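(* Let $n\ge1$, $\epsilon>0$, and let $F=F(r,s,p,M)$ be a $C^1$ function on $(0,1+\epsilon)\times\mathbb{R}\times\mathbb{R}^n\times\mathcal{S}^{n\times n}$ such that the matrix $\left(-\frac{\partial F}{\partial M_{ij}}(r,s,p,M)\right)$ is positive definite for all $(r,s,p,M)$ in this set. Assume $$\frac{\partial}{\partial r}F(r,s,p,M)\ge0\qquad\text{for all }0<r<1+\epsilon,\ s>0,\ p\in\mathbb{R}^n,\ M\in\mathcal{S}^{n\times n},$$ and $$F(r,s,O^tp,O^tMO)=F(r,s,p,M)\qquad\text{for all }0<r<1+\epsilon,\ s>0,\ p\in\mathbb{R}^n,\ M\in\mathcal{S}^{n\times n},\ O\in O(n).$$ Let $u\in C^2(\overline{B}_1\setminus\{0\})$ satisfy, for some $0<\bar r\le1$: for every $V\in\mathbb{R}^n$, the function $w(x):=u(x)+V\cdot x$ satisfies $\inf_{B_r\setminus\{0\}}w=\min_{\partial B_r}w$ for all $0<r<\bar r$. Assume also $$F(|x|,u,\nabla u,\nabla^2u)=0,\quad u>0\qquad\text{in }B_1\setminus\{0\},$$ and $u=0$ on $\partial B_1$. Then $u$ is radially symmetric about the origin and, writing $u=u(r)$ with $r=|x|$, $u'(r)<0$ for $0<r<1$.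
   Context: $B_r$ is the open ball of radius $r$ centered at the origin of $\mathbb{R}^n$. $\mathcal{S}^{n\times n}$ is the set of real symmetric $n\times n$ matrices, and $O(n)$ is the group of real orthogonal $n\times n$ matrices. *)

(* Defs.v *)
From HB Require Import structures.
From mathcomp Require Import all_boot all_order all_algebra.
From mathcomp Require Import all_classical all_reals all_analysis.
Set Implicit Arguments.
Unset Strict Implicit.
Unset Printing Implicit Defensive.
Import Order.TTheory GRing.Theory Num.Theory.
Import numFieldNormedType.Exports.
Local Open Scope classical_set_scope.
Local Open Scope ring_scope.

(* Points of R^n are column vectors. The library norm `|x| on 'cV[R]_n is the
   sup norm, hence the explicit Euclidean norm; the two are equivalent, so
   continuity and differentiability are the usual ones. *)
Definition dotv (R : realType) (n : nat) (x y : 'cV[R]_n) : R :=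
  \sum_(i < n) x i 0 * y i 0.

Definition enorm (R : realType) (n : nat) (x : 'cV[R]_n) : R :=
  Num.sqrt (dotv x x).

Definition punctured_ball (R : realType) (n : nat) (r : R) : set 'cV[R]_n :=
  [set x | 0 < enorm x < r].

Definition punctured_cball (R : realType) (n : nat) (r : R) : set 'cV[R]_n :=
  [set x | 0 < enorm x <= r].

Definition esphere (R : realType) (n : nat) (r : R) : set 'cV[R]_n :=
  [set x | enorm x = r].

Definition real_orthomx (R : realType) (n : nat) (O : 'M[R]_n) : Prop :=
  O^T *m O = 1%:M.

Definition posdefmx (R : realType) (n : nat) (A : 'M[R]_n) : Prop :=
  A^T = A /\ forall v : 'cV[R]_n, v != 0 -> 0 < (v^T *m A *m v) 0 0.

Definition grad (R : realType) (n : nat) (u : 'cV[R]_n -> R) (x : 'cV[R]_n) :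
    'cV[R]_n :=
  \col_(i < n) 'D_(delta_mx i 0) u x.

Definition hess (R : realType) (n : nat) (u : 'cV[R]_n -> R) (x : 'cV[R]_n) :
    'M[R]_n :=
  \matrix_(i < n, j < n)
    'D_(delta_mx j 0) (fun y => 'D_(delta_mx i 0) u y) x.

(* C^1 and C^2 on an open set U. *)
Definition C1_on (R : realType) (V : normedModType R) (U : set V) (f : V -> R) :
    Prop :=
  (forall x, U x -> differentiable f x) /\
  (forall v : V, {within U, continuous (fun x => 'D_v f x)}).

Definition C2_on (R : realType) (V : normedModType R) (U : set V) (f : V -> R) :
    Prop :=
  C1_on U f /\ forall v : V, C1_on U (fun x => 'D_v f x).

(* C^2 on a set K with U `<=` K `<=` closure U, U open: f is continuous on K
   and C^2 on U, and its derivatives of order 1 and 2 extend continuously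
   from U to K. *)
Definition extends_cont (R : realType) (V : normedModType R) (U K : set V)
    (f : V -> R) : Prop :=
  exists g : V -> R,
    {within K, continuous g} /\ (forall x, U x -> g x = f x).

Definition C2_upto (R : realType) (V : normedModType R) (U K : set V)
    (f : V -> R) : Prop :=
  [/\ C2_on U f,
      {within K, continuous f},
      forall v : V, extends_cont U K (fun x => 'D_v f x) &
      forall v w : V,
        extends_cont U K (fun x => 'D_w (fun y => 'D_v f y) x)].

Definition sympart (R : realType) (n : nat) (M : 'M[R]_n) : 'M[R]_n :=
  2^-1 *: (M + M^T).

(* Only the values of F at symmetric matrices are meaningful. Differentiability
   on S^{n x n} is expressed by composing F with the orthogonal projection
   sympart of 'M_n onto S^{n x n}: F is C^1 on an open subset of
   R x R x R^n x S^{n x n} iff the composite is C^1 on its preimage. The matrix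
   dFdM is the gradient of F in M for the inner product \tr (M *m N): for
   N symmetric, the derivative of F at M along N is
   \sum_(i, j) dFdM i j * N i j. *)
Definition symF_uncurried (R : realType) (n : nat)
    (F : R -> R -> 'cV[R]_n -> 'M[R]_n -> R)
    (z : R * R * 'cV[R]_n * 'M[R]_n) : R :=
  F z.1.1.1 z.1.1.2 z.1.2 (sympart z.2).

Definition dFdM (R : realType) (n : nat)
    (F : R -> R -> 'cV[R]_n -> 'M[R]_n -> R)
    (r s : R) (p : 'cV[R]_n) (M : 'M[R]_n) : 'M[R]_n :=
  \matrix_(i < n, j < n)
    'D_(delta_mx i j) (fun N : 'M[R]_n => F r s p (sympart N)) M.

(* Main.v *)
(** Moving planes. For a unit vector e and lam > 0 let x' be the reflection of x in
    the hyperplane x.e = lam, and put v x = u x' and f = u - v. By monotonicity in r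
    and invariance under reflections, u and v satisfy at |x'| a differential
    inequality and the equation respectively, so f cannot be touched from below by a
    strict subsolution of the linearized operator. Near the origin u may be singular,
    but at a touching point the jet of u is comparable to that of v, so only jets of
    v enter. A narrow strip estimate near the hyperplane together with strict
    positivity of f away from it shows that the set of lam with f >= 0 is open to the
    left, hence f >= 0 for all lam in (0, 1). Letting lam tend to 0 gives radial
    symmetry, and a Hopf barrier at lam e gives the sign of the derivative. *)

Require Import Defs.
From mathcomp Require Import all_boot all_order all_algebra.
From mathcomp Require Import all_classical all_reals all_analysis.
From mathcomp Require Import ring lra.
Set Implicit Arguments.
Unset Strict Implicit.
Unset Printing Implicit Defensive.
Import Order.TTheory GRing.Theory Num.Theory.
Import numFieldNormedType.Exports.
Local Open Scope classical_set_scope.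
Local Open Scope ring_scope.

(** The obstacle is the origin, which enters the cap once [lam <= 1/2]. The value of [u] there is
    arbitrary, so pointwise positivity of [f] on the cap says nothing about [f] close to it.
    Positivity is therefore stated as a positive lower bound on a punctured neighbourhood, a
    condition that is open in the centre. The barrier [l + A l^2 - |x - z|^2], with [l = (z - x).e],
    can be positive on a small sphere about [z] only strictly behind [z]. Positivity thus spreads
    towards the hyperplane from the points farther away, and no connectedness argument is needed. At
    the origin the infimum of [f - barrier] over the punctured ball may not be attained, so there
    may be no touching point. The family of linear functions [V.x] in the singularity hypothesis
    makes up for it: barriers tilted by small linear terms trade a nonpositive infimum for a strict
    conical minimum at the origin, and subtracting the tangent plane of a smooth function there
    turns this into a violation of the hypothesis. *)

Lemma continuous_sumx (R : realType) (T : topologicalType) (I : Type) (r : seq I)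
    (f : I -> T -> R) (t : T) :
  (forall i, {for t, continuous (f i)}) ->
  {for t, continuous (fun s => \sum_(i <- r) f i s)}.
Proof.
move=> cf; elim: r => [|i r IH].
  rewrite (_ : (fun s => _) = cst 0); first exact: cst_continuous.
  by apply/funext => s; rewrite big_nil.
rewrite (_ : (fun s => _) = f i \+ (fun s => \sum_(i <- r) f i s)).
  exact: continuousD.
by apply/funext => s; rewrite big_cons.
Qed.

(** * Euclidean dot product and norm *)

Section Euclid.
Variables (R : realType) (n : nat).
Implicit Types (x y z w : 'cV[R]_n) (M : 'M[R]_n).

Lemma dotvC x y : dotv x y = dotv y x.
Proof. by apply: eq_bigr => i _; rewrite mulrC. Qed.

Lemma dotvDl x y z : dotv (x + y) z = dotv x z + dotv y z.
Proof. by rewrite -big_split; apply: eq_bigr => i _; rewrite mxE mulrDl. Qed.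

Lemma dotvZl (k : R) x y : dotv (k *: x) y = k * dotv x y.
Proof. by rewrite mulr_sumr; apply: eq_bigr => i _; rewrite mxE mulrA. Qed.

Lemma dotvNl x y : dotv (- x) y = - dotv x y.
Proof. by rewrite -scaleN1r dotvZl mulN1r. Qed.

Lemma dotvBl x y z : dotv (x - y) z = dotv x z - dotv y z.
Proof. by rewrite dotvDl dotvNl. Qed.

Lemma dotvDr x y z : dotv z (x + y) = dotv z x + dotv z y.
Proof. by rewrite dotvC dotvDl !(dotvC z). Qed.

Lemma dotvZr (k : R) x y : dotv y (k *: x) = k * dotv y x.
Proof. by rewrite dotvC dotvZl dotvC. Qed.

Lemma dotvNr x y : dotv x (- y) = - dotv x y.
Proof. by rewrite dotvC dotvNl dotvC. Qed.

Lemma dotvBr x y z : dotv z (x - y) = dotv z x - dotv z y.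
Proof. by rewrite dotvDr dotvNr. Qed.

Lemma dotv0l x : dotv 0 x = 0.
Proof. by rewrite -(scale0r 0) dotvZl mul0r. Qed.

Lemma dotv0r x : dotv x 0 = 0.
Proof. by rewrite dotvC dotv0l. Qed.

Definition dotvE := (dotvDl, dotvDr, dotvBl, dotvBr, dotvNl, dotvNr, dotvZl, dotvZr,
  dotv0l, dotv0r).

Lemma dotvv_ge0 x : 0 <= dotv x x.
Proof. by apply: sumr_ge0 => i _; rewrite -expr2 sqr_ge0. Qed.

Lemma dotvv_eq0 x : (dotv x x == 0) = (x == 0).
Proof.
apply/eqP/eqP => [|->]; last exact: dotv0l.
move/eqP; rewrite psumr_eq0 => [/allP h|i _]; last by rewrite -expr2 sqr_ge0.
apply/colP => i; rewrite mxE; have /implyP := h i (mem_index_enum _).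
by rewrite mulf_eq0 orbb => /(_ isT)/eqP.
Qed.

Lemma dotvv_gt0 x : (0 < dotv x x) = (x != 0).
Proof. by rewrite lt_def dotvv_ge0 andbT dotvv_eq0. Qed.

Lemma enorm_ge0 x : 0 <= enorm x.
Proof. exact: sqrtr_ge0. Qed.

Lemma enorm_sqr x : enorm x ^+ 2 = dotv x x.
Proof. by rewrite sqr_sqrtr ?dotvv_ge0. Qed.

Lemma enorm_gt0 x : (0 < enorm x) = (x != 0).
Proof. by rewrite sqrtr_gt0 dotvv_gt0. Qed.

Lemma enorm0 : enorm (0 : 'cV[R]_n) = 0.
Proof. by rewrite /enorm dotv0l sqrtr0. Qed.

Lemma enormZ (k : R) x : enorm (k *: x) = `|k| * enorm x.
Proof. by rewrite /enorm dotvZl dotvZr mulrA -expr2 sqrtrM ?sqr_ge0 // sqrtr_sqr. Qed.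

Lemma enormN x : enorm (- x) = enorm x.
Proof. by rewrite -scaleN1r enormZ normrN1 mul1r. Qed.

(** The square of [<y,y> x - <x,y> y] is [<y,y>] times the Gram determinant of [x] and [y]. *)
Lemma dotv_CS x y : dotv x y <= enorm x * enorm y.
Proof.
have [->|y0] := eqVneq y 0; first by rewrite dotv0r enorm0 mulr0.
rewrite -dotvv_gt0 in y0.
apply: le_trans (ler_norm _) _.
rewrite -[leLHS]sqrtr_sqr -sqrtrM ?dotvv_ge0 // ler_wsqrtr //.
have := dotvv_ge0 (dotv y y *: x - dotv x y *: y).
rewrite !dotvE (dotvC y x) => h.
suff : 0 <= dotv y y * (dotv x x * dotv y y - dotv x y ^+ 2).
  by rewrite pmulr_rge0 // subr_ge0.
by move: h; congr (_ <= _); ring.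
Qed.

Lemma dotv_CSN x y : - (enorm x * enorm y) <= dotv x y.
Proof. by rewrite lerNl -dotvNl (le_trans (dotv_CS _ _)) // enormN. Qed.

Lemma ler_enormD x y : enorm (x + y) <= enorm x + enorm y.
Proof.
rewrite -(@ler_pXn2r _ 2) ?nnegrE ?addr_ge0 ?enorm_ge0 //.
rewrite enorm_sqr sqrrD !enorm_sqr !dotvE (dotvC y x).
have := dotv_CS x y; lra.
Qed.

Lemma ler_enormB x y : enorm x - enorm y <= enorm (x - y).
Proof. by rewrite lerBlDr (le_trans _ (ler_enormD _ _)) // subrK. Qed.

Lemma enormBC x y : enorm (x - y) = enorm (y - x).
Proof. by rewrite -enormN opprB. Qed.

Lemma mx_norm_leP m p (N : 'M[R]_(m, p)) (C : R) : 0 <= C ->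
  (`|N| <= C) <-> (forall i j, `|N i j| <= C).
Proof.
move=> C0; split => [h i j|h].
  by apply: le_trans h; rewrite [leRHS]/Num.norm/= mx_normrE; exact: (le_bigmax _ (fun ij => `|N ij.1 ij.2|) (i, j)).
by rewrite [leLHS]/Num.norm/= mx_normrE; apply: bigmax_le => // -[i j] _.
Qed.

Lemma coord_le_enorm x i : `|x i 0| <= enorm x.
Proof.
rewrite -sqrtr_sqr ler_wsqrtr // /dotv (bigD1 i) //= -expr2 lerDl.
by apply: sumr_ge0 => j _; rewrite -expr2 sqr_ge0.
Qed.

Lemma norm_le_enorm x : `|x| <= enorm x.
Proof.
apply/mx_norm_leP; first exact: enorm_ge0.
by move=> i j; rewrite ord1 coord_le_enorm.
Qed.

Lemma continuous_dotv (T : topologicalType) (f g : T -> 'cV[R]_n) (t : T) :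
  {for t, continuous f} -> {for t, continuous g} ->
  {for t, continuous (fun s => dotv (f s) (g s))}.
Proof.
move=> cf cg; rewrite /dotv.
apply: (@continuous_sumx) => i; apply: continuousM.
  exact: (@continuous_comp _ _ _ f (fun y : 'cV[R]_n => y i 0) t cf (@coord_continuous _ _ _ i 0 _)).
exact: (@continuous_comp _ _ _ g (fun y : 'cV[R]_n => y i 0) t cg (@coord_continuous _ _ _ i 0 _)).
Qed.

Lemma continuous_enorm x : {for x, continuous (@enorm R n)}.
Proof.
apply: (@continuous_comp _ _ _ (fun y => dotv y y) Num.sqrt); last exact: sqrt_continuous.
by apply: continuous_dotv; exact: cvg_id.
Qed.

End Euclid.

(** * Compactness of closed bounded sets *)

Section Compactness.
Variable R : realType.

Lemma continuous_vec_mx m n : continuous (@vec_mx R m n).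
Proof.
move=> v; apply/(@cvgrPdist_le _ _ _ (nbhs v) (nbhs_filter v)) => e e0.
apply: filterS (nbhsx_ballx v e e0) => w; rewrite -ball_normE /= => vw.
rewrite -linearB /=; apply/mx_norm_leP => [|i j]; first exact: ltW.
by rewrite mxE; move/ltW/mx_norm_leP: vw => -> //; exact: ltW.
Qed.

(** Heine-Borel for row vectors is carried over by [vec_mx], an isometry for the sup norms. *)
Lemma compact_mx_box m n (C : R) : compact [set M : 'M[R]_(m, n) | `|M| <= C].
Proof.
have [C0|C0] := ltP C 0.
  rewrite [X in compact X](_ : _ = set0); first exact: compact0.
  rewrite -subset0 => M /= h.
  by have := le_lt_trans (normr_ge0 M) (le_lt_trans h C0); rewrite ltxx.
rewrite [X in compact X](_ : _ = vec_mx @` [set v : 'rV[R]_(m * n) | `|v| <= C]); last first.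
  apply/seteqP; split => [M /= h|_ [v /= h <-]].
    exists (mxvec M); last exact: mxvecK.
    apply/mx_norm_leP => // i j; rewrite ord1.
    by case/mxvec_indexP: j => i' j'; rewrite mxvecE; move/mx_norm_leP: h; apply.
  by apply/mx_norm_leP => // i j; rewrite mxE; move/mx_norm_leP: h; apply.
apply: continuous_compact.
  apply: continuous_subspaceT; exact: continuous_vec_mx.
apply: bounded_closed_compact.
  by exists C; split; [exact: num_real|move=> x Cx v /= h; exact: le_trans h (ltW Cx)].
by apply: closed_comp (@closed_le _ C) => v _; exact: norm_continuous.
Qed.

Lemma compact_sublevel n (A : set 'cV[R]_n) (C : R) :
  closed A -> (forall x, A x -> enorm x <= C) -> compact A.
Proof.
move=> cA h; apply: (subclosed_compact cA (@compact_mx_box n 1 C)).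
by move=> x /h; exact: le_trans (norm_le_enorm x).
Qed.

End Compactness.

(** * Derivatives along lines and the second order test at a minimum *)

Section LineDerivatives.
Variables (R : realType) (V : normedModType R).
Implicit Types (f g : V -> R) (x y v w a b : V).

(** A directional derivative sees a function along one line only, and that line may be mapped into
    another space. This carries derivatives through reflections and between the space of jets and a
    single variable, without a chain rule and without differentiability. *)
Lemma derive_congr (W : normedModType R) f (g : W -> R) x v (y w : W) :
  (forall h : R, f (h *: v + x) = g (h *: w + y)) -> 'D_v f x = 'D_w g y.
Proof.
move=> fg; rewrite /derive.
suff -> : (fun h => h^-1 *: ((f \o shift x) (h *: v) - f x)) =
  (fun h => h^-1 *: ((g \o shift y) (h *: w) - g y)) by [].
apply/funext => h /=; rewrite fg; congr (_ *: (_ - _)).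
by rewrite -[x in LHS]add0r -(scale0r v) fg scale0r add0r.
Qed.

Lemma derivable_congr (W : normedModType R) f (g : W -> R) x v (y w : W) :
  (forall h : R, f (h *: v + x) = g (h *: w + y)) ->
  derivable g y w -> derivable f x v.
Proof.
move=> fg; rewrite /derivable.
suff -> : (fun h => h^-1 *: ((f \o shift x) (h *: v) - f x)) =
  (fun h => h^-1 *: ((g \o shift y) (h *: w) - g y)) by [].
apply/funext => h /=; rewrite fg; congr (_ *: (_ - _)).
by rewrite -[x in LHS]add0r -(scale0r v) fg scale0r add0r.
Qed.

End LineDerivatives.

Section LineMVT.
Variables (R : realType) (V : normedModType R).
Implicit Types (f g : V -> R) (x y v w a b : V).

Lemma is_derive_line f x w (t : R) : derivable f (x + t *: w) w ->
  is_derive t 1 (fun s : R => f (x + s *: w)) ('D_w f (x + t *: w)).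
Proof.
have e (h : R) : f (x + (h *: (1 : R) + t) *: w) = f (h *: w + (x + t *: w)).
  by congr f; rewrite scalerDl addrCA [h *: (1 : R)]mulr1.
move=> df; apply: DeriveDef.
  exact: (@derivable_congr R R^o V (fun s : R => f (x + s *: w)) f t 1 _ w e df).
exact: (@derive_congr R R^o V (fun s : R => f (x + s *: w)) f t 1 _ w e).
Qed.

Lemma MVT_line f x w (h : R) : 0 < h ->
  (forall t, 0 <= t <= h -> derivable f (x + t *: w) w) ->
  exists2 t, 0 < t < h & f (x + h *: w) - f x = h * 'D_w f (x + t *: w).
Proof.
move=> h0 df.
have [||t] := @MVT R (fun s => f (x + s *: w)) (fun s => 'D_w f (x + s *: w)) 0 h h0.
- by move=> t; rewrite in_itv /= => /andP[t0 th]; apply/is_derive_line/df; rewrite !ltW.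
- apply: derivable_within_continuous => t; rewrite in_itv /= => th.
  by have [] := is_derive_line (df _ th).
rewrite in_itv /= => th; rewrite scale0r addr0 subr0 mulrC => e.
by exists t.
Qed.

End LineMVT.

Section SecondOrder.
Variable R : realType.

(** If [g2 < 0], then [g1] is negative just to the right of 0, and the mean value theorem puts [g]
    below [g 0] there. *)
Lemma second_order_min1 (g g1 : R -> R) (g2 d : R) : 0 < d ->
  (forall t : R, `|t| < d -> is_derive t (1 : R) g (g1 t)) ->
  is_derive (0 : R) (1 : R) g1 g2 ->
  (forall t, `|t| < d -> g 0 <= g t) -> g1 0 = 0 /\ 0 <= g2.
Proof.
move=> d0 dg dg1 gmin.
have itvE t : t \in `](- d), d[ = (`|t| < d) by rewrite in_itv /= ltr_norml.
have g10 : g1 0 = 0.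
  have h0 : (0 : R) \in `](- d), d[ by rewrite itvE normr0.
  have gd (t : R) : t \in `](- d), d[ -> derivable g t 1 by rewrite itvE => /dg[].
  have gm (t : R) : t \in `](- d), d[ -> g 0 <= g t by rewrite itvE; exact: gmin.
  have dd : - d <= d by move: d0; lra.
  have [_ D0] := derive1_at_min dd gd h0 gm.
  have dg0 : is_derive (0 : R) (1 : R) g (g1 0) by apply: dg; rewrite normr0.
  by have [_ <-] := dg0.
split => //; rewrite leNgt; apply/negP => g20.
have [dg1' e2] := dg1.
have : (fun h : R => h^-1 *: (g1 (h *: (1 : R) + 0) - g1 0)) @ 0^' --> g2.
  by rewrite -e2; exact: dg1'.
move/cvgr_lt => /(_ 0 g20) [e /= e0 he].
pose h := Num.min d e / 2.
have h0 : 0 < h by rewrite divr_gt0 // lt_min d0.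
have hd : h < d by rewrite ltr_pdivrMr // gt_min; apply/orP; left; move: d0; lra.
have hE : h < e by rewrite ltr_pdivrMr // gt_min; apply/orP; right; move: e0; lra.
have [||t] := @MVT R g g1 0 h h0.
- move=> t; rewrite in_itv /= => /andP[t0 th]; apply: dg.
  by rewrite gtr0_norm // (lt_trans th).
- apply: derivable_within_continuous => t; rewrite in_itv /= => /andP[t0 th].
  by have [|] := dg t; rewrite // ger0_norm // (le_lt_trans th).
rewrite in_itv /= => /andP[t0 th]; rewrite subr0 => e1.
have : g1 t < 0.
  have := he t; rewrite /ball_ /= sub0r normrN gtr0_norm // => /(_ (lt_trans th hE)).
  rewrite g10 subr0 addr0 [t *: (1 : R)]mulr1 => /(_ (lt0r_neq0 t0)).
  by rewrite [_ *: _]mulrC pmulr_llt0 ?invr_gt0.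
move=> g1t; have : g 0 <= g h by apply: gmin; rewrite gtr0_norm.
by rewrite leNgt -subr_lt0 e1 pmulr_llt0 // g1t.
Qed.

Lemma second_order_min (V : normedModType R) (f : V -> R) (x w : V) :
  (\forall y \near x, derivable f y w) -> derivable ('D_w f) x w ->
  (\forall y \near x, f x <= f y) -> 'D_w f x = 0 /\ 0 <= 'D_w ('D_w f) x.
Proof.
move=> df d2f fmin.
have cl : (fun t : R => x + t *: w) @ (0 : R) --> x.
  rewrite -[X in _ --> X]addr0 -[X in _ --> _ + X](scale0r w).
  apply: cvgD; first exact: cvg_cst.
  by apply: cvgZr_tmp; exact: cvg_id.
have : \forall t \near (0 : R), derivable f (x + t *: w) w /\ f x <= f (x + t *: w).
  by apply: (cl _ (filterI df fmin)).
move=> [d /= d0 hd].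
have hd' t : `|t| < d -> derivable f (x + t *: w) w /\ f x <= f (x + t *: w).
  by move=> td; apply: hd; rewrite /ball_ /= sub0r normrN.
have ex : x + 0 *: w = x by rewrite scale0r addr0.
have := @second_order_min1 (fun t => f (x + t *: w)) (fun t => 'D_w f (x + t *: w))
  ('D_w ('D_w f) x) d d0.
rewrite ex; apply.
- by move=> t /hd'[? _]; exact: is_derive_line.
- by have := @is_derive_line R V ('D_w f) x w 0; rewrite ex; apply.
- by move=> t /hd'[].
Qed.

End SecondOrder.

Lemma ler_dist_half (R : realFieldType) (p q r s k : R) :
  `|p - r| <= k / 2 -> `|q - s| <= k / 2 -> r = s -> `|p - q| <= k.
Proof.
move=> + + rs; rewrite rs !ler_norml => /andP[? ?] /andP[? ?].
by apply/andP; split; lra.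
Qed.

(** * Symmetry of mixed second derivatives *)

Section Schwarz.
Variables (R : realType) (V : normedModType R) (U : set V) (f : V -> R).
Hypothesis df : forall x v, U x -> derivable f x v.
Hypothesis d2f : forall x v w, U x -> derivable ('D_v f) x w.

(** Two mean value theorems: along [a] for the increment of [f] in direction [b], then along [b] for
    ['D_a f]. The left side is symmetric in [a] and [b], and the symmetry of the Hessian rests on
    that. *)
Lemma second_difference x a b (h : R) : 0 < h ->
  (forall s t, 0 <= s <= h -> 0 <= t <= h -> U (x + s *: a + t *: b)) ->
  exists s t, [/\ 0 <= s <= h, 0 <= t <= h &
    f (x + h *: a + h *: b) - f (x + h *: a) - f (x + h *: b) + f x =
    h ^+ 2 * 'D_b ('D_a f) (x + s *: a + t *: b)].
Proof.
move=> h0 hU; have h00 : 0 <= h <= h by rewrite ltW /=.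
have Uh0 s : 0 <= s <= h -> U (x + s *: a).
  by move=> sh; have := hU s 0 sh; rewrite scale0r addr0 lexx ltW //; apply.
pose g y := f (y + h *: b) - f y.
have sh s : 0 <= s <= h -> is_derive (x + s *: a) a (fun y => f (y + h *: b))
    ('D_a f (x + s *: a + h *: b)).
  move=> sh.
  have e (k : R) : f (k *: a + (x + s *: a) + h *: b) = f (k *: a + (x + s *: a + h *: b)).
    by rewrite !addrA.
  apply: DeriveDef; last exact: (derive_congr e).
  by apply: (derivable_congr e); apply/df/hU.
have [|s s1 es] := @MVT_line R V g x a h h0.
  move=> s s1; apply: derivableB; last exact/df/Uh0.
  by have [] := sh _ s1.
have sh1 : 0 <= s <= h by case/andP: s1 => ? ?; rewrite !ltW.
have [|t t1 et] := @MVT_line R V ('D_a f) (x + s *: a) b h h0.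
  by move=> t t1; apply/d2f/hU.
exists s, t; split => //; first by case/andP: t1 => ? ?; rewrite !ltW.
move: es; rewrite /g deriveB; [|by have [] := sh _ sh1|exact/df/Uh0].
have [_ ->] := sh _ sh1; rewrite et expr2 -mulrA => <-.
by rewrite opprB addrA (addrAC _ _ (f x)) addrAC (addrAC x).
Qed.

(** The second difference, taken in both orders, equates the two mixed derivatives at two possibly
    different points of a small parallelogram; continuity at [x] then identifies their values at
    [x]. *)
Lemma Schwarz_derive x a b : open U -> U x ->
  {for x, continuous ('D_b ('D_a f))} -> {for x, continuous ('D_a ('D_b f))} ->
  'D_b ('D_a f) x = 'D_a ('D_b f) x.
Proof.
move=> oU Ux cba cab.
apply/eqP; rewrite -subr_eq0 -normr_le0; apply/ler_addgt0Pl => e e0; rewrite addr0.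
have e20 : 0 < e / 2 by rewrite divr_gt0.
have /nbhs_ballP[d /= d0 hd] : nbhs x [set y | [/\ U y,
   `|'D_b ('D_a f) x - 'D_b ('D_a f) y| <= e / 2 &
   `|'D_a ('D_b f) x - 'D_a ('D_b f) y| <= e / 2]].
  have h1 : nbhs x [set y | U y] by apply: open_nbhs_nbhs; split.
  have /cvgr_dist_le /(_ _ e20) h2 := cba.
  have /cvgr_dist_le /(_ _ e20) h3 := cab.

  apply: (@filterS _ _ (nbhs_filter x) _ _ _ (filterI h1 (filterI h2 h3))) => y [Uy [A B]].
  split; [exact: Uy|exact: A|exact: B].
(* With this side the parallelogram stays in the ball of radius [d]; the summand 1 covers
   [a = b = 0]. *)
pose h := d / (`|a| + `|b| + 1) / 2.
have ab0 : 0 < `|a| + `|b| + 1 by rewrite ltr_pwDr // addr_ge0.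
have h0 : 0 < h by rewrite !divr_gt0.
have hab : h * (`|a| + `|b|) < d.
  have -> : d = h * ((`|a| + `|b| + 1) * 2) by rewrite /h; field; lra.
  by rewrite ltr_pM2l //; have := normr_ge0 a; have := normr_ge0 b; lra.
have hball s t : 0 <= s <= h -> 0 <= t <= h -> ball x d (x + s *: a + t *: b).
  move=> /andP[s0 sh] /andP[t0 th]; rewrite -ball_normE /= -addrA opprD addNKr normrN.
  apply: le_lt_trans (ler_normD _ _) (le_lt_trans _ hab).
  by rewrite !normrZ !ger0_norm // mulrDr lerD // ler_wpM2r.
have [|s [t [s1 t1 e1]]] := @second_difference x a b h h0.
  by move=> s t s1 t1; have [] := hd _ (hball _ _ s1 t1).
have [|t' [s' [t1' s1' e2]]] := @second_difference x b a h h0.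
  by move=> t' s' t1' s1'; rewrite addrAC; have [] := hd _ (hball _ _ s1' t1').
have xc (s0 t0 : R) : x + t0 *: b + s0 *: a = x + s0 *: a + t0 *: b by rewrite addrAC.
rewrite !xc in e2.
have [_ A _] := hd _ (hball _ _ s1 t1).
have [_ _ B] := hd _ (hball _ _ s1' t1').
have E : 'D_b ('D_a f) (x + s *: a + t *: b) = 'D_a ('D_b f) (x + s' *: a + t' *: b).
  apply: (mulfI (lt0r_neq0 (exprn_gt0 2 h0))); apply: etrans (esym e1) (etrans _ e2).
  by rewrite (addrAC (f _)).
exact: (ler_dist_half A B E).
Qed.

End Schwarz.

Section MatrixDerivatives.
Variable R : realType.

Lemma derive_mxE m n (f : 'M[R]_(m, n) -> R) (x w : 'M[R]_(m, n)) : differentiable f x ->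
  'D_w f x = \sum_i \sum_j w i j * 'D_(delta_mx i j) f x.
Proof.
move=> df; rewrite deriveE // [in LHS](matrix_sum_delta w) linear_sum.
apply: eq_bigr => i _; rewrite linear_sum; apply: eq_bigr => j _.
by rewrite linearZ /= deriveE.
Qed.

Lemma derive_gradE n (f : 'cV[R]_n -> R) x w : differentiable f x ->
  'D_w f x = dotv (grad f x) w.
Proof.
move=> df; rewrite derive_mxE //; apply: eq_bigr => i _.
by rewrite big_ord1 mxE mulrC.
Qed.

Lemma differentiable_expansion (V : normedModType R) (f : V -> R) x (e : R) :
  differentiable f x -> 0 < e ->
  \forall h \near (0 : V), `|f (x + h) - f x - 'D_h f x| <= e * `|h|.
Proof.
move=> df e0; have /diff_locallyP[_ /eqaddoP /(_ e e0)] := df.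
apply: filterS => h; rewrite deriveE //.
by rewrite /= !fctE /= opprD addrA (addrC h).
Qed.

Lemma is_derive_quadratic (V : normedModType R) (f : V -> R) x v (c0 c1 c2 : R) :
  (forall h : R, f (h *: v + x) = c0 + h * c1 + h ^+ 2 * c2) -> is_derive x v f c1.
Proof.
move=> fE; pose g (h : R) := c0 + h * c1 + h ^+ 2 * c2.
have e (h : R) : f (h *: v + x) = g (h *: (1 : R) + 0).
  by rewrite fE /g addr0 [h *: (1 : R)]mulr1.
have dg : is_derive (0 : R) (1 : R) g c1.
  rewrite /g; apply: is_derive_eq.
  by rewrite /GRing.scale /=; ring.
apply: DeriveDef; first by apply: (derivable_congr e); have [] := dg.
by rewrite (derive_congr e); have [] := dg.
Qed.

End MatrixDerivatives.

(** * Second order jets and their comparison at a minimum *)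

Section Jets.
Variables (R : realType) (n : nat).
Implicit Types (f g : 'cV[R]_n -> R) (x y w p q : 'cV[R]_n) (M N : 'M[R]_n).

(** Only first and second derivatives along single lines enter, so [M] counts only through its
    quadratic form. This is all that the test at a minimum uses, and such jets are easy to subtract
    and to reflect. *)
Definition has_jet f x p M :=
  [/\ \forall y \near x, forall w, derivable f y w,
      forall w, derivable ('D_w f) x w,
      forall w, 'D_w f x = dotv p w &
      forall w, 'D_w ('D_w f) x = dotv w (M *m w)].

Lemma dotv_mulmx a b M : dotv a (M *m b) = \sum_i \sum_j a i 0 * b j 0 * M i j.
Proof.
apply: eq_bigr => i _; rewrite mxE mulr_sumr; apply: eq_bigr => j _; ring.
Qed.

Lemma dotv_trmx a b M : dotv a (M *m b) = dotv (M^T *m a) b.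
Proof.
rewrite dotv_mulmx exchange_big dotvC dotv_mulmx /=; apply: eq_bigr => i _.
by apply: eq_bigr => j _; rewrite mxE; ring.
Qed.

Section C2.
Variables (U : set 'cV[R]_n) (f : 'cV[R]_n -> R).
Hypotheses (oU : open U) (fC2 : C2_on U f).

Lemma C2_differentiable x : U x -> differentiable f x.
Proof. by have [[h _] _] := fC2; exact: h. Qed.

Lemma C2_differentiable2 x w : U x -> differentiable ('D_w f) x.
Proof. by have [_ h] := fC2; have [h1 _] := h w; exact: h1. Qed.

Lemma C2_continuous1 x w : U x -> {for x, continuous ('D_w f)}.
Proof. by move=> Ux; exact/differentiable_continuous/C2_differentiable2. Qed.

Lemma C2_continuous2 x a b : U x -> {for x, continuous ('D_b ('D_a f))}.
Proof.
move=> Ux; have [_ /(_ a)[_ /(_ b)]] := fC2.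
by rewrite continuous_open_subspace //; apply; rewrite inE.
Qed.

Lemma C2_derive2E x a b : U x -> 'D_b ('D_a f) x = dotv a (hess f x *m b).
Proof.
move=> Ux; have nU : nbhs x U by apply: open_nbhs_nbhs; split.
have e : {near x, 'D_a f =1 (\sum_i (a i 0 *: ('D_(delta_mx i 0) f)))}.
  apply: filterS nU => y Uy; rewrite derive_gradE; last exact: C2_differentiable.
  by rewrite fct_sumE; apply: eq_bigr => i _; rewrite mxE mulrC.
rewrite (near_eq_derive b e) derive_sum; last first.
  by move=> i; apply/derivableZ/diff_derivable/C2_differentiable2.
apply: eq_bigr => i _; rewrite deriveZ; last exact/diff_derivable/C2_differentiable2.
rewrite derive_gradE; last exact: C2_differentiable2.
congr (_ * _); rewrite !mxE; apply: eq_bigr => j _; by rewrite !mxE.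
Qed.

Lemma hess_sym x : U x -> (hess f x)^T = hess f x.
Proof.
move=> Ux; apply/matrixP => i j; rewrite !mxE.
apply: (Schwarz_derive _ _ oU Ux) => [y v Uy|y v w Uy||].
- exact/diff_derivable/C2_differentiable.
- exact/diff_derivable/C2_differentiable2.
- exact: C2_continuous2.
- exact: C2_continuous2.
Qed.

Lemma C2_has_jet x : U x -> has_jet f x (grad f x) (hess f x).
Proof.
move=> Ux; split.
- have nU : nbhs x U by apply: open_nbhs_nbhs; split.
  by apply: filterS nU => y Uy w; exact/diff_derivable/C2_differentiable.
- by move=> w; exact/diff_derivable/C2_differentiable2.
- by move=> w; exact/derive_gradE/C2_differentiable.
- by move=> w; rewrite C2_derive2E.
Qed.

End C2.

Lemma has_jetB f g x p q M N : has_jet f x p M -> has_jet g x q N ->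
  has_jet (fun y => f y - g y) x (p - q) (M - N).
Proof.
move=> [df d2f ep eM] [dg d2g eq eN].
have e w : {near x, 'D_w (fun y => f y - g y) =1 'D_w f \- 'D_w g}.
  by apply: filterS2 df dg => y dfy dgy; exact: deriveB.
have e' w : {near x, 'D_w f \- 'D_w g =1 'D_w (fun y => f y - g y)}.
  by apply: filterS (e w).
split.
- by apply: filterS2 df dg => y dfy dgy w; exact: derivableB.
- by move=> w; apply: (near_eq_derivable (e' w)); exact: derivableB.
- by move=> w; rewrite (nbhs_singleton (e w)) /= ep eq !dotvE.
- move=> w; rewrite (near_eq_derive w (e w)) deriveB // eM eN.
  by rewrite mulmxBl !dotvE.
Qed.

Lemma has_jet_min f x p M : has_jet f x p M -> (\forall y \near x, f x <= f y) ->
  p = 0 /\ forall w, 0 <= dotv w (M *m w).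
Proof.
move=> [df d2f ep eM] fmin.
have h w : dotv p w = 0 /\ 0 <= dotv w (M *m w).
  rewrite -ep -eM; apply: second_order_min => //.
  by apply: filterS df => y; apply.
split=> [|w]; last by have [] := h w.
by apply/eqP; rewrite -dotvv_eq0; have [-> _] := h p.
Qed.

(** The common shape of all test functions: the barriers as well as the weight of the narrow
    strip. *)
Definition quadratic (c : R) (b z : 'cV[R]_n) (Q : 'M[R]_n) (x : 'cV[R]_n) : R :=
  c + dotv b (x - z) + 2^-1 * dotv (x - z) (Q *m (x - z)).

Lemma has_jet_quadratic c b z Q x : Q^T = Q ->
  has_jet (quadratic c b z Q) x (b + Q *m (x - z)) Q.
Proof.
move=> Qs.
have D y w : is_derive y w (quadratic c b z Q) (dotv (b + Q *m (y - z)) w).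
  apply: (@is_derive_quadratic _ _ _ _ _ (quadratic c b z Q y) _
    (2^-1 * dotv w (Q *m w))) => h.
  rewrite /quadratic -(addrA (h *: w)); move: (y - z) => d.
  rewrite mulmxDr -scalemxAr !dotvE (dotv_trmx d w) Qs.
  by rewrite !(dotvC _ w); field.
have D1 w : 'D_w (quadratic c b z Q) = (fun y => dotv (b + Q *m (y - z)) w).
  by apply/funext => y; have [] := D y w.
have D2 w : is_derive x w ('D_w (quadratic c b z Q)) (dotv w (Q *m w)).
  rewrite D1; apply: (@is_derive_quadratic _ _ _ _ _ (dotv (b + Q *m (x - z)) w) _ 0) => h.
  rewrite -(addrA (h *: w)); move: (x - z) => d.
  by rewrite mulmxDr -scalemxAr !dotvE (dotvC w (Q *m w)); ring.
split.
- by near=> y => w; have [] := D y w.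
- by move=> w; have [] := D2 w.
- by move=> w; have [] := D x w.
- by move=> w; have [] := D2 w.
Unshelve. all: by end_near. Qed.

End Jets.

(** * Reflections in the hyperplanes orthogonal to [e] *)

Section Reflection.
Variables (R : realType) (n : nat) (e : 'cV[R]_n).
Hypothesis e1 : dotv e e = 1.
Implicit Types (x y w : 'cV[R]_n) (lam : R).

Definition reflv x := x - (2 * dotv x e) *: e.
Definition refl lam x := reflv x + (2 * lam) *: e.
Definition reflmx : 'M[R]_n := 1%:M - 2 *: (e *m e^T).

Lemma mulmx_dotv (a b x : 'cV[R]_n) : a *m b^T *m x = dotv b x *: a.
Proof.
apply/colP => i; rewrite -mulmxA !mxE big_ord1 !mxE mulrC.
by congr (_ * _); apply: eq_bigr => j _; rewrite mxE.
Qed.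

Lemma reflmxE x : reflmx *m x = reflv x.
Proof. by rewrite mulmxBl mul1mx -scalemxAl mulmx_dotv scalerA dotvC. Qed.

Lemma reflmx_sym : reflmx^T = reflmx.
Proof. by rewrite /reflmx linearB /= linearZ /= trmx_mul trmxK trmx1. Qed.

Lemma dotv_reflv x y : dotv (reflv x) (reflv y) = dotv x y.
Proof. by rewrite /reflv !dotvE (dotvC e y) e1; ring. Qed.

Lemma reflvK : involutive reflv.
Proof.
move=> x; have d : dotv (reflv x) e = - dotv x e by rewrite /reflv !dotvE e1; ring.
by rewrite {1}/reflv d mulrN scaleNr opprK subrK.
Qed.

Lemma dotv_reflv_swap x y : dotv (reflv x) y = dotv x (reflv y).
Proof. by rewrite -[y in LHS]reflvK dotv_reflv. Qed.

Lemma reflmx_orth : real_orthomx reflmx.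
Proof.
rewrite /real_orthomx reflmx_sym -[RHS](mulmx1); apply/matrixP => i j.
have h (A B : 'M[R]_n) : (forall x, A *m x = B *m x) -> A = B.
  move=> AB; apply/matrixP => k l.
  by have /colP/(_ k) := AB (delta_mx l 0); rewrite -!colE !mxE.
congr fun_of_matrix; apply: h => x.
by rewrite -mulmxA !reflmxE reflvK mulmx1 mul1mx.
Qed.

Lemma reflD lam x h : refl lam (h + x) = reflv h + refl lam x.
Proof. by rewrite /refl addrA /reflv dotvDl mulrDr scalerDl opprD addrACA. Qed.

Lemma reflvZ (h : R) w : reflv (h *: w) = h *: reflv w.
Proof. by rewrite /reflv dotvE scalerBr scalerA; congr (_ - _ *: _); ring. Qed.

Lemma dotv_refl_e lam x : dotv (refl lam x) e = 2 * lam - dotv x e.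
Proof. by rewrite /refl /reflv !dotvE e1; ring. Qed.


Lemma reflE lam x : refl lam x = x + (2 * (lam - dotv x e)) *: e.
Proof. by rewrite /refl /reflv mulrBr scalerBl addrAC addrA. Qed.

Lemma reflK lam : involutive (refl lam).
Proof.
move=> x; rewrite reflE dotv_refl_e reflE -addrA -scalerDl.
by rewrite [X in X *: e](_ : _ = 0) ?scale0r ?addr0 //; ring.
Qed.

(** For [lam > 0] the correction is positive exactly on the side [x.e < lam]: reflection moves these
    points away from the origin, which is the direction that monotonicity in [r] requires. *)
Lemma dotv_refl lam x :
  dotv (refl lam x) (refl lam x) = dotv x x + 4 * lam * (lam - dotv x e).
Proof. by rewrite /refl /reflv !dotvE (dotvC e x) e1; ring. Qed.

Lemma enorm_reflv x : enorm (reflv x) = enorm x.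
Proof. by rewrite /enorm dotv_reflv. Qed.

Lemma reflB lam x y : refl lam x - refl lam y = reflv (x - y).
Proof.
have := reflD lam y (x - y); rewrite subrK => ->.
by rewrite addrK.
Qed.

Lemma continuous_refl lam x : {for x, continuous (refl lam)}.
Proof.
have cd : {for x, continuous (fun y => (2 * dotv y e) *: e)}.
  apply: continuousZl; apply: continuousM; first exact: cst_continuous.
  by apply: (@continuous_dotv _ _ _ id (cst e)); [exact: cvg_id|exact: cst_continuous].
have cr : {for x, continuous (fun y => y - (2 * dotv y e) *: e)}.
  by apply: (@continuousB _ _ _ id); first exact: cvg_id.
exact: (@continuousD _ _ _ _ (cst _) _ cr (@cst_continuous _ _ _ _)).
Qed.

Lemma refl_derive (f : 'cV[R]_n -> R) lam x w :
  'D_w (fun y => f (refl lam y)) x = 'D_(reflv w) f (refl lam x).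
Proof.
apply: (@derive_congr R _ _ (fun y => f (refl lam y)) f x w (refl lam x) (reflv w)) => h.
by rewrite reflD reflvZ.
Qed.

Lemma refl_derivable (f : 'cV[R]_n -> R) lam x w :
  derivable f (refl lam x) (reflv w) -> derivable (fun y => f (refl lam y)) x w.
Proof.
apply: (@derivable_congr R _ _ (fun y => f (refl lam y)) f x w (refl lam x) (reflv w)) => h.
by rewrite reflD reflvZ.
Qed.

Lemma has_jet_refl (f : 'cV[R]_n -> R) lam x p M : has_jet f (refl lam x) p M ->
  has_jet (fun y => f (refl lam y)) x (reflmx *m p) (reflmx *m M *m reflmx).
Proof.
move=> [df d2f ep eM].
have D w : 'D_w (fun y => f (refl lam y)) = (fun y => 'D_(reflv w) f (refl lam y)).
  by apply/funext => y; exact: refl_derive.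
split.
- have H := @continuous_refl lam x _ df.
  apply: (@filterS _ _ (nbhs_filter x) _ _ _ H) => y /= h w.
  exact: refl_derivable.
- by move=> w; rewrite D; exact: (@refl_derivable ('D_(reflv w) f)).
- by move=> w; rewrite refl_derive ep reflmxE dotv_reflv_swap.
- by move=> w; rewrite D (refl_derive ('D_(reflv w) f)) eM -!mulmxA !reflmxE dotv_reflv_swap.
Qed.

End Reflection.

(** * Semidefinite matrices and the trace pairing *)

Section Contraction.
Variables (R : realType) (n : nat).
Implicit Types (A N : 'M[R]_n) (w : 'cV[R]_n).

(** The trace pairing [\tr (A^T *m N)]. *)
Definition mxdot A N : R := \sum_i \sum_j A i j * N i j.

Definition psdmx N := forall w, 0 <= dotv w (N *m w).

Lemma dotv_delta i w : dotv (delta_mx i 0) w = w i 0.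
Proof.
rewrite /dotv (bigD1 i) //= big1 ?addr0 ?mxE ?eqxx ?mul1r // => j ji.
by rewrite mxE (negPf ji) mul0r.
Qed.

Lemma mul_mx_delta N j : N *m delta_mx j 0 = col j N.
Proof. by rewrite -colE. Qed.

Lemma dotv_delta_mx N i j : dotv (delta_mx i 0) (N *m delta_mx j 0) = N i j.
Proof. by rewrite dotv_delta mul_mx_delta mxE. Qed.

Lemma mxdot_outer A w : mxdot A (w *m w^T) = dotv w (A *m w).
Proof.
rewrite dotv_mulmx; apply: eq_bigr => i _; apply: eq_bigr => j _.
by rewrite mxE big_ord1 mxE mulrC.
Qed.

Lemma mxdotB A N1 N2 : mxdot A (N1 - N2) = mxdot A N1 - mxdot A N2.
Proof.
rewrite /mxdot -sumrB; apply: eq_bigr => i _; rewrite -sumrB.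
by apply: eq_bigr => j _; rewrite mxE [in X in _ * (_ + X)]mxE mulrBr.
Qed.

Lemma mxdotZ A k N : mxdot A (k *: N) = k * mxdot A N.
Proof.
rewrite /mxdot mulr_sumr; apply: eq_bigr => i _; rewrite mulr_sumr.
by apply: eq_bigr => j _; rewrite !mxE; ring.
Qed.

(* Each step subtracts from N the rank one matrix c c^T / N_ii, with c the i-th
   column, which keeps N semidefinite and kills its i-th diagonal entry. *)
Lemma mxdot_psd_ge0 A N : N^T = N -> psdmx N -> psdmx A -> 0 <= mxdot A N.
Proof.
move=> + + Apsd; have [m] := ubnP #|[pred i | N i i != 0]|.
elim: m N => // m IH N leNm Ns Npsd.
have Nd i : 0 <= N i i by rewrite -dotv_delta_mx; exact: Npsd.
have [i Ni|N0] := pickP (fun i => N i i != 0); last first.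
  suff -> : N = 0 by rewrite /mxdot big1 // => i _; rewrite big1 // => j _; rewrite mxE mulr0.
  apply/matrixP => i j; rewrite mxE; apply/eqP; rewrite -sqrf_eq0 eq_le sqr_ge0 andbT.
  have Nz k : N k k = 0 by apply/eqP; have := N0 k; case: eqP.
  have Nji : N j i = N i j by rewrite -[in LHS]Ns mxE.
  (* With a vanishing diagonal this test vector gives [- 2 N_ij^2 >= 0]. *)
  have := Npsd (delta_mx j 0 - N i j *: delta_mx i 0).
  rewrite mulmxBr -scalemxAr !dotvE !dotv_delta_mx !Nz Nji; lra.
have Ni0 : 0 < N i i by rewrite lt_def Ni Nd.
pose c := col i N; pose N' := N - (N i i)^-1 *: (c *m c^T).
have Nc w : dotv (delta_mx i 0) (N *m w) = dotv c w.
  by rewrite dotv_trmx Ns mul_mx_delta.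
have N's : N'^T = N' by rewrite /N' linearB /= linearZ /= trmx_mul trmxK Ns.
have N'E w : dotv w (N' *m w) = dotv w (N *m w) - (N i i)^-1 * dotv c w ^+ 2.
  by rewrite /N' mulmxBl -scalemxAl mulmx_dotv !dotvE (dotvC w c) expr2.
have N'psd : psdmx N'.
  move=> w; rewrite N'E.
  (* Completing the square: this shift of [w] along the [i]-th axis minimizes the quadratic form of
     [N], and the minimum is the form of [N'] at [w]. *)
  have := Npsd (w - (dotv c w / N i i) *: delta_mx i 0).
  rewrite mulmxBr -scalemxAr !dotvE Nc dotv_delta_mx mul_mx_delta -/c (dotvC w c).
  congr (_ <= _); field; exact: lt0r_neq0.
have -> : N = N' + (N i i)^-1 *: (c *m c^T) by rewrite subrK.
have -> : N' + (N i i)^-1 *: (c *m c^T) = N' - (- (N i i)^-1) *: (c *m c^T).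
  by rewrite scaleNr opprK.
rewrite mxdotB mxdotZ mxdot_outer mulNr opprK addr_ge0 //; last first.
  by rewrite mulr_ge0 ?invr_ge0.
rewrite ltnS in leNm; apply: IH => //; apply: leq_trans leNm.
apply: proper_card; apply/properP; split.
  apply/fintype.subsetP => j; rewrite !inE; apply: contra => /eqP Nj.
  have : 0 <= N' j j by rewrite -dotv_delta_mx; exact: N'psd.
  rewrite -dotv_delta_mx N'E dotv_delta_mx Nj sub0r oppr_ge0 => h.
  by rewrite eq_le oppr_le0 oppr_ge0 h mulr_ge0 ?invr_ge0 ?sqr_ge0.
exists i; rewrite !inE //; apply/negPn/eqP.
rewrite -dotv_delta_mx N'E dotv_delta_mx dotvC dotv_delta mxE expr2 mulKf ?subrr //.
Qed.

End Contraction.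

Section SymmetricMatrices.
Variables (R : realType) (n : nat).
Implicit Types M N : 'M[R]_n.

Lemma symmxD M N : M^T = M -> N^T = N -> (M + N)^T = M + N.
Proof. by move=> Ms Ns; rewrite linearD /= Ms Ns. Qed.

Lemma symmxB M N : M^T = M -> N^T = N -> (M - N)^T = M - N.
Proof. by move=> Ms Ns; rewrite linearB /= Ms Ns. Qed.

Lemma symmxZ k M : M^T = M -> (k *: M)^T = k *: M.
Proof. by move=> Ms; rewrite linearZ /= Ms. Qed.

End SymmetricMatrices.

(** * The operator [F] and its linearization *)

Section EllipticOperator.
Variables (R : realType) (n : nat) (eps : R) (F : R -> R -> 'cV[R]_n -> 'M[R]_n -> R).
Notation jet := (R * R * 'cV[R]_n * 'M[R]_n)%type.
Notation G := (symF_uncurried F).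

Definition jet_dom := [set z : jet | 0 < z.1.1.1 < 1 + eps].

Hypotheses (hFC1 : C1_on jet_dom G)
  (hFell : forall (r s : R) (p : 'cV[R]_n) (M : 'M[R]_n),
     0 < r < 1 + eps -> M^T = M -> posdefmx (- dFdM F r s p M))
  (hFr : forall (r s : R) (p : 'cV[R]_n) (M : 'M[R]_n),
     0 < r < 1 + eps -> 0 < s -> M^T = M ->
     0 <= derive1 (fun t : R => F t s p M) r).

Lemma sympart_id (M : 'M[R]_n) : M^T = M -> sympart M = M.
Proof.
move=> Ms; rewrite /sympart Ms -[X in X + _](scale1r M) -[X in _ + X](scale1r M).
rewrite -scalerDl scalerA -[RHS]scale1r; congr (_ *: _); by field.
Qed.

Lemma symF_uncurriedE r s p (M : 'M[R]_n) : M^T = M -> G (r, s, p, M) = F r s p M.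
Proof. by move=> Ms; rewrite /symF_uncurried /= sympart_id. Qed.

Lemma open_jet_dom : open jet_dom.
Proof.
have -> : jet_dom = (fun z : jet => z.1.1.1) @^-1` [set` `]0, 1 + eps[].
  by apply/seteqP; split => z /=; rewrite in_itv.
apply: open_comp; last exact: itv_open.
move=> z _; apply: (@continuous_comp _ _ _ (fun z : jet => z.1.1) fst); last exact: cvg_fst.
by apply: (@continuous_comp _ _ _ (fun z : jet => z.1) fst); exact: cvg_fst.
Qed.

Lemma symF_differentiable z : jet_dom z -> differentiable G z.
Proof. by have [h _] := hFC1; exact: h. Qed.

Lemma symF_derive_continuous z d : jet_dom z -> {for z, continuous ('D_d G)}.
Proof.
move=> Dz; have [_ /(_ d)] := hFC1.
by rewrite (continuous_open_subspace _ open_jet_dom) //; apply; rewrite inE.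
Qed.

Lemma derive_linear (V : normedModType R) (f : V -> R) x k v w : differentiable f x ->
  'D_(k *: v + w) f x = k * 'D_v f x + 'D_w f x.
Proof. by move=> df; rewrite !deriveE // linearP. Qed.

(** The linearized operator split into its terms of order zero, one and two. The radius does not
    vary, since both equations are compared at the common radius [|x'|]. *)
Lemma symF_deriveE z k q (N : 'M[R]_n) : jet_dom z ->
  'D_((0, k, q, N) : jet) G z = k * 'D_((0, 1, 0, 0) : jet) G z +
    dotv q (\col_i 'D_((0, 0, delta_mx i 0, 0) : jet) G z) +
    mxdot (\matrix_(i, j) 'D_((0, 0, 0, delta_mx i j) : jet) G z) N.
Proof.
move=> Dz; have dG := symF_differentiable Dz.
have eM (c : R) (N1 N2 : 'M[R]_n) :
    ((0, 0, 0, c *: N1 + N2) : jet) = c *: ((0, 0, 0, N1) : jet) + (0, 0, 0, N2).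
  by rewrite -[RHS]/((c *: 0 + 0, c *: 0 + 0, c *: 0 + 0, c *: N1 + N2) : jet) !scaler0 !addr0.
have eq' (c : R) (q1 q2 : 'cV[R]_n) :
    ((0, 0, c *: q1 + q2, 0) : jet) = c *: ((0, 0, q1, 0) : jet) + (0, 0, q2, 0).
  by rewrite -[RHS]/((c *: 0 + 0, c *: 0 + 0, c *: q1 + q2, c *: 0 + 0) : jet) !scaler0 !addr0.
have e : ((0, k, q, N) : jet) = k *: ((0, 1, 0, 0) : jet) +
    (1 *: ((0, 0, q, 0) : jet) + (0, 0, 0, N)).
  rewrite -[RHS]/((k *: 0 + (1 *: 0 + 0), k *: 1 + (1 *: 0 + 0), k *: 0 + (1 *: q + 0),
    k *: 0 + (1 *: 0 + N)) : jet) !scaler0 !scale1r !addr0 !add0r.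
  by rewrite [k *: (1 : R)]mulr1.
rewrite e !derive_linear // mul1r -!addrA; congr (_ + (_ + _)).
  rewrite [q in LHS]matrix_sum_delta.
  rewrite (big_morph (fun q => 'D_((0, 0, q, 0) : jet) G z) (id1 := 0) (op1 := +%R)); first last.
  - exact: derive0.
  - by move=> q1 q2; rewrite -[q1]scale1r eq' derive_linear // mul1r scale1r.
  apply: eq_bigr => i _; rewrite big_ord1 -[X in (_, _, X, _)]addr0 eq' derive_linear //.
  by rewrite [X in _ + X]derive0 addr0 mxE.
rewrite [N in LHS]matrix_sum_delta.
rewrite (big_morph (fun N => 'D_((0, 0, 0, N) : jet) G z) (id1 := 0) (op1 := +%R)); first last.
- exact: derive0.
- by move=> N1 N2; rewrite -[N1]scale1r eM derive_linear // mul1r scale1r.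
apply: eq_bigr => i _.
rewrite (big_morph (fun N => 'D_((0, 0, 0, N) : jet) G z) (id1 := 0) (op1 := +%R)); first last.
- exact: derive0.
- by move=> N1 N2; rewrite -[N1]scale1r eM derive_linear // mul1r scale1r.
apply: eq_bigr => j _; rewrite -[X in (_, _, X)]addr0 eM derive_linear //.
by rewrite [X in _ + X]derive0 addr0 mxE mulrC.
Qed.

Lemma symF_derive_dFdM z i j : 
  'D_((0, 0, 0, delta_mx i j) : jet) G z = dFdM F z.1.1.1 z.1.1.2 z.1.2 z.2 i j.
Proof.
rewrite mxE; apply: (@derive_congr R _ _ G
  (fun N => F z.1.1.1 z.1.1.2 z.1.2 (sympart N))) => h.
case: z => [[[r s] p] M].
rewrite /symF_uncurried -[h *: _ + _]/((h *: 0 + r, h *: 0 + s, h *: 0 + p,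
  h *: delta_mx i j + M) : jet) /=.
by rewrite !scaler0 !add0r.
Qed.

(** This fixes the signs used below: [F] decreases in [M], so touching from below makes the
    linearized operator nonnegative on the test function, and a barrier has to make it negative. *)
Lemma symF_derive_psd_le0 z (N : 'M[R]_n) : jet_dom z -> z.2^T = z.2 ->
  N^T = N -> psdmx N -> 'D_((0, 0, 0, N) : jet) G z <= 0.
Proof.
move=> Dz Mz Ns Npsd; rewrite symF_deriveE // mul0r dotv0l !add0r.
set A := \matrix_(i, j) _.
have Apsd : psdmx (- A).
  have -> : A = dFdM F z.1.1.1 z.1.1.2 z.1.2 z.2.
    by apply/matrixP => i j; rewrite mxE symF_derive_dFdM.
  move=> w; have [->|w0] := eqVneq w 0; first by rewrite dotv0l.
  have [_ /(_ w w0)] := hFell z.1.1.2 z.1.2 Dz Mz.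
  rewrite -mulmxA mxE => /ltW; congr (_ <= _).
  by apply: eq_bigr => i _; rewrite mxE.
have := mxdot_psd_ge0 Ns Npsd Apsd; rewrite -oppr_le0; congr (_ <= _).
rewrite /mxdot -sumrN; apply: eq_bigr => i _; rewrite -sumrN.
by apply: eq_bigr => j _; rewrite [(- A) i j]mxE mulNr opprK.
Qed.

Lemma symF_derive_outer_lt0 z (w : 'cV[R]_n) : jet_dom z -> z.2^T = z.2 -> w != 0 ->
  'D_((0, 0, 0, w *m w^T) : jet) G z < 0.
Proof.
move=> Dz Mz w0; rewrite symF_deriveE // mul0r dotv0l !add0r mxdot_outer.
have [_ /(_ w w0)] := hFell z.1.1.2 z.1.2 Dz Mz.
rewrite -mulmxA mxE -oppr_lt0; congr (_ < _).
rewrite mulNmx -sumrN; apply: eq_bigr => i _; rewrite !mxE mulrN opprK; congr (_ * _).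
by apply: eq_bigr => j _; rewrite -symF_derive_dFdM !mxE.
Qed.

Lemma F_mono_r r1 r2 s p (M : 'M[R]_n) : 0 < r1 -> r1 <= r2 -> r2 < 1 + eps ->
  0 < s -> M^T = M -> F r1 s p M <= F r2 s p M.
Proof.
move=> r10 r12 r2e s0 Ms.
have eG : (fun t => F t s p M) = (fun t => G (t, s, p, M)).
  by apply/funext => t; rewrite symF_uncurriedE.
have dF (t : R) : r1 <= t <= r2 -> derivable (fun t => F t s p M) t 1.
  move=> /andP[t1 t2]; rewrite eG.
  have Dt : jet_dom (t, s, p, M) by rewrite /jet_dom /= (lt_le_trans r10) //= (le_lt_trans t2).
  apply: (@derivable_congr R _ _ (fun t => G (t, s, p, M)) G t 1 (t, s, p, M) (1, 0, 0, 0)).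
    move=> h; rewrite -[X in _ = G X]/((h *: 1 + t, h *: 0 + s, h *: 0 + p, h *: 0 + M) : jet).
    by rewrite !scaler0 !add0r.
  exact/diff_derivable/symF_differentiable.
have dcont : {within `[r1, r2], continuous (fun t => F t s p M)}.
  by apply: derivable_within_continuous => t; rewrite in_itv; exact: dF.
apply: (ger0_derive1_le_cc _ _ dcont) => // [t|t||].
- by rewrite in_itv /= => /andP[t1 t2]; apply: dF; rewrite !ltW.
- rewrite in_itv /= => /andP[t1 t2]; apply: hFr => //.
  by rewrite (lt_trans r10) //= (lt_trans t2).
- by rewrite in_itv /= lexx.
- by rewrite in_itv /= lexx r12.
Qed.

Lemma F_psd_le r s p (M N : 'M[R]_n) : 0 < r < 1 + eps -> M^T = M -> N^T = N ->
  psdmx N -> F r s p (M + N) <= F r s p M.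
Proof.
move=> rD Ms Ns Npsd.
have Dt t : jet_dom ((r, s, p, M) + t *: ((0, 0, 0, N) : jet)).
  by rewrite /jet_dom /= scaler0 addr0.
have E t : ((r, s, p, M) : jet) + t *: ((0, 0, 0, N) : jet) = (r, s, p, M + t *: N).
  rewrite -[LHS]/((r + t *: 0, s + t *: 0, p + t *: 0, M + t *: N) : jet).
  by rewrite !scaler0 !addr0.
have [|t t01] := @MVT_line R _ G (r, s, p, M) (0, 0, 0, N) 1 ltr01.
  by move=> t _; exact/diff_derivable/symF_differentiable.
rewrite mul1r => e.
have : 'D_((0, 0, 0, N) : jet) G ((r, s, p, M) + t *: (0, 0, 0, N)) <= 0.
  apply: symF_derive_psd_le0 => //.
  by rewrite E /= linearD /= linearZ /= Ms Ns.
rewrite -e E scale1r !symF_uncurriedE ?subr_le0 //.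
by rewrite linearD /= Ms Ns.
Qed.

Lemma symF_derive_psd_le z k q (N N1 : 'M[R]_n) : jet_dom z -> z.2^T = z.2 ->
  N^T = N -> N1^T = N1 -> psdmx (N1 - N) ->
  'D_((0, k, q, N1) : jet) G z <= 'D_((0, k, q, N) : jet) G z.
Proof.
move=> Dz Mz Ns N1s Npsd.
have -> : ((0, k, q, N1) : jet) = 1 *: ((0, k, q, N) : jet) + (0, 0, 0, N1 - N).
  rewrite -[RHS]/((1 *: 0 + 0, 1 *: k + 0, 1 *: q + 0, 1 *: N + (N1 - N)) : jet).
  by rewrite scaler0 !scale1r !addr0 addrCA subrr addr0.
rewrite derive_linear ?mul1r; last exact: symF_differentiable.
by rewrite gerDl; apply: symF_derive_psd_le0 => //; rewrite linearB /= Ns N1s.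
Qed.

(* Evaluating at the larger radius keeps r' away from 0, where F is not defined;
   the segment only involves the jet of the second function, which stays bounded
   where the first one is singular. *)
Lemma linearize_touching r r' s p (M : 'M[R]_n) k q N p1 M1 :
  0 < r -> r <= r' -> r' < 1 + eps -> 0 < s + k -> M^T = M -> N^T = N -> M1^T = M1 ->
  F r (s + k) p1 M1 = 0 -> F r' s p M = 0 ->
  p1 = p + q -> psdmx (M1 - M - N) ->
  exists2 t, 0 <= t <= 1 &
    0 <= 'D_((0, k, q, N) : jet) G (r', s + t * k, p + t *: q, M + t *: N).
Proof.
move=> r0 rr r'e sk0 Ms Ns M1s F1 F2 p1E Npsd.
have rD : 0 < r' < 1 + eps by rewrite (lt_le_trans r0).
have MNs : (M + N)^T = M + N by rewrite linearD /= Ms Ns.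
have h1 : 0 <= F r' (s + k) (p + q) (M + N).
  have : 0 <= F r' (s + k) p1 M1 by rewrite -F1; exact: F_mono_r.
  move=> /le_trans; apply; rewrite p1E (_ : M1 = (M + N) + (M1 - M - N)); last first.
    by rewrite addrC -[M1 - M - N]addrA -opprD subrK.
  by apply: F_psd_le => //; rewrite !linearB /= Ms Ns M1s.
have E t : ((r', s, p, M) : jet) + t *: ((0, k, q, N) : jet) =
    (r', s + t * k, p + t *: q, M + t *: N).
  rewrite -[LHS]/((r' + t *: 0, s + t * k, p + t *: q, M + t *: N) : jet).
  by rewrite !scaler0 !addr0.
have [|t /andP[t0 t1]] := @MVT_line R _ G (r', s, p, M) (0, k, q, N) 1 ltr01.
  by move=> t _; apply/diff_derivable/symF_differentiable; rewrite E.
rewrite mul1r !E scale1r mul1r scale1r !symF_uncurriedE // => e.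
exists t; first by rewrite !ltW.
by rewrite -e F2 subr0.
Qed.

End EllipticOperator.

Section GradHessReflection.
Variables (R : realType) (n : nat) (e : 'cV[R]_n).
Hypothesis e1 : dotv e e = 1.
Variables (U : set 'cV[R]_n) (f : 'cV[R]_n -> R) (lam : R).
Hypotheses (oU : open U) (fC2 : C2_on U f).
Notation rx := (refl e lam).
Notation v := (fun y => f (rx y)).

Lemma grad_refl_coord x i : grad v x i 0 = 'D_(reflv e (delta_mx i 0)) f (rx x).
Proof. by rewrite mxE (@refl_derive _ _ e f lam). Qed.

Lemma hess_refl_coord x i j : hess v x i j =
  'D_(reflv e (delta_mx j 0)) ('D_(reflv e (delta_mx i 0)) f) (rx x).
Proof.
rewrite mxE; have -> : (fun y => 'D_(delta_mx i 0) v y) =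
  (fun y => 'D_(reflv e (delta_mx i 0)) f (refl e lam y)).
  by apply/funext => y; rewrite (@refl_derive _ _ e f lam).
by rewrite (@refl_derive _ _ e ('D_(reflv e (delta_mx i 0)) f) lam).
Qed.

Lemma grad_refl x : U (rx x) -> grad v x = reflmx e *m grad f (rx x).
Proof.
move=> Ux; apply/colP => i; rewrite grad_refl_coord derive_gradE; last first.
  exact: (C2_differentiable fC2).
by rewrite -dotv_reflv_swap // -reflmxE dotvC dotv_delta.
Qed.

Lemma hess_refl x : U (rx x) -> hess v x = reflmx e *m hess f (rx x) *m reflmx e.
Proof.
move=> Ux; apply/matrixP => i j; rewrite hess_refl_coord (C2_derive2E oU fC2) //.
rewrite -[RHS]dotv_delta_mx -!mulmxA !reflmxE.
by rewrite -[in RHS]dotv_reflv_swap.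
Qed.

Lemma C2_has_jet_refl x : U (rx x) -> has_jet v x (grad v x) (hess v x).
Proof.
move=> Ux; rewrite grad_refl // hess_refl //; apply: has_jet_refl => //.
exact: (C2_has_jet oU fC2).
Qed.

Lemma hess_refl_sym x : U (rx x) -> (hess v x)^T = hess v x.
Proof.
move=> Ux; rewrite hess_refl // !trmx_mul reflmx_sym (hess_sym oU fC2) //.
by rewrite mulmxA.
Qed.

End GradHessReflection.

(** * The solution, its reflection, and test functions touching their difference *)

Record singular_solution (R : realType) (n : nat) (eps : R)
    (F : R -> R -> 'cV[R]_n -> 'M[R]_n -> R) (u : 'cV[R]_n -> R) (rbar : R) : Prop :=
  SingularSolution {
  sol_FC1 : C1_on
     [set z : R * R * 'cV[R]_n * 'M[R]_n | 0 < z.1.1.1 < 1 + eps]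
     (symF_uncurried F);
  sol_Fell : forall (r s : R) (p : 'cV[R]_n) (M : 'M[R]_n),
     0 < r < 1 + eps -> M^T = M -> posdefmx (- dFdM F r s p M);
  sol_Fr : forall (r s : R) (p : 'cV[R]_n) (M : 'M[R]_n),
     0 < r < 1 + eps -> 0 < s -> M^T = M ->
     0 <= derive1 (fun t : R => F t s p M) r;
  sol_FO : forall (r s : R) (p : 'cV[R]_n) (M O : 'M[R]_n),
     0 < r < 1 + eps -> 0 < s -> M^T = M -> real_orthomx O ->
     F r s (O^T *m p) (O^T *m M *m O) = F r s p M;
  sol_C2 : C2_upto (@punctured_ball R n 1) (@punctured_cball R n 1) u;
  sol_sing : forall (V : 'cV[R]_n) (r : R), 0 < r < rbar ->
     exists x0 : 'cV[R]_n,
       [/\ esphere r x0,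
           (forall x, esphere r x -> u x0 + dotv V x0 <= u x + dotv V x) &
           ereal_inf [set (u x + dotv V x)%:E | x in @punctured_ball R n r]
             = (u x0 + dotv V x0)%:E];
  sol_pde : forall x : 'cV[R]_n, punctured_ball 1 x ->
     F (enorm x) (u x) (grad u x) (hess u x) = 0;
  sol_pos : forall x : 'cV[R]_n, punctured_ball 1 x -> 0 < u x;
  sol_bd : forall x : 'cV[R]_n, esphere 1 x -> u x = 0;
  sol_eps : 0 < eps;
  sol_rbar : 0 < rbar <= 1 }.

Section Touching.
Variables (R : realType) (n : nat) (eps : R) (F : R -> R -> 'cV[R]_n -> 'M[R]_n -> R)
  (u : 'cV[R]_n -> R) (rbar : R).
Hypothesis Hsol : singular_solution eps F u rbar.
Variables (e : 'cV[R]_n) (lam : R).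
Hypotheses (e1 : dotv e e = 1) (lam0 : 0 < lam).
Notation jet := (R * R * 'cV[R]_n * 'M[R]_n)%type.
Notation G := (symF_uncurried F).
Notation B1 := (@punctured_ball R n 1).
Notation rx := (refl e lam).
Notation v := (fun y => u (rx y)).

Lemma open_punctured_ball r : open (@punctured_ball R n r).
Proof.
have -> : @punctured_ball R n r = @enorm R n @^-1` [set` `]0, r[].
  by apply/seteqP; split => z /=; rewrite in_itv.
apply: open_comp; last exact: itv_open.
by move=> z _; exact: continuous_enorm.
Qed.

Lemma open_B1 : open B1.
Proof. exact: open_punctured_ball. Qed.

Lemma sol_C2_on : C2_on B1 u.
Proof. by have [] := sol_C2 Hsol. Qed.

Lemma enorm_lt_refl x : dotv x e < lam -> enorm x < enorm (rx x).
Proof.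
move=> xl; rewrite -(@ltr_pXn2r _ 2) ?nnegrE ?enorm_ge0 // !enorm_sqr dotv_refl //.
by rewrite ltrDl pmulr_lgt0 ?subr_gt0 // mulr_gt0.
Qed.

Lemma enorm_le_refl x : dotv x e <= lam -> enorm x <= enorm (rx x).
Proof.
move=> xl; rewrite -(@ler_pXn2r _ 2) ?nnegrE ?enorm_ge0 // !enorm_sqr dotv_refl //.
by rewrite lerDl mulr_ge0 ?subr_ge0 // mulr_ge0 // ltW.
Qed.

Lemma cap_punctured_ball x : dotv x e < lam -> x != 0 -> enorm (rx x) < 1 ->
  B1 x /\ B1 (rx x).
Proof.
move=> /enorm_lt_refl h; rewrite -enorm_gt0 => x0 x1.
by rewrite /punctured_ball /= x0 x1 (lt_trans h) // (lt_trans x0 h).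
Qed.

(** The radius is [|x'|] and not [|x|]: at [x] the reflected function solves the equation taken at
    the radius of the reflected point. *)
Definition refl_jet x : jet := (enorm (rx x), v x, grad v x, hess v x).

Lemma refl_pde x : B1 (rx x) ->
  F (enorm (rx x)) (v x) (grad v x) (hess v x) = 0.
Proof.
move=> Bx; rewrite (grad_refl e1 sol_C2_on) // (hess_refl e1 open_B1 sol_C2_on) //.
rewrite -[X in X *m grad _ _]reflmx_sym -[X in X *m hess _ _]reflmx_sym (sol_FO Hsol).
- exact: (sol_pde Hsol).
- by have /andP[-> /= h] := Bx; rewrite (lt_trans h) // ltrDl (sol_eps Hsol).
- exact: (sol_pos Hsol).
- exact: (hess_sym open_B1 sol_C2_on).
- exact: reflmx_orth.
Qed.

Section At.
Variables (x : 'cV[R]_n) (c : R) (b z : 'cV[R]_n) (Q : 'M[R]_n).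
Hypotheses (xl : dotv x e < lam) (x0 : x != 0) (x1 : enorm (rx x) < 1) (Qs : Q^T = Q)
  (fmin : \forall y \near x, u x - v x - quadratic c b z Q x <=
                             u y - v y - quadratic c b z Q y).
Let q := b + Q *m (x - z).

Lemma touching_jets : grad u x = grad v x + q /\ psdmx (hess u x - hess v x - Q).
Proof.
have [Bx Brx] := cap_punctured_ball xl x0 x1.
have j1 := C2_has_jet open_B1 sol_C2_on Bx.
have j2 := C2_has_jet_refl e1 open_B1 sol_C2_on Brx.
have j3 := has_jetB (has_jetB j1 j2) (has_jet_quadratic c b z x Qs).
have [/eqP h1 h2] := has_jet_min j3 fmin; split => //.
by apply/eqP; rewrite -subr_eq0 opprD addrA.
Qed.

Lemma enorm_refl_dom : 0 < enorm (rx x) < 1 + eps.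
Proof.
have [_ /andP[-> /= h]] := cap_punctured_ball xl x0 x1.
by rewrite (lt_trans h) // ltrDl (sol_eps Hsol).
Qed.

(** The linearization with [N := Q]. Neither [grad u x] nor [hess u x] appears, so a small test
    function keeps the segment close to the jet of [v]. This is the version for barriers. *)
Lemma touching_reflected_jet : exists2 t, 0 <= t <= 1 &
  0 <= 'D_((0, u x - v x, q, Q) : jet) G
    (enorm (rx x), v x + t * (u x - v x), grad v x + t *: q, hess v x + t *: Q).
Proof.
have [Bx Brx] := cap_punctured_ball xl x0 x1.
have [h1 h2] := touching_jets; have /andP[r0 r1] := enorm_refl_dom.
apply: (linearize_touching (sol_FC1 Hsol) (sol_Fell Hsol) (sol_Fr Hsol)
  (r := enorm x) (p1 := grad u x) (M1 := hess u x)) => //.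
- by have /andP[] := Bx.
- exact/ltW/enorm_lt_refl.
- by rewrite addrC subrK; exact: (sol_pos Hsol).
- exact: (hess_refl_sym e1 open_B1 sol_C2_on).
- exact: (hess_sym open_B1 sol_C2_on).
- by rewrite addrC subrK; exact: (sol_pde Hsol).
- exact: refl_pde.
Qed.

(** The linearization with [N := hess u x - hess v x], whose segment joins the jets of [v] and [u];
    ellipticity then replaces this matrix by the smaller [Q]. This is the version for the narrow
    strip, where both jets are bounded but [Q], of order [m / d ^+ 2], need not be small. *)
Lemma touching_segment : exists2 t, 0 <= t <= 1 &
  0 <= 'D_((0, u x - v x, q, Q) : jet) G
    (enorm (rx x), v x + t * (u x - v x), grad v x + t *: (grad u x - grad v x),
     hess v x + t *: (hess u x - hess v x)).
Proof.
have [Bx Brx] := cap_punctured_ball xl x0 x1.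
have [h1 h2] := touching_jets; have /andP[r0 r1] := enorm_refl_dom.
have hs := hess_sym open_B1 sol_C2_on Bx.
have hs' := hess_refl_sym e1 open_B1 sol_C2_on Brx.
have [|||||||||||t t01 h] := @linearize_touching _ _ _ _ (sol_FC1 Hsol) (sol_Fell Hsol) (sol_Fr Hsol)
  (enorm x) (enorm (rx x)) (v x) (grad v x) (hess v x) (u x - v x) q
  (hess u x - hess v x) (grad u x) (hess u x).
- by have /andP[] := Bx.
- exact/ltW/enorm_lt_refl.
- by [].
- by rewrite addrC subrK; exact: (sol_pos Hsol).
- by [].
- exact: (symmxB hs hs').
- by [].
- by rewrite addrC subrK; exact: (sol_pde Hsol).
- exact: refl_pde.
- by [].
- by move=> w; rewrite subrr mul0mx dotv0r.
have qE : grad u x - grad v x = q by rewrite h1 addrC addKr.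
exists t; first exact: t01.
rewrite qE.
apply: le_trans h _.
apply: (symF_derive_psd_le (sol_FC1 Hsol) (sol_Fell Hsol)) => //.
- by rewrite /jet_dom /= enorm_refl_dom.
- exact: (symmxD hs' (symmxZ t (symmxB hs hs'))).
- exact: (symmxB hs hs').
Qed.

End At.
End Touching.

Section MatrixValued.
Variable R : realType.

Lemma continuous_mx (T : topologicalType) m n (M : T -> 'M[R]_(m, n)) (t : T) :
  (forall i j, {for t, continuous (fun s => M s i j)}) -> {for t, continuous M}.
Proof.
move=> cM; apply/(@cvgrPdist_le _ _ _ (nbhs t) (nbhs_filter t)) => e e0.
have h : \forall s \near t, forall i j, `|M t i j - M s i j| <= e.
  apply: filter_forall => i; apply: filter_forall => j.
  by have /cvgr_dist_le /(_ _ e0) := cM i j.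
apply: (@filterS _ _ (nbhs_filter t) _ _ _ h) => s hs.
by apply/mx_norm_leP => [|i j]; [exact: ltW|rewrite !mxE].
Qed.

Lemma dotv_le_coord n (q g : 'cV[R]_n) a c : (forall i, `|q i 0| <= a) ->
  (forall i, `|g i 0| <= c) -> dotv q g <= n%:R * (a * c).
Proof.
move=> qa gc; apply: le_trans (_ : \sum_(i < n) (a * c) <= _); last first.
  by rewrite sumr_const card_ord mulr_natl.
by apply: ler_sum => i _; rewrite (le_trans (ler_norm _)) // normrM ler_pM.
Qed.

Lemma near_norm_le_add1 (T : topologicalType) (g : T -> R) (t : T) :
  {for t, continuous g} -> \forall s \near t, `|g s| <= `|g t| + 1.
Proof.
move=> /cvgr_dist_le /(_ 1 ltr01) h.
apply: (@filterS _ _ (nbhs_filter t) _ _ _ h) => s hs.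
by rewrite -lerBlDl (le_trans (lerB_dist _ _)) // distrC.
Qed.

Lemma near_norm_le_add1_forall (T : topologicalType) (I : finType) (g : I -> T -> R) (t : T) :
  (forall i, {for t, continuous (g i)}) ->
  \forall s \near t, forall i, `|g i s| <= `|g i t| + 1.
Proof. by move=> cg; apply: filter_forall => i; exact: near_norm_le_add1. Qed.

Lemma le_sum3 (x y z : R) : 0 <= x -> 0 <= y -> 0 <= z ->
  [/\ x <= x + y + z, y <= x + y + z & z <= x + y + z].
Proof. by move=> *; split; lra. Qed.

Lemma ler_sum_term (I : finType) (g : I -> R) i : (forall i, 0 <= g i) -> g i <= \sum_i g i.
Proof. by move=> g0; rewrite (bigD1 i) //= lerDl sumr_ge0. Qed.

Lemma mxdot0r n (A : 'M[R]_n) : mxdot A 0 = 0.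
Proof. by rewrite /mxdot big1 // => i _; rewrite big1 // => j _; rewrite [X in _ * X]mxE mulr0. Qed.

Lemma mul_le_norm (x y a c : R) : `|x| <= a -> `|y| <= c -> x * y <= a * c.
Proof. by move=> xa yc; rewrite (le_trans (ler_norm _)) // normrM ler_pM. Qed.

Lemma le_half_of_dist (x y : R) : - (- x / 2) <= x - y -> y <= - (- x / 2).
Proof. lra. Qed.

Lemma sum_bounds_lt0 (ep a C A m d1 d2 d3 d4 : R) :
  d1 <= 2 * ep * C -> d2 <= 2 * A * ep * - a -> d3 <= 3 * ep * C -> d4 <= m * (6 * ep * C) ->
  0 < ep * (2 * A * a - (5 * C + m * (6 * C))) -> d1 + (d2 + (d3 + d4)) < 0.
Proof. nra. Qed.

Lemma normr_scale_le (V : normedModType R) (x : V) (t : R) : 0 <= t -> t <= 1 ->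
  `|t *: x| <= `|x|.
Proof. by move=> t0 t1; rewrite normrZ ger0_norm // ler_piMl. Qed.

Lemma jet_norm_le n (r s C : R) (p : 'cV[R]_n) (M : 'M[R]_n) :
  `|r| <= C -> `|s| <= C -> `|p| <= C -> `|M| <= C -> `|(r, s, p, M)| <= C.
Proof. by move=> *; rewrite !prod_normE /= !ge_max; apply/andP; split=> //; do 2?[apply/andP; split=> //]. Qed.

Lemma jet_subE n (t r s k : R) (p q : 'cV[R]_n) (M N : 'M[R]_n) :
  (r, s + t * k, p + t *: q, M + t *: N) - (r, s, p, M) = (0, t * k, t *: q, t *: N).
Proof.
rewrite -[LHS]/((r - r, s + t * k - s, p + t *: q - p, M + t *: N - M)) subrr.
by congr (_, _, _, _); rewrite addrAC subrr add0r.
Qed.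

Lemma norm_sub_lt_half (V : normedModType R) (x y z : V) (eta : R) :
  `|x - y| < eta / 2 -> `|z - y| < eta / 2 -> `|x - z| < eta.
Proof.
move=> h1 h2; rewrite -(subrK y x) -addrA (le_lt_trans (ler_normD _ _)) //.
rewrite -[X in _ + X]normrN opprB; lra.
Qed.

End MatrixValued.

(** * The barrier and its linearized inequality *)

Section Barrier.
Variables (R : realType) (n : nat) (e : 'cV[R]_n).
Hypothesis e1 : dotv e e = 1.
Implicit Types (x z V : 'cV[R]_n) (A ep c : R).

(** The Hessian of [A l^2 - |x - z|^2] for [l = (z - x).e]: the rank one part gives the sign of the
    linearized operator, the other part makes the barrier negative on most of a sphere about [z]. *)
Definition barrier_hess A : 'M[R]_n := (2 * A) *: (e *m e^T) - 2%:M.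

(** The parameters [V] and [c] change the barrier by an affine function and leave its Hessian alone.
    A nonzero tilt [V] serves at the origin. *)
Definition barrier ep A z V c := quadratic c (V - ep *: e) z (ep *: barrier_hess A).

Lemma barrier_hess_mul A x : barrier_hess A *m x = (2 * A * dotv x e) *: e - 2 *: x.
Proof. by rewrite mulmxBl -scalemxAl mulmx_dotv scalerA mul_scalar_mx dotvC. Qed.

Lemma barrierE ep A z V c x : barrier ep A z V c x =
  c + dotv V (x - z) + ep * (dotv (z - x) e + A * dotv (z - x) e ^+ 2 - dotv (x - z) (x - z)).
Proof.
rewrite /barrier /quadratic -(opprB x z); move: (x - z) => d.
rewrite -scalemxAl barrier_hess_mul !dotvE (dotvC e d).
by field.
Qed.

Lemma barrier_hess_sym ep A : (ep *: barrier_hess A)^T = ep *: barrier_hess A.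
Proof.
apply/symmxZ/symmxB; last by rewrite tr_scalar_mx.
by apply: symmxZ; rewrite trmx_mul trmxK.
Qed.

Lemma unit_coord_le1 i : `|e i 0| <= 1.
Proof. by rewrite (le_trans (coord_le_enorm _ _)) // /enorm e1 sqrtr1. Qed.

Lemma enorm_unit : enorm e = 1.
Proof. by rewrite /enorm e1 sqrtr1. Qed.

(** [V - ep *: e] contributes [2 * ep]; each of the two terms of the Hessian contributes another
    [2 * ep], because [s * A <= 1] and [1 <= A]. *)
Lemma barrier_grad_le ep A z V x s : 0 < ep -> 1 <= A -> s * A <= 1 ->
  enorm V <= ep -> enorm (x - z) <= s ->
  enorm (V - ep *: e + (ep *: barrier_hess A) *m (x - z)) <= 6 * ep.
Proof.
move=> ep0 A1 sA Vep; move: (x - z) => d ds.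
rewrite -scalemxAl barrier_hess_mul.
have d0 := enorm_ge0 d.
have dA : enorm d * A <= 1 by rewrite (le_trans _ sA) // ler_wpM2r //; lra.
have de : `|dotv d e| <= enorm d.
  rewrite ler_norml; have := dotv_CS d e; have := dotv_CSN d e.
  by rewrite enorm_unit mulr1 => -> ->.
have h1 : enorm ((2 * A * dotv d e) *: e) <= 2.
  rewrite enormZ enorm_unit mulr1 normrM (ger0_norm (x := 2 * A)); last by lra.
  have : A * `|dotv d e| <= A * enorm d by rewrite ler_wpM2l //; lra.
  lra.
have h2 : enorm (2 *: d) <= 2.
  rewrite enormZ ger0_norm // ger_pMr //.
  apply: le_trans dA; rewrite ler_peMr //.
apply: le_trans (ler_enormD _ _) _.
have h3 : enorm (V - ep *: e) <= ep + ep.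
  apply: le_trans (ler_enormD _ _) _; rewrite enormN enormZ enorm_unit mulr1.
  by rewrite lerD // gtr0_norm.
have h4 : enorm (ep *: ((2 * A * dotv d e) *: e - 2 *: d)) <= ep * (2 + 2).
  rewrite enormZ gtr0_norm // ler_wpM2l ?(ltW ep0) //.
  by apply: le_trans (ler_enormD _ _) _; rewrite enormN lerD.
lra.
Qed.

Lemma barrier_hess_coord ep A i j : 0 < ep -> 1 <= A ->
  `|(ep *: barrier_hess A) i j| <= ep * (2 * A + 2).
Proof.
move=> ep0 A1; rewrite mxE normrM gtr0_norm // ler_wpM2l ?(ltW ep0) //.
rewrite !mxE big_ord1 !mxE (le_trans (ler_normB _ _)) // lerD //.
  rewrite normrM (ger0_norm (x := 2 * A)); last by lra.
  rewrite ler_piMr //; first lra.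
  rewrite normrM.
  by rewrite mulr_ile1 ?normr_ge0 ?unit_coord_le1.
by case: (i == j); rewrite ?mulr0n ?normr0 // mulr1n ger0_norm.
Qed.

End Barrier.

Section BarrierTouching.
Variables (R : realType) (n : nat) (eps : R) (F : R -> R -> 'cV[R]_n -> 'M[R]_n -> R)
  (u : 'cV[R]_n -> R) (rbar : R).
Hypothesis Hsol : singular_solution eps F u rbar.
Variables (e : 'cV[R]_n) (lam : R).
Hypotheses (e1 : dotv e e = 1) (lam0 : 0 < lam).
Notation jet := (R * R * 'cV[R]_n * 'M[R]_n)%type.
Notation G := (symF_uncurried F).
Notation B1 := (@punctured_ball R n 1).
Notation rx := (refl e lam).
Notation v := (fun y => u (rx y)).

Lemma refl_jet_continuous z : B1 (rx z) -> {for z, continuous (refl_jet u e lam)}.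
Proof.
move=> Bz.
have h1 : {for z, continuous (fun x => enorm (rx x))}.
  by apply: continuous_comp; [exact: continuous_refl|exact: continuous_enorm].
have h2 : {for z, continuous v}.
  apply: continuous_comp; first exact: continuous_refl.
  exact/differentiable_continuous/(C2_differentiable (sol_C2_on Hsol)).
have h3 : {for z, continuous (fun x => grad v x)}.
  apply: continuous_mx => i j; rewrite ord1.
  have -> : (fun s => grad v s i 0) = (fun s => 'D_(reflv e (delta_mx i 0)) u (rx s)).
    by apply/funext => s; exact: (@grad_refl_coord R n e u lam s i).
  apply: (@continuous_comp _ _ _ rx ('D_(reflv e (delta_mx i 0)) u)).
    exact: continuous_refl.
  exact: (C2_continuous1 (sol_C2_on Hsol)).
have h4 : {for z, continuous (fun x => hess v x)}.
  apply: continuous_mx => i j.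
  have -> : (fun s => hess v s i j) = (fun s =>
     'D_(reflv e (delta_mx j 0)) ('D_(reflv e (delta_mx i 0)) u) (rx s)).
    by apply/funext => s; exact: (@hess_refl_coord R n e u lam s i j).
  apply: (@continuous_comp _ _ _ rx
    ('D_(reflv e (delta_mx j 0)) ('D_(reflv e (delta_mx i 0)) u))).
    exact: continuous_refl.
  exact: (C2_continuous2 (@open_B1 R n) (sol_C2_on Hsol)).
exact: (cvg_pair (cvg_pair (cvg_pair h1 h2) h3) h4).
Qed.

(** Bounds on the linearized operator in exactly the directions from which the jet of a barrier is
    combined. *)
Definition jet_bounded (a C : R) (J : jet) :=
  [/\ `|'D_((0, 1, 0, 0) : jet) G J| <= C,
      forall i, `|'D_((0, 0, delta_mx i 0, 0) : jet) G J| <= C,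
      `|'D_((0, 0, 0, 1%:M) : jet) G J| <= C &
      'D_((0, 0, 0, e *m e^T) : jet) G J <= - a].

Lemma jet_bounded_near z : B1 (rx z) -> exists a C : R, [/\ 0 < a, 0 <= C &
  \forall J \near refl_jet u e lam z, jet_dom eps J /\ jet_bounded a C J].
Proof.
move=> Bz; set J0 := refl_jet u e lam z.
have DJ0 : jet_dom eps J0.
  have /andP[h1 h2] := Bz.
  by rewrite /jet_dom /= h1 (lt_trans h2) // ltrDl (sol_eps Hsol).
have cD d : {for J0, continuous ('D_d G)}.
  exact: (symF_derive_continuous (sol_FC1 Hsol)).
have e0 : e != 0.
  by apply/eqP => e0; move: e1; rewrite e0 dotv0l => /esym/eqP; rewrite oner_eq0.
(* Half of the ellipticity at [J0], so that the bound persists for nearby jets. *)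
pose a := - 'D_((0, 0, 0, e *m e^T) : jet) G J0 / 2.
have a0 : 0 < a.
  rewrite divr_gt0 // oppr_gt0.
  apply: (symF_derive_outer_lt0 (sol_FC1 Hsol) (sol_Fell Hsol)) => //.
  exact: (hess_refl_sym e1 (@open_B1 R n) (sol_C2_on Hsol)).
pose g (i : 'I_n) := `|'D_((0, 0, delta_mx i 0, 0) : jet) G J0| + 1.
pose C := (`|'D_((0, 1, 0, 0) : jet) G J0| + 1) + (\sum_i g i) +
  (`|'D_((0, 0, 0, 1%:M) : jet) G J0| + 1).
have N0 d : 0 <= `|'D_d G J0| + 1 by rewrite addr_ge0.
have g0 i : 0 <= g i by exact: N0.
have S0 : 0 <= \sum_i g i by apply: sumr_ge0.
exists a, C; split; [exact: a0|by rewrite !addr_ge0|].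
have n0 : \forall J \near J0, jet_dom eps J.
  by apply: open_nbhs_nbhs; split; [exact: open_jet_dom|].
have n1 := near_norm_le_add1 (cD (0, 1, 0, 0)).
have n2 := @near_norm_le_add1_forall _ _ _
  (fun i J => 'D_((0, 0, delta_mx i 0, 0) : jet) G J) J0 (fun i => cD (0, 0, delta_mx i 0, 0)).
have n3 := near_norm_le_add1 (cD (0, 0, 0, 1%:M)).
have n4 : \forall J \near J0, 'D_((0, 0, 0, e *m e^T) : jet) G J <= - a.
  have /cvgr_dist_le /(_ _ a0) h := cD (0, 0, 0, e *m e^T).
  apply: (@filterS _ _ (nbhs_filter J0) _ _ _ h) => J.
  by rewrite ler_norml => /andP[+ _]; exact: le_half_of_dist.
apply: (@filterS _ _ (nbhs_filter J0) _ _ _ (filterI n0 (filterI n1 (filterI n2 (filterI n3 n4))))).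
move=> J [DJ [b1 [b2 [b3 b4]]]]; split; first exact: DJ.
split.
- by apply: le_trans b1 _; have [h _ _] := le_sum3 (N0 (0, 1, 0, 0)) S0 (N0 (0, 0, 0, 1%:M)).
- move=> i; apply: le_trans (b2 i) _.
  have [_ h _] := le_sum3 (N0 (0, 1, 0, 0)) S0 (N0 (0, 0, 0, 1%:M)).
  exact: (le_trans (ler_sum_term i g0) h).
- by apply: le_trans b3 _; have [_ _ h] := le_sum3 (N0 (0, 1, 0, 0)) S0 (N0 (0, 0, 0, 1%:M)).
- exact: b4.
Qed.

(** The [5 * C] is [2 * C] from the part [- 2%:M] of the Hessian and [3 * C] from the term of order
    zero; the [n] first order terms give [6 * C] each. Everything scales with [ep], so the condition
    on [A] is free of [ep]. *)
Lemma symF_derive_barrier_lt0 (a C A ep k : R) (q : 'cV[R]_n) J : 0 < a -> 0 <= C -> 0 < ep -> 0 <= A ->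
  5 * C + n%:R * (6 * C) < 2 * A * a ->
  jet_dom eps J -> jet_bounded a C J -> `|k| <= 3 * ep -> (forall i, `|q i 0| <= 6 * ep) ->
  'D_((0, k, q, ep *: barrier_hess e A) : jet) G J < 0.
Proof.
move=> a0 C0 ep0 A0 hA DJ [b1 b2 b3 b4] kb qb.
have dG := symF_differentiable (sol_FC1 Hsol) DJ.
have -> : ((0, k, q, ep *: barrier_hess e A) : jet) =
    (- (2 * ep)) *: ((0, 0, 0, 1%:M) : jet) + ((2 * A * ep) *: ((0, 0, 0, e *m e^T) : jet)
    + (0, k, q, 0)).
  rewrite -[RHS]/((- (2 * ep) * 0 + (2 * A * ep * 0 + 0), - (2 * ep) * 0 + (2 * A * ep * 0 + k),
   - (2 * ep) *: 0 + (2 * A * ep *: 0 + q), - (2 * ep) *: 1%:M +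
     (2 * A * ep *: (e *m e^T) + 0)) : jet).
  rewrite !mulr0 !scaler0 !add0r addr0; congr (_, _).
  rewrite /barrier_hess scalerBr scalerA addrC (mulrC ep); congr (_ + _).
  by rewrite scaleNr scale_scalar_mx scalemx1 mulrC.
rewrite !derive_linear // (@symF_deriveE _ _ _ _ (sol_FC1 Hsol) J k q 0 DJ).
rewrite mxdot0r addr0.
have gb : dotv q (\col_i 'D_((0, 0, delta_mx i 0, 0) : jet) G J) <= n%:R * (6 * ep * C).
  by apply: dotv_le_coord; [exact: qb|move=> i; rewrite mxE; exact: b2].
have kb' := mul_le_norm kb b1.
have ep2 : `|- (2 * ep)| <= 2 * ep by rewrite normrN gtr0_norm // mulr_gt0.
have eb := mul_le_norm ep2 b3.
have Aep : 0 <= 2 * A * ep by rewrite !mulr_ge0 // ltW.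
have ab := ler_wpM2l Aep b4.
have : 0 < ep * (2 * A * a - (5 * C + n%:R * (6 * C))) by rewrite mulr_gt0 // subr_gt0.
exact: (sum_bounds_lt0 eb ab kb' gb).
Qed.

(* A is chosen so that A <e, a e> dominates the lower order terms of the linearized
   operator near the reflected jet at z, whatever the (small) size ep. *)
Lemma barrier_not_touching z : B1 (rx z) -> exists A s0 ep0 : R,
  [/\ 1 <= A, 0 < s0, s0 * A <= 1, 0 < ep0 &
  (forall x, enorm (x - z) < s0 -> enorm (rx x) < 1) /\
  forall ep V c x, 0 < ep < ep0 -> enorm V <= ep -> enorm (x - z) < s0 ->
    dotv x e < lam -> x != 0 -> 0 <= u x - v x <= 3 * ep ->
    ~ \forall y \near x, u x - v x - barrier e ep A z V c x <=
      u y - v y - barrier e ep A z V c y].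
Proof.
move=> Bz; have [a [C [a0 C0 /nbhs_ballP[eta /= eta0 heta]]]] := jet_bounded_near Bz.
pose A := 1 + (5 * C + n%:R * (6 * C)) / a.
have K0 : 0 <= 5 * C + n%:R * (6 * C) by rewrite addr_ge0 // mulr_ge0 // mulr_ge0.
have A1 : 1 <= A by rewrite lerDl divr_ge0 // ltW.
have hA : 5 * C + n%:R * (6 * C) < 2 * A * a.
  have -> : 2 * A * a = 2 * a + 2 * (5 * C + n%:R * (6 * C)).
    by rewrite /A; field; exact: lt0r_neq0.
  lra.
have nB : \forall x \near z, B1 (rx x).
  have /(_ B1) := @continuous_refl R n e lam z; apply.
  by apply: open_nbhs_nbhs; split => //; exact: open_B1.
have eta2 : 0 < eta / 2 by rewrite divr_gt0.
have /cvgr_dist_lt /(_ _ eta2) nJ := refl_jet_continuous Bz.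
have nBJ : nbhs z [set x | B1 (rx x) /\
    `|refl_jet u e lam z - refl_jet u e lam x| < eta / 2].
  exact: (filterI nB nJ).
have /nbhs_ballP[s1 /= s10 hs1] := nBJ.
(* Up to the radius [A^-1] one has [A l^2 <= |l|]: the quadratic term never outweighs the linear
   one. *)
pose s0 := Num.min s1 A^-1.
have A0 : 0 < A by apply: lt_le_trans A1.
have s00 : 0 < s0 by rewrite lt_min s10 invr_gt0.
have s0A : s0 * A <= 1 by rewrite -ler_pdivlMr // div1r ge_min lexx orbT.
(* [ep * (2 * A + 8)] bounds [3 ep], [6 ep] and [ep (2 A + 2)], the sizes by which value, gradient
   and Hessian leave the reflected jet. The other half of [eta] pays for moving that jet from [z] to
   [x]. *)
pose ep0 := eta / 2 / (2 * A + 8).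
have A8 : 0 < 2 * A + 8 by rewrite addr_gt0 // mulr_gt0.
have ep00 : 0 < ep0 by rewrite divr_gt0.
have near_z x : enorm (x - z) < s0 -> ball z s1 x.
  move=> xs; rewrite -ball_normE /= (le_lt_trans (norm_le_enorm _)) // enormBC.
  by rewrite (lt_le_trans xs) // ge_min lexx.
exists A, s0, ep0; split => //; split.
  by move=> x /near_z /hs1[/andP[]].
move=> ep V c x /andP[epgt0 epep0] Vep xs xl x0 /andP[f0 f3] fmin.
have [/andP[_ x1] Jx] := hs1 _ (near_z _ xs).
have Qs := barrier_hess_sym e ep A.
have [t /andP[t0 t1]] := touching_reflected_jet Hsol e1 lam0 xl x0 x1 Qs fmin.
apply/negP; rewrite -ltNge.
have qb i : `|(V - ep *: e + ep *: barrier_hess e A *m (x - z)) i 0| <= 6 * ep.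
  apply: le_trans (coord_le_enorm _ _) _.
  exact: (barrier_grad_le e1 epgt0 A1 s0A Vep (ltW xs)).
have kb : `|u x - v x| <= 3 * ep by rewrite ger0_norm.
have [DJ bJ] : jet_dom eps (enorm (rx x), v x + t * (u x - v x),
    grad v x + t *: (V - ep *: e + ep *: barrier_hess e A *m (x - z)),
    hess v x + t *: (ep *: barrier_hess e A)) /\
  jet_bounded a C (enorm (rx x), v x + t * (u x - v x),
    grad v x + t *: (V - ep *: e + ep *: barrier_hess e A *m (x - z)),
    hess v x + t *: (ep *: barrier_hess e A)).
  apply: heta; rewrite -ball_normE /=.
  apply: (norm_sub_lt_half Jx).
  apply: le_lt_trans (_ : ep * (2 * A + 8) < _); last by rewrite -ltr_pdivlMr.
  rewrite (jet_subE t) ; apply: jet_norm_le.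
  - by rewrite normr0 mulr_ge0 // ltW.
  - apply: le_trans (normr_scale_le _ t0 t1) _; apply: le_trans kb _.
    by rewrite mulrC ler_wpM2l ?(ltW epgt0) //; lra.
  - apply: le_trans (normr_scale_le _ t0 t1) _; apply/mx_norm_leP.
      by rewrite mulr_ge0 // ltW.
    move=> i j; rewrite ord1; apply: le_trans (qb i) _.
    by rewrite mulrC ler_wpM2l ?(ltW epgt0) //; lra.
  - apply: le_trans (normr_scale_le _ t0 t1) _; apply/mx_norm_leP.
      by rewrite mulr_ge0 // ltW.
    move=> i j; apply: le_trans (barrier_hess_coord e1 i j epgt0 A1) _.
    by rewrite ler_wpM2l ?(ltW epgt0) //; lra.
exact: (symF_derive_barrier_lt0 a0 C0 epgt0 (ltW A0) hA DJ bJ kb qb).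
Qed.

End BarrierTouching.

(** * Minima on closed sets and size of the barrier on balls and spheres *)

Section ClosedSets.
Variables (R : realType) (n : nat).
Implicit Types (g h : 'cV[R]_n -> R) (C : set 'cV[R]_n).

Lemma closed_le_fun g c : continuous g -> closed [set x | g x <= c].
Proof. by move=> cg; apply: closed_comp (@closed_le _ c) => x _; exact: cg. Qed.

Lemma closed_ge_fun g c : continuous g -> closed [set x | c <= g x].
Proof. by move=> cg; apply: closed_comp (@closed_ge _ c) => x _; exact: cg. Qed.

Lemma continuous_enormB (z : 'cV[R]_n) : continuous (fun x : 'cV[R]_n => enorm (x - z)).
Proof.
move=> x; apply: (@continuous_comp _ _ _ (fun x : 'cV[R]_n => x - z) (@enorm R n)).
  by apply: (@continuousB _ _ _ id (cst z)); [exact: cvg_id|exact: cst_continuous].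
exact: continuous_enorm.
Qed.

Lemma continuous_dotv_cst (w : 'cV[R]_n) : continuous (fun x : 'cV[R]_n => dotv x w).
Proof.
by move=> x; apply: (@continuous_dotv _ _ _ id (cst w)); [exact: cvg_id|exact: cst_continuous].
Qed.

Lemma EVT_min_closed C g (B : R) : closed C -> (forall x, C x -> enorm x <= B) ->
  C !=set0 -> (forall x, C x -> {for x, continuous g}) ->
  exists2 c, C c & forall x, C x -> g c <= g x.
Proof.
move=> cC CB C0 cg.
have [|c] := compact_EVT_min C0 (compact_sublevel cC CB) (f := g).
  apply: continuous_in_subspaceT => x; rewrite inE; exact: cg.
by rewrite inE => Cc h; exists c => // x Cx; apply: h; rewrite inE.
Qed.

Lemma dotv_unit_le (e x : 'cV[R]_n) : dotv e e = 1 -> `|dotv x e| <= enorm x.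
Proof.
move=> e1; have := dotv_CS x e; have := dotv_CSN x e.
by rewrite (enorm_unit e1) mulr1 ler_norml => -> ->.
Qed.

Lemma near_enorm_lt (z x : 'cV[R]_n) (s : R) : enorm (x - z) < s ->
  \forall y \near x, enorm (y - z) < s.
Proof.
move=> xs; apply: (@cvgr_lt _ _ (nbhs x) _ (fun y : 'cV[R]_n => enorm (y - z)) (enorm (x - z))) => //.
exact: continuous_enormB.
Qed.

Lemma near_enorm_gt (z x : 'cV[R]_n) (s : R) : s < enorm (x - z) ->
  \forall y \near x, s < enorm (y - z).
Proof.
move=> xs; apply: (@cvgr_gt _ _ (nbhs x) _ (fun y : 'cV[R]_n => enorm (y - z)) (enorm (x - z))) => //.
exact: continuous_enormB.
Qed.

End ClosedSets.

Section BarrierBounds.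
Variables (R : realType) (n : nat) (e : 'cV[R]_n).
Hypothesis e1 : dotv e e = 1.
Implicit Types (x z V : 'cV[R]_n) (A ep c s : R).

Lemma continuous_barrier ep A z V c : continuous (barrier e ep A z V c).
Proof.
move=> x.
have -> : barrier e ep A z V c = (fun x : 'cV[R]_n => c + dotv V (x - z) +
  ep * (dotv (z - x) e + A * (dotv (z - x) e * dotv (z - x) e) - dotv (x - z) (x - z))).
  by apply/funext => y; rewrite barrierE // expr2.
have c1 : {for x, continuous (fun x : 'cV[R]_n => x - z)}.
  by apply: (@continuousB _ _ _ id (cst z)); [exact: cvg_id|exact: cst_continuous].
have c2 : {for x, continuous (fun x : 'cV[R]_n => z - x)}.
  by apply: (@continuousB _ _ _ (cst z) id); [exact: cst_continuous|exact: cvg_id].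
have ce (w : 'cV[R]_n) : {for x, continuous (fun _ : 'cV[R]_n => w)} by exact: cst_continuous.
have cr (k : R) : {for x, continuous (fun _ : 'cV[R]_n => k)} by exact: cst_continuous.
have c3 := continuous_dotv c2 (ce e).
have c4 := continuous_dotv (ce V) c1.
have c5 := continuous_dotv c1 c1.
have c6 := continuousD c3 (continuousM (cr A) (continuousM c3 c3)).
exact: (continuousD (continuousD (cr c) c4) (continuousM (cr ep) (continuousB c6 c5))).
Qed.

Lemma barrier_tilt ep A z V c x : barrier e ep A z V c x =
  barrier e ep A z 0 0 x + c + dotv V (x - z).
Proof. by rewrite !barrierE // dotv0l; ring. Qed.

Lemma barrier_le ep A z x s : 0 < ep -> 0 <= A -> s * A <= 1 -> enorm (x - z) <= s ->
  barrier e ep A z 0 0 x <= ep * (2 * s).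
Proof.
move=> ep0 A0 sA xs; rewrite barrierE // dotv0l !add0r ler_wpM2l ?(ltW ep0) //.
have := dotv_unit_le (z - x) e1; rewrite enormBC; move: (dotv (z - x) e) => l ls.
have s0 : 0 <= s by exact: le_trans (enorm_ge0 _) xs.
have ls' : `|l| <= s by exact: le_trans xs.
have l2 : A * l ^+ 2 <= s.
  have -> : l ^+ 2 = `|l| * `|l| by rewrite -normrM -expr2 ger0_norm ?sqr_ge0.
  rewrite mulrA; apply: le_trans (_ : (A * `|l|) * s <= _).
    by rewrite ler_wpM2l // mulr_ge0.
  rewrite ler_piMl //; apply: le_trans sA; rewrite mulrC; exact: ler_wpM2r.
have := dotvv_ge0 (x - z); have := ler_norm l; lra.
Qed.

Lemma barrier_ge ep A z x s : 0 < ep -> 0 <= A -> s <= 1 -> enorm (x - z) <= s ->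
  - (ep * (2 * s)) <= barrier e ep A z 0 0 x.
Proof.
move=> ep0 A0 s1 xs; rewrite barrierE // dotv0l !add0r -mulrN ler_wpM2l ?(ltW ep0) //.
have := dotv_unit_le (z - x) e1; rewrite enormBC ler_norml => /andP[h _].
have A2 : 0 <= A * dotv (z - x) e ^+ 2 by rewrite mulr_ge0 ?sqr_ge0.
have : dotv (x - z) (x - z) <= s.
  rewrite -enorm_sqr expr2; have := enorm_ge0 (x - z).
  move: (enorm (x - z)) xs => d ds d0; nra.
lra.
Qed.

(** Since [A |l| <= 1], the term [A l^2] is at most [|l|]: it does not exceed [- l] when [l <= 0],
    and at most doubles [l] otherwise. Hence [l + A l^2 <= s^2 / 2], against [- s^2] from the last
    term. *)
Lemma barrier_sphere_le ep A z x s : 0 < ep -> 0 <= A -> s * A <= 1 -> s <= 1 ->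
  enorm (x - z) = s -> dotv (z - x) e <= s ^+ 2 / 4 ->
  barrier e ep A z 0 0 x <= - (ep * (s ^+ 2 / 2)).
Proof.
move=> ep0 A0 sA s1 xs; rewrite barrierE // dotv0l !add0r -mulrN ler_pM2l //.
rewrite -enorm_sqr xs.
have := dotv_unit_le (z - x) e1; rewrite enormBC xs ler_norml.
move: (dotv (z - x) e) => l /andP[l1 l2] l3.
suff : l + A * l ^+ 2 <= s ^+ 2 / 2 by move: (s ^+ 2) (l ^+ 2) => *; lra.
rewrite expr2; have [l0|l0] := leP l 0.
  have : 0 <= s ^+ 2 by rewrite sqr_ge0.
  have : A * (- l) <= 1 by apply: le_trans sA; rewrite mulrC ler_wpM2r // lerNl.
  move=> Al s20; have : 0 <= (- l) * (1 - A * - l) by rewrite mulr_ge0 ?oppr_ge0 // subr_ge0.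
  lra.
have Al : A * l <= 1 by apply: le_trans sA; rewrite mulrC ler_wpM2r.
have : 0 <= l * (1 - A * l) by rewrite mulr_ge0 ?subr_ge0 // ltW.
lra.
Qed.

End BarrierBounds.

Lemma eq_le_of (R : realType) (x y : R) : x = y -> x <= y.
Proof. by move=> ->. Qed.

(** * Strict positivity at the boundary and at regular points *)

Section StrongMaximum.
Variables (R : realType) (n : nat) (eps : R) (F : R -> R -> 'cV[R]_n -> 'M[R]_n -> R)
  (u : 'cV[R]_n -> R) (rbar : R).
Hypothesis Hsol : singular_solution eps F u rbar.
Variables (e : 'cV[R]_n) (lam : R).
Hypotheses (e1 : dotv e e = 1) (lam0 : 0 < lam).
Notation B1 := (@punctured_ball R n 1).
Notation K1 := (@punctured_cball R n 1).
Notation rx := (refl e lam).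
Notation v := (fun y => u (rx y)).
Notation f := (fun y => u y - u (rx y)).

(** The reflected point may lie on the unit sphere, where [u] vanishes; the origin is excluded
    because the value of [u] there carries no information. *)
Definition reflection_le := forall x, dotv x e < lam -> x != 0 -> enorm (rx x) <= 1 -> 0 <= f x.

Hypothesis Hnn : reflection_le.

(** The centre [z] may be the origin, or a point whose reflection lies on the unit sphere. *)
Definition locally_pos z := exists rho c : R, [/\ 0 < rho, 0 < c &
  forall y, enorm (y - z) < rho -> y != 0 -> enorm (rx y) <= 1 -> c <= f y].

Lemma u_continuous x : B1 x -> {for x, continuous u}.
Proof. by move=> Bx; exact/differentiable_continuous/(C2_differentiable (sol_C2_on Hsol)). Qed.

Lemma v_continuous x : B1 (rx x) -> {for x, continuous v}.
Proof.
by move=> Bx; apply: continuous_comp; [exact: continuous_refl|exact: u_continuous].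
Qed.

Lemma f_continuous x : dotv x e < lam -> x != 0 -> enorm (rx x) < 1 -> {for x, continuous f}.
Proof.
move=> xl x0 x1; have [B Br] := cap_punctured_ball e1 lam0 xl x0 x1.
exact: (continuousB (u_continuous B) (v_continuous Br)).
Qed.

Lemma u_within_eps p (t : R) : K1 p -> 0 < t -> exists2 rho : R, 0 < rho &
  forall y, K1 y -> enorm (y - p) < rho -> `|u p - u y| < t.
Proof.
move=> Kp t0; have [_ cu _ _] := sol_C2 Hsol.
have := cu p => /cvgr_dist_lt /(_ t t0).
rewrite /nbhs /= -(nbhs_subspace_in Kp) => /nbhs_ballP[r /= r0 h].
exists r => // y Ky yp; apply: h => //; rewrite -ball_normE /=.
by rewrite (le_lt_trans (norm_le_enorm _)) // enormBC.
Qed.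

Lemma sing_ge V r : 0 < r < rbar -> exists x0, esphere r x0 /\
  forall y, 0 < enorm y < r -> u x0 + dotv V x0 <= u y + dotv V y.
Proof.
move=> hr; have [x0 [h1 h2 h3]] := sol_sing Hsol V hr.
exists x0; split => // y hy; rewrite -lee_fin -h3.
by apply: ereal_inf_lbound; exists y.
Qed.

(** At the origin the singularity hypothesis with [V = 0] bounds [u] below by its minimum on a
    sphere, which is positive; elsewhere continuity suffices. *)
Lemma u_lower_bound z : enorm z < 1 -> exists r1 c : R, [/\ 0 < r1, 0 < c &
  forall y, enorm (y - z) < r1 -> y != 0 -> c <= u y].
Proof.
move=> zlt; have [->|z0] := eqVneq z 0.
  have /andP[rb0 rb1] := sol_rbar Hsol.
  have hr : 0 < rbar / 2 < rbar by rewrite divr_gt0 //= ltr_pdivrMr //; lra.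
  have [x0 [h1 h2]] := sing_ge 0 hr.
  exists (rbar / 2), (u x0); split; first by case/andP: hr.
    apply: (sol_pos Hsol); rewrite /punctured_ball /= h1.
    by have /andP[-> h3] := hr; rewrite (lt_le_trans h3).
  move=> y; rewrite subr0 -enorm_gt0 => y1 y0.
  by have := h2 y; rewrite !dotv0l !addr0; apply; rewrite y0.
have Bz : B1 z.
  by rewrite /punctured_ball /= enorm_gt0 z0.
have uz := sol_pos Hsol Bz.
have uz2 : 0 < u z / 2 by rewrite divr_gt0.
have Kz : K1 z by rewrite /punctured_cball /=; case/andP: Bz => -> /ltW ->.
have [r1 r10 h1] := u_within_eps Kz uz2.
have zz : enorm (z - z) < 1 - enorm z by rewrite subrr enorm0 subr_gt0; case/andP: Bz.
exists (Num.min r1 (1 - enorm z)), (u z / 2); split => //.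
  by rewrite lt_min r10 subr_gt0; case/andP: Bz.
move=> y; rewrite lt_min -enorm_gt0 => /andP[y1 y2] y0.
have Ky : K1 y.
  rewrite /punctured_cball /= y0 /= -(subrK z y).
  by apply: le_trans (ler_enormD _ _) _; rewrite -lerBrDr ltW.
have := h1 y Ky y1; rewrite ltr_norml => /andP[_]; lra.
Qed.

Lemma locally_pos_boundary z : dotv z e < lam -> enorm (rx z) = 1 -> locally_pos z.
Proof.
move=> zl z1.
have zlt : enorm z < 1 by rewrite -z1 enorm_lt_refl.
have [r1 [c [r10 c0 hc]]] := u_lower_bound zlt.
have Kz : K1 (rx z) by rewrite /punctured_cball /= z1 ltr01 lexx.
have c2 : 0 < c / 2 by rewrite divr_gt0.
have [r2 r20 h2] := u_within_eps Kz c2.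
exists (Num.min (Num.min r1 r2) 1), (c / 2); split => //.
  by rewrite !lt_min r10 r20 ltr01.
move=> y; rewrite !lt_min => /andP[/andP[y1 y2] y3] y0 yr.
have := hc y y1 y0; suff : u (rx y) < c / 2 by lra.
have yz : enorm (rx y - rx z) = enorm (y - z) by rewrite reflB enorm_reflv.
have ry0 : 0 < enorm (rx y).
  have := ler_enormB (rx z) (rx z - rx y).
  by rewrite subKr z1 (enormBC (rx z)) yz; lra.
have := h2 (rx y); rewrite yz => /(_ _ y2).
have -> : u (rx z) = 0 by apply: (sol_bd Hsol).
rewrite sub0r normrN => h; apply: le_lt_trans (ler_norm _) (h _).
by rewrite /punctured_cball /= ry0 yr.
Qed.

Section Ball.
Variables (z : 'cV[R]_n) (A s ep0 : R).
Hypotheses (A1 : 1 <= A) (s0 : 0 < s) (s1 : s <= 1) (sA : s * A <= 1) (ep00 : 0 < ep0).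
Hypothesis cap : forall x, enorm (x - z) <= s -> dotv x e < lam /\ enorm (rx x) < 1.
Hypothesis Hnt : forall ep V c x, 0 < ep < ep0 -> enorm V <= ep -> enorm (x - z) <= s ->
    dotv x e < lam -> x != 0 -> 0 <= u x - v x <= 3 * ep ->
    ~ \forall y \near x, u x - v x - barrier e ep A z V c x <=
      u y - v y - barrier e ep A z V c y.

Let A0 : 0 <= A. Proof. exact: le_trans A1. Qed.

(** Where [l <= s^2 / 4] the barrier is negative and [0 <= f] is enough. The rest of the sphere is
    strictly behind [z] and lies in a compact set on which [f] has a positive minimum; a small [ep]
    keeps the barrier below it. *)
Lemma sphere_gap : (forall x, enorm (x - z) = s -> x != 0) ->
  (forall x, enorm (x - z) = s -> dotv x e < dotv z e -> 0 < f x) ->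
  exists ep c : R, [/\ 0 < ep < ep0, 0 < c &
    forall x, enorm (x - z) = s -> c <= f x - barrier e ep A z 0 0 x].
Proof.
move=> sph0 left.
have s24 : 0 < s ^+ 2 / 4 by rewrite divr_gt0 // exprn_gt0.
pose C := [set x | enorm (x - z) <= s] `&` [set x | s <= enorm (x - z)] `&`
  [set x | dotv x e <= dotv z e - s ^+ 2 / 4].
have CE x : C x -> enorm (x - z) = s /\ dotv x e <= dotv z e - s ^+ 2 / 4.
  by move=> [[/= a b] c]; split => //; apply/le_anti; rewrite a b.
have [c [c0 hc]] : exists c : R, 0 < c /\ forall x, C x -> c <= f x.
  have [C0|/set0P[x0 Cx0]] := eqVneq C set0.
    by exists 1; split => // x; rewrite C0.
  have [|||x Cx xmin] := @EVT_min_closed R n C f (s + enorm z) _ _ (ex_intro _ x0 Cx0).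
  - apply: closedI; last exact/closed_le_fun/continuous_dotv_cst.
    by apply: closedI; [exact/closed_le_fun/continuous_enormB|exact/closed_ge_fun/continuous_enormB].
  - move=> x /CE[xs _]; rewrite -[X in enorm X](subrK z) -xs; exact: ler_enormD.
  - move=> x /CE[xs _]; have [h1 h2] := cap (eq_le_of xs).
    by apply: f_continuous => //; exact: sph0.
  exists (f x); split => //; have [xs xz] := CE x Cx; apply: left => //.
  by apply: le_lt_trans xz _; rewrite ltrBlDr ltrDl.
pose ep := Num.min (ep0 / 2) (c / 4).
have epgt0 : 0 < ep by rewrite lt_min !divr_gt0.
have epc : ep <= c / 4 by rewrite ge_min lexx orbT.
have ephalf : ep0 / 2 < ep0 by rewrite ltr_pdivrMr // ltr_pMr // ltr1n.
have ep2 : ep < ep0 by apply: le_lt_trans ephalf; rewrite ge_min lexx.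
exists ep, (Num.min (ep * (s ^+ 2 / 2)) (c / 2)); split.
- by rewrite epgt0.
- by rewrite lt_min !mulr_gt0 // ?exprn_gt0.
move=> x xs; rewrite ge_min.
have [hl|hl] := leP (dotv (z - x) e) (s ^+ 2 / 4).
  have := barrier_sphere_le e1 epgt0 A0 sA s1 xs hl.
  have [h1 h2] := cap (eq_le_of xs).
  have := Hnn h1 (sph0 _ xs) (ltW h2).
  by move=> /= p1 p2; apply/orP; left; lra.
have := barrier_le e1 epgt0 A0 sA (eq_le_of xs).
have : c <= f x.
  apply: hc; split; first by rewrite /= xs.
  by move: hl; rewrite dotvBl /=; lra.
move=> /= p1 p2; apply/orP; right.
have : ep * (2 * s) <= c / 2.
  apply: le_trans (_ : ep * 2 <= _); last by lra.
  by rewrite ler_pM2l //; have := s1; lra.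
lra.
Qed.

Lemma locally_pos_of_gap ep c : 0 < ep -> 0 < c ->
  (forall x, enorm (x - z) <= s -> x != 0 -> c <= f x - barrier e ep A z 0 0 x) ->
  locally_pos z.
Proof.
(* On this radius the barrier is at least [- c / 2]. *)
move=> epgt0 c0 h; pose rho := Num.min s (c / (4 * ep)).
have r0 : 0 < rho by rewrite lt_min s0 divr_gt0 // mulr_gt0.
have rs : rho <= s by rewrite ge_min lexx.
exists rho, (c / 2); split => //; first by rewrite divr_gt0.
move=> y yr y0 _; have := h y (le_trans (ltW yr) rs) y0.
have := barrier_ge e1 epgt0 A0 (le_trans rs s1) (ltW yr).
have : ep * (2 * rho) <= c / 2.
  have : rho <= c / (4 * ep) by rewrite ge_min lexx orbT.
  by rewrite ler_pdivlMr ?mulr_gt0 //; lra.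
move=> /=; lra.
Qed.

(** The ball avoids the origin, so the minimum is attained. If it were nonpositive, it would be
    interior with [0 <= f <= barrier <= 3 * ep], and the barrier would touch there. *)
Lemma ball_gap_nonzero ep c : 0 < ep < ep0 -> 0 < c -> s < enorm z ->
  (forall x, enorm (x - z) = s -> c <= f x - barrier e ep A z 0 0 x) ->
  exists2 c' : R, 0 < c' &
    forall x, enorm (x - z) <= s -> x != 0 -> c' <= f x - barrier e ep A z 0 0 x.
Proof.
move=> /[dup] epb /andP[epgt0 _] c0 sz hsph.
have nz x : enorm (x - z) <= s -> x != 0.
  apply: contraTneq => ->; by rewrite sub0r enormN -ltNge.
pose g x := f x - barrier e ep A z 0 0 x.
have [||||x xs xmin] := @EVT_min_closed R n [set x | enorm (x - z) <= s] g (s + enorm z).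
- exact/closed_le_fun/continuous_enormB.
- move=> x /= xs; rewrite -[X in enorm X](subrK z).
  by apply: le_trans (ler_enormD _ _) _; rewrite lerD2r.
- by exists z; rewrite /= subrr enorm0 ltW.
- move=> x xs; have [h1 h2] := cap xs.
  exact: (continuousB (f_continuous h1 (nz _ xs) h2) (@continuous_barrier _ _ _ _ _ _ _ _ _)).
exists (g x); last by move=> y ys _; exact: xmin.
rewrite ltNge; apply/negP => gx.
have xlt : enorm (x - z) < s.
  rewrite lt_neqAle xs andbT; apply/eqP => xs'.
  by have := lt_le_trans c0 (hsph x xs'); rewrite ltNge gx.
have [h1 h2] := cap xs.
have h3 := Hnn h1 (nz _ xs) (ltW h2).
apply: (Hnt epb _ xs h1 (nz _ xs) (V := 0) (c := 0)); first by rewrite enorm0 ltW.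
- rewrite h3 /=; have := barrier_le e1 epgt0 A0 sA xs.
  have : ep * (2 * s) <= ep * 3 by rewrite ler_pM2l //; have := s1; lra.
  by move: gx; rewrite /g /=; lra.
- by apply: filterS (near_enorm_lt xlt) => y /ltW ys; exact: xmin.
Qed.

End Ball.
End StrongMaximum.

Lemma sub_subD_le (R : realFieldType) (x b c x' b' c' : R) :
  x - b - c <= x' - b' - c' -> x - (b + c) <= x' - (b' + c').
Proof. lra. Qed.

Lemma gap_contradiction (R : realFieldType) (dr m uy vy by_ ux vx bx v0 py px w w' : R) :
  0 < dr -> w <= w' -> w' = dr / 16 -> uy - vy - by_ < m + dr / 4 ->
  vy + by_ - v0 - py <= w -> - (dr / 4) <= vx + bx - v0 - px ->
  m + dr <= ux - vx - bx -> ux - px <= uy - py -> False.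
Proof. lra. Qed.

(** * Strict positivity at the singular point *)

Section SingularBall.
Variables (R : realType) (n : nat) (eps : R) (F : R -> R -> 'cV[R]_n -> 'M[R]_n -> R)
  (u : 'cV[R]_n -> R) (rbar : R).
Hypothesis Hsol : singular_solution eps F u rbar.
Variables (e : 'cV[R]_n) (lam : R).
Hypotheses (e1 : dotv e e = 1) (lam0 : 0 < lam).
Notation B1 := (@punctured_ball R n 1).
Notation rx := (refl e lam).
Notation v := (fun y => u (rx y)).
Notation f := (fun y => u y - u (rx y)).
Hypothesis Hnn : reflection_le u e lam.

(** The reflection of the origin is a regular point of [u], so [v + barrier] has a tangent plane at
    0 even though [u] may not. Its slope [p] is what the singularity hypothesis will be applied to,
    with [V := - p]. *)
Lemma reflected_expansion ep A : B1 (rx 0) -> 0 < ep -> 1 <= A ->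
  exists p : 'cV[R]_n, forall eta : R, 0 < eta -> exists2 rho : R, 0 < rho &
    forall x, enorm x < rho ->
      `|v x + barrier e ep A 0 0 0 x - v 0 - dotv p x| <= eta * enorm x.
Proof.
move=> B0 ep0 A1; exists (reflv e (grad u (rx 0)) - ep *: e) => eta eta0.
have du := C2_differentiable (sol_C2_on Hsol) B0.
have eta2 : 0 < eta / 2 by rewrite divr_gt0.
have /nbhs_ballP[r /= r0 hr] := differentiable_expansion du eta2.
pose k := ep * (A + 1).
have k0 : 0 < k by rewrite mulr_gt0 //; lra.
exists (Num.min r (eta / 2 / k)); first by rewrite lt_min r0 divr_gt0.
move=> x; rewrite lt_min => /andP[xr xk].
have xE : rx x = rx 0 + reflv e x by rewrite -[x in LHS]addr0 reflD addrC.
have : ball 0 r (reflv e x).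
  by rewrite -ball_normE /= sub0r normrN (le_lt_trans (norm_le_enorm _)) // enorm_reflv.
move=> /hr; rewrite -xE derive_gradE // -dotv_reflv_swap //.
move: (reflv e (grad u (rx 0))) => g h1.
have h2 : `|v x - v 0 - dotv g x| <= eta / 2 * enorm x.
  apply: le_trans h1 _; rewrite ler_wpM2l ?(ltW eta2) //.
  by rewrite (le_trans (norm_le_enorm _)) // enorm_reflv.
have h3 : `|barrier e ep A 0 0 0 x + ep * dotv e x| <= eta / 2 * enorm x.
  rewrite barrierE // dotv0l sub0r subr0 !dotvE !add0r (dotvC e).
  rewrite -mulrDr normrM gtr0_norm //.
  have h4 : `|dotv x e| <= enorm x := dotv_unit_le x e1.
  have h5 := enorm_ge0 x.
  have h6 : dotv x e ^+ 2 <= enorm x ^+ 2.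
    by rewrite -[dotv x e ^+ 2]ger0_norm ?sqr_ge0 // normrX lerXn2r.
  have h7 : 0 <= A * dotv x e ^+ 2 by rewrite mulr_ge0 ?sqr_ge0 //; lra.
  have h8 : A * dotv x e ^+ 2 <= A * enorm x ^+ 2 by rewrite ler_wpM2l //; lra.
  have h9 : 0 <= enorm x ^+ 2 by rewrite sqr_ge0.
  have h10 : `|- dotv x e + A * (- dotv x e) ^+ 2 - dotv x x + dotv x e| <= (A + 1) * enorm x ^+ 2.
    by rewrite sqrrN -enorm_sqr ler_norml; apply/andP; split; lra.
  apply: le_trans (_ : ep * ((A + 1) * enorm x ^+ 2) <= _).
    by rewrite ler_wpM2l ?(ltW ep0).
  rewrite expr2 !mulrA -/k ler_wpM2r // mulrC -ler_pdivlMr //; exact: ltW.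
have -> : v x + barrier e ep A 0 0 0 x - v 0 - dotv (g - ep *: e) x =
    (v x - v 0 - dotv g x) + (barrier e ep A 0 0 0 x + ep * dotv e x).
  by rewrite !dotvE; ring.
apply: le_trans (ler_normD _ _) _; lra.
Qed.

Variables (A s ep0 : R).
Hypotheses (A1 : 1 <= A) (s0 : 0 < s) (s1 : s <= 1) (sA : s * A <= 1).
Hypothesis cap : forall x, enorm (x - 0) <= s -> dotv x e < lam /\ enorm (rx x) < 1.
Hypothesis Hnt : forall ep V c x, 0 < ep < ep0 -> enorm V <= ep -> enorm (x - 0) <= s ->
    dotv x e < lam -> x != 0 -> 0 <= u x - v x <= 3 * ep ->
    ~ \forall y \near x, u x - v x - barrier e ep A 0 V c x <=
      u y - v y - barrier e ep A 0 V c y.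
Variables (ep c : R).
Hypotheses (epb : 0 < ep < ep0) (c0 : 0 < c)
  (hsph : forall x, enorm (x - 0) = s -> c <= f x - barrier e ep A 0 0 0 x).

Let g x := f x - barrier e ep A 0 0 0 x.
Let epgt0 : 0 < ep. Proof. by case/andP: epb. Qed.
Let A0 : 0 <= A. Proof. exact: le_trans A1. Qed.

Lemma g_continuous x : enorm x <= s -> x != 0 -> {for x, continuous g}.
Proof.
move=> xs x0; have [|h1 h2] := cap (x := x); first by rewrite subr0.
exact: (continuousB (f_continuous Hsol e1 lam0 h1 x0 h2) (@continuous_barrier R n e ep A 0 0 0 x)).
Qed.

Lemma barrier_le2 x : enorm x <= s -> barrier e ep A 0 0 0 x <= 2 * ep.
Proof.
move=> xs; have := barrier_le e1 epgt0 A0 sA (z := 0) (x := x).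
rewrite subr0 => /(_ xs) /le_trans; apply.
by rewrite mulrC ler_wpM2r ?(ltW epgt0) //; have := s1; lra.
Qed.

(** Suppose the tilted function [G] drops below [m] at [x1]. Close to the origin it exceeds [G x1],
    the tilt being small there, and on the sphere the gap [c] outweighs the tilt. So [G] has a
    minimum inside an annulus, where a tilted barrier touches. *)
Lemma tilted_ge m V : m <= 0 -> (forall x, enorm x <= s -> x != 0 -> m <= g x) ->
  enorm V <= Num.min ep (c / 2) ->
  forall x, enorm x <= s -> x != 0 -> m <= g x - dotv V x.
Proof.
move=> m0 hm; rewrite le_min => /andP[Vep Vc] x1 x1s x10.
rewrite leNgt; apply/negP => x1m.
pose G x := g x - dotv V x.
have Gx1 : G x1 < m by [].
pose rho := Num.min (enorm x1) ((m - G x1) / (ep + ep)).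
have rho0 : 0 < rho by rewrite lt_min enorm_gt0 x10 divr_gt0 ?subr_gt0 ?addr_gt0.
have Glow x : enorm x < rho -> x != 0 -> G x1 < G x.
  rewrite lt_min => /andP[xx1 xr] x0.
  have := hm x (le_trans (ltW xx1) x1s) x0.
  have : dotv V x < m - G x1.
    apply: le_lt_trans (dotv_CS _ _) _.
    apply: le_lt_trans (_ : (ep + ep) * enorm x < _).
      by rewrite ler_wpM2r ?enorm_ge0 //; have := epgt0; lra.
    by rewrite mulrC -ltr_pdivlMr ?addr_gt0.
  rewrite /G; lra.
have [||||x2 [x2s x2r] x2min] := @EVT_min_closed R n
    ([set x | enorm (x - 0) <= s] `&` [set x | rho / 2 <= enorm (x - 0)]) G s.
- by apply: closedI; [exact/closed_le_fun/continuous_enormB|exact/closed_ge_fun/continuous_enormB].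
- by move=> x [/=]; rewrite subr0.
- exists x1; split; rewrite /= subr0 //.
  have : rho <= enorm x1 by rewrite ge_min lexx.
  by have := rho0; lra.
- move=> x [/=]; rewrite !subr0 => xs xr.
  have x0 : x != 0 by rewrite -enorm_gt0; have := rho0; lra.
  apply: (continuousB (g_continuous xs x0)).
  by apply: (@continuous_dotv _ _ _ (fun=> V) id); [exact: cst_continuous|exact: cvg_id].
rewrite /= subr0 in x2s x2r.
have Gx2 : G x2 <= G x1.
  apply: x2min; split; rewrite /= subr0 //.
  have : rho <= enorm x1 by rewrite ge_min lexx.
  by have := rho0; lra.
have x20 : x2 != 0 by rewrite -enorm_gt0; have := rho0; lra.
have x2rho : rho / 2 < enorm x2.
  rewrite lt_neqAle x2r andbT; apply/eqP => x2E.
  have : G x1 < G x2 by apply: Glow => //; have := rho0; lra.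
  lra.
have Vx : dotv V x2 <= enorm V.
  apply: le_trans (dotv_CS _ _) _; rewrite ler_piMr ?enorm_ge0 //.
  exact: le_trans s1.
have x2lt : enorm x2 < s.
  rewrite lt_neqAle x2s andbT; apply/eqP => x2E.
  have : c <= g x2 by apply: hsph; rewrite subr0.
  by have := c0; move: Gx2 Gx1 Vx Vc m0; rewrite /G; lra.
have [|h1 h2] := cap (x := x2); first by rewrite subr0.
apply: (Hnt epb Vep _ h1 x20 (c := 0)); first by rewrite subr0.
(* Origin of the constant 3: the barrier is at most [2 * ep] and the tilt at most [ep]. *)
- rewrite (Hnn h1 x20 (ltW h2)) /=.
  have := barrier_le2 x2s; move: Gx2 Gx1 Vx Vep m0; rewrite /G /g; lra.
- have n1 : \forall y \near x2, enorm (y - 0) < s by apply: near_enorm_lt; rewrite subr0.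
  have n2 : \forall y \near x2, rho / 2 < enorm (y - 0) by apply: near_enorm_gt; rewrite subr0.
  apply: filterS (filterI n1 n2) => y [y1 y2].
  have := x2min y; rewrite /G /g !(barrier_tilt e ep A 0 V 0) !subr0 !addr0.
  move=> /(_ (conj (ltW y1) (ltW y2))); exact: sub_subD_le.
Qed.

(* If the infimum m is nonpositive, all small tilts together give a lower bound by a
   cone, f - barrier >= m + d |x|; since v + barrier is differentiable at 0, this
   contradicts the hypothesis on u + V.x for V minus its gradient. *)
Lemma ball_gap_zero : exists2 c' : R, 0 < c' &
    forall x, enorm (x - 0) <= s -> x != 0 -> c' <= f x - barrier e ep A 0 0 0 x.
Proof.
pose S := [set g x | x in [set x | enorm x <= s /\ x != 0]].
have Slb : lbound S (- (2 * ep)).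
  move=> _ [x [xs x0] <-]; have [|h1 h2] := cap (x := x); first by rewrite subr0.
  have := Hnn h1 x0 (ltW h2); have := barrier_le2 xs; rewrite /g /=; lra.
have en : enorm e = 1 := enorm_unit e1.
have Sne : S !=set0.
  exists (g (s *: e)), (s *: e) => //; split.
    by rewrite enormZ en mulr1 gtr0_norm.
  by rewrite -enorm_gt0 enormZ en mulr1 gtr0_norm.
have Sinf : has_inf S by split => //; exists (- (2 * ep)).
pose m := inf S.
have hm x : enorm x <= s -> x != 0 -> m <= g x.
  by move=> xs x0; apply: ge_inf; [case: Sinf|exists x].
have [m0|m0] := ltP 0 m.
  by exists m => // x; rewrite subr0; exact: hm.
exfalso.
pose d := Num.min ep (c / 2).
have d0 : 0 < d by rewrite lt_min epgt0 divr_gt0.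
have hd x : enorm x <= s -> x != 0 -> m + d * enorm x <= g x.
  move=> xs x0; have nx : 0 < enorm x by rewrite enorm_gt0.
  (* The tilt in the direction of [x] itself, of maximal length [d], yields the cone. *)
  have := tilted_ge m0 hm (V := (d / enorm x) *: x) _ xs x0.
  rewrite enormZ dotvZl -enorm_sqr ger0_norm ?divr_ge0 ?(ltW d0) ?(ltW nx) //.
  rewrite divfK ?lt0r_neq0 // => /(_ (lexx _)).
  rewrite expr2 mulrA divfK ?lt0r_neq0 // lerBrDr; exact.
have B0 : B1 (rx 0).
  have [|h1 h2] := cap (x := 0); first by rewrite subrr enorm0 ltW.
  rewrite /punctured_ball /= h2 andbT.
  by apply: le_lt_trans (enorm_lt_refl e1 lam0 h1); exact: enorm_ge0.
have [p hp] := reflected_expansion B0 epgt0 A1.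
have d4 : 0 < d / 4 by rewrite divr_gt0.
have [rho rho0 hrho] := hp _ d4.
have /andP[rb0 _] := sol_rbar Hsol.
pose r := Num.min (Num.min rbar s) rho / 2.
have mn0 : 0 < Num.min (Num.min rbar s) rho by rewrite !lt_min rb0 s0 rho0.
have r0 : 0 < r by rewrite divr_gt0.
have rmin : r < Num.min (Num.min rbar s) rho by rewrite /r; lra.
move: (rmin); rewrite !lt_min => /andP[/andP[rrb rs] rrho].
have hrr : 0 < r < rbar by rewrite r0.
have [x0 [x0r hx0]] := sing_ge Hsol (- p) hrr.
have x0r' : enorm x0 = r by [].
have x00 : x0 != 0 by rewrite -enorm_gt0 x0r'.
have e0 : 0 < d * r / 4 by rewrite divr_gt0 // mulr_gt0.
(* The cone forces this almost minimal point into the ball of radius [r / 4]. After subtracting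
   [p.x] and the constant [v 0], [u] is below [m + 5 d r / 16] at [y] and at least [m + 3 d r / 4]
   at [x0]. *)
have [_ [y [ys y0] <-] ym] := inf_adherent e0 Sinf.
have yr : enorm y < r / 4.
  have := le_lt_trans (hd y ys y0) ym.
  by rewrite ltrD2l -mulrA ltr_pM2l.
have y0' : 0 < enorm y by rewrite enorm_gt0.
have yr' : enorm y < r by lra.
have hy : 0 < enorm y < r by rewrite y0'.
have := hx0 y hy; rewrite !dotvNl.
have x0rho : enorm x0 < rho by rewrite x0r'.
have yrho : enorm y < rho by exact: lt_trans rrho.
have := hrho x0 x0rho; have := hrho y yrho; rewrite !ler_norml => /andP[_ h1] /andP[h2 _].
have := hd x0 _ x00; rewrite x0r' => /(_ (ltW rs)).
have dy : d / 4 * enorm y <= d / 4 * (r / 4) by rewrite ler_wpM2l // ltW.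
have dr : 0 < d * r by rewrite mulr_gt0.
have E : d / 4 * (r / 4) = d * r / 16 by field.
have E2 : d / 4 * r = d * r / 4 by field.
move: ym h1 h2; rewrite /g x0r' E2 -/m => ym h1 h2 h3 h4.
exact: (gap_contradiction dr dy E ym h1 h2 h3 h4).
Qed.

End SingularBall.

(** * Strict positivity on the whole cap *)

Section StrictInequality.
Variables (R : realType) (n : nat) (eps : R) (F : R -> R -> 'cV[R]_n -> 'M[R]_n -> R)
  (u : 'cV[R]_n -> R) (rbar : R).
Hypothesis Hsol : singular_solution eps F u rbar.
Variables (e : 'cV[R]_n) (lam : R).
Hypotheses (e1 : dotv e e = 1) (lam0 : 0 < lam).
Notation B1 := (@punctured_ball R n 1).
Notation K1 := (@punctured_cball R n 1).
Notation rx := (refl e lam).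
Notation v := (fun y => u (rx y)).
Notation f := (fun y => u y - u (rx y)).
Hypothesis Hnn : reflection_le u e lam.

Lemma locally_pos_gt0 x : locally_pos u e lam x -> x != 0 -> enorm (rx x) <= 1 -> 0 < f x.
Proof.
move=> [rho [c [rho0 c0 h]]] x0 x1; apply: lt_le_trans c0 (h x _ x0 x1).
by rewrite subrr enorm0.
Qed.

Lemma open_locally_pos : open [set x | locally_pos u e lam x].
Proof.
rewrite openE => z [rho [c [rho0 c0 h]]].
have : \forall y \near z, enorm (y - z) < rho / 2.
  by apply: near_enorm_lt; rewrite subrr enorm0 divr_gt0.
apply: filterS => y yz; exists (rho / 2), c; split => //; first by rewrite divr_gt0.
move=> x xy; apply: h; rewrite -(subrK y x) -addrA.
by apply: le_lt_trans (ler_enormD _ _) _; lra.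
Qed.

Lemma locally_pos_interior z : dotv z e < lam -> enorm (rx z) < 1 ->
  (forall x, dotv x e < dotv z e -> x != 0 -> enorm (rx x) < 1 -> 0 < f x) ->
  locally_pos u e lam z.
Proof.
move=> zl z1 left.
have Bz : B1 (rx z).
  rewrite /punctured_ball /= z1 andbT.
  by apply: le_lt_trans (enorm_lt_refl e1 lam0 zl); exact: enorm_ge0.
have [A [s' [ep0 [A1 s'0 s'A ep00 [h1 h2]]]]] := barrier_not_touching Hsol e1 lam0 Bz.
(* A radius below [|z|] keeps the origin out of the ball when [z != 0]; for [z = 0] no such
   restriction applies. *)
pose z' : R := if z == 0 then 1 else enorm z.
have z'0 : 0 < z' by rewrite /z'; case: eqVneq => // z0; rewrite enorm_gt0.
pose s := Num.min (Num.min s' (lam - dotv z e)) (Num.min 1 z') / 2.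
have mn0 : 0 < Num.min (Num.min s' (lam - dotv z e)) (Num.min 1 z').
  by rewrite !lt_min s'0 subr_gt0 zl ltr01 z'0.
have s0 : 0 < s by rewrite divr_gt0.
have : s < Num.min (Num.min s' (lam - dotv z e)) (Num.min 1 z') by rewrite /s; lra.
rewrite !lt_min => /andP[/andP[ss' sl] /andP[s1 sz']].
have sA : s * A <= 1.
  by apply: le_trans s'A; rewrite ler_wpM2r ?(ltW ss') //; lra.
have cap x : enorm (x - z) <= s -> dotv x e < lam /\ enorm (rx x) < 1.
  move=> xs; split; last by apply: h1; exact: le_lt_trans ss'.
  have := dotv_unit_le (x - z) e1; rewrite dotvBl ler_norml => /andP[_]; lra.
have Hnt ep V c x : 0 < ep < ep0 -> enorm V <= ep -> enorm (x - z) <= s ->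
    dotv x e < lam -> x != 0 -> 0 <= u x - v x <= 3 * ep ->
    ~ \forall y \near x, u x - v x - barrier e ep A z V c x <=
      u y - v y - barrier e ep A z V c y.
  by move=> epb Vep xs; apply: h2 => //; exact: le_lt_trans ss'.
have sph0 x : enorm (x - z) = s -> x != 0.
  have [->|z0] := eqVneq z 0; first by rewrite subr0 -enorm_gt0 => ->.
  apply: contra_eqN => /eqP ->; rewrite sub0r enormN eq_sym lt_eqF //.
  by move: sz'; rewrite /z' (negPf z0).
have [ep [c [epb c0 hsph]]] := sphere_gap Hsol e1 lam0 Hnn A1 s0 (ltW s1) sA ep00 cap sph0
  (fun x xs xl => left x xl (sph0 x xs) (proj2 (cap x (eq_le_of xs)))).
have [c' c'0 hc'] : exists2 c' : R, 0 < c' &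
    forall x, enorm (x - z) <= s -> x != 0 -> c' <= f x - barrier e ep A z 0 0 x.
  have [z0|z0] := eqVneq z 0.
    move: cap Hnt hsph; rewrite z0 => cap Hnt hsph.
    exact: (ball_gap_zero Hsol e1 lam0 Hnn A1 s0 (ltW s1) sA cap Hnt epb c0 hsph).
  apply: (ball_gap_nonzero Hsol e1 lam0 Hnn A1 s0 (ltW s1) sA cap Hnt epb c0 _ hsph).
  by move: sz'; rewrite /z' (negPf z0).
have /andP[epgt0 _] := epb.
exact: (locally_pos_of_gap e1 A1 s0 (ltW s1) epgt0 c'0 hc').
Qed.

(* A point of the cap where positivity fails, chosen farthest from the hyperplane,
   has only points of positivity behind it, so the barrier applies there. *)
Lemma locally_pos_cap z : dotv z e < lam -> enorm (rx z) <= 1 -> locally_pos u e lam z.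
Proof.
move=> zl z1; apply: contrapT => badz.
pose T := (~` [set x | locally_pos u e lam x]) `&` [set x | enorm (rx x) <= 1] `&`
  [set x | dotv x e <= dotv z e].
have [||||w [[/= wbad w1] wz] wmin] := @EVT_min_closed R n T (fun x => dotv x e) 1.
- apply: closedI; last exact/closed_le_fun/continuous_dotv_cst.
  apply: closedI; first exact/open_closedC/open_locally_pos.
  apply: closed_le_fun => x; apply: (@continuous_comp _ _ _ rx (@enorm R n)).
    exact: continuous_refl.
  exact: continuous_enorm.
- move=> x [[/= _ x1] xz]; apply: le_trans x1; apply/ltW/enorm_lt_refl => //.
  exact: le_lt_trans zl.
- by exists z; split; [split|rewrite /=].
- by move=> x _; exact: continuous_dotv_cst.
have wl := le_lt_trans wz zl.
apply: wbad; have [w1'|w1'] := eqVneq (enorm (rx w)) 1.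
  exact: (locally_pos_boundary Hsol e1 lam0).
apply: locally_pos_interior => //; first by rewrite lt_neqAle w1'.
move=> x xw x0 x1; apply: locally_pos_gt0 => //; last exact: ltW.
apply: contrapT => badx; have : dotv w e <= dotv x e.
  by apply: wmin; split; [split => //; exact: ltW|rewrite /=; exact: le_trans (ltW xw) wz].
by rewrite leNgt xw.
Qed.

Lemma cap_gt0 x : dotv x e < lam -> x != 0 -> enorm (rx x) <= 1 -> 0 < f x.
Proof. by move=> xl x0 x1; apply: locally_pos_gt0 => //; exact: locally_pos_cap. Qed.

(** The reflected value is frozen at [rx z], so the bound does not involve the reflection of [y] and
    survives a change of the plane. *)
Lemma cap_gap z : dotv z e < lam -> enorm (rx z) <= 1 ->
  exists rho c : R, [/\ 0 < rho, 0 < c &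
    forall y, enorm (y - z) < rho -> y != 0 -> u (rx z) + c <= u y].
Proof.
move=> zl z1; have [z1'|z1'] := eqVneq (enorm (rx z)) 1.
  have [|r [c [r0 c0 h]]] := u_lower_bound Hsol (z := z).
    by rewrite -z1'; exact: enorm_lt_refl.
  exists r, c; split => // y yr y0; rewrite (sol_bd Hsol) // add0r; exact: h.
have zlt : enorm (rx z) < 1 by rewrite lt_neqAle z1'.
have [r [c [r0 c0 h]]] := locally_pos_cap zl z1.
have Bz : B1 (rx z).
  rewrite /punctured_ball /= zlt andbT.
  by apply: le_lt_trans (enorm_lt_refl e1 lam0 zl); exact: enorm_ge0.
have c2 : 0 < c / 2 by rewrite divr_gt0.
have Kz : K1 (rx z) by rewrite /punctured_cball /=; case/andP: Bz => -> /ltW.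
have [r2 r20 h2] := u_within_eps Hsol Kz c2.
exists (Num.min (Num.min r r2) (Num.min (1 - enorm (rx z)) (enorm (rx z)))), (c / 2); split => //.
  by rewrite !lt_min r0 r20 subr_gt0 zlt; case/andP: Bz.
move=> y; rewrite !lt_min => /andP[/andP[yr yr2] /andP[y1 y1']] y0.
have yz : enorm (rx y - rx z) = enorm (y - z) by rewrite reflB enorm_reflv.
have ry1 : enorm (rx y) <= 1.
  by have := ler_enormB (rx y) (rx z); rewrite yz; lra.
have ry0 : 0 < enorm (rx y).
  by have := ler_enormB (rx z) (rx y); rewrite enormBC yz; lra.
have := h y yr y0 ry1.
have := h2 (rx y); rewrite yz /punctured_cball /= ry0 ry1 => /(_ isT yr2).
by rewrite ltr_norml => /andP[_]; lra.
Qed.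

End StrictInequality.

(** * The narrow strip estimate *)

Section Bounds.
Variable R : realType.

Lemma fin_bound (T : Type) (I : finType) (D : T -> Prop) (g : I -> T -> R) :
  (forall i, exists B, forall x, D x -> `|g i x| <= B) ->
  exists2 B, 0 <= B & forall i x, D x -> `|g i x| <= B.
Proof.
move=> H; have [B hB] := choice H.
exists (\sum_i `|B i|); first by apply: sumr_ge0.
move=> i x Dx; apply: le_trans (hB i x Dx) _; apply: le_trans (ler_norm _) _.
exact: (ler_sum_term i (fun i => normr_ge0 (B i))).
Qed.

Lemma compact_bound (T : topologicalType) (C : set T) (g : T -> R) :
  compact C -> {within C, continuous g} -> exists B, forall x, C x -> `|g x| <= B.
Proof.
move=> cC cg; have [M [_ hM]] := compact_bounded (continuous_compact cg cC).
exists (M + 1) => x Cx; apply: hM; first by rewrite ltrDl.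
by exists x.
Qed.

Lemma within_continuous_eps n (C : set 'cV[R]_n) (g : 'cV[R]_n -> R) :
  (forall x (t : R), C x -> 0 < t -> exists2 rho : R, 0 < rho &
    forall y, C y -> enorm (y - x) < rho -> `|g x - g y| < t) ->
  {within C, continuous g}.
Proof.
move=> h; rewrite continuous_subspace_in => x; rewrite inE => Cx.
apply/(@cvgrPdist_lt _ _ _ (nbhs (x : subspace C)) (nbhs_filter _)) => t t0.
have [rho rho0 hr] := h x t Cx t0.
rewrite /nbhs /= -(nbhs_subspace_in Cx).
have : \forall y \near x, enorm (y - x) < rho.
  by apply: near_enorm_lt; rewrite subrr enorm0.
by apply: filterS => y yx Cy; exact: hr.
Qed.

(** Divided by [2 m / d^2], the left side is at most [C d^2 + N C d - al], and [d <= 1] bounds this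
    by [d (C + N C) - al]. *)
Lemma narrow_arith (m d C al N D1 D2 D3 : R) : 0 < m -> 0 < d -> d <= 1 -> 0 <= C -> 0 <= N ->
  d * (C + N * C) < al -> D1 <= 2 * m * C -> D2 <= N * (2 * m / d * C) -> D3 <= - al ->
  D1 + D2 + 2 * m / d ^+ 2 * D3 < 0.
Proof.
move=> m0 d0 d1 C0 N0 hd h1 h2 h3.
have k0 : 0 < 2 * m / d ^+ 2 by rewrite divr_gt0 ?exprn_gt0 ?mulr_gt0.
have h3' : 2 * m / d ^+ 2 * D3 <= 2 * m / d ^+ 2 * - al by rewrite ler_pM2l.
have : 2 * m / d ^+ 2 * (C * d ^+ 2 + N * C * d - al) < 0.
  rewrite pmulr_rlt0 // subr_lt0; apply: le_lt_trans hd.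
  have : C * d ^+ 2 <= C * d by rewrite ler_wpM2l // expr2 ler_piMr // ltW.
  lra.
have -> : 2 * m / d ^+ 2 * (C * d ^+ 2 + N * C * d - al) =
    2 * m * C + N * (2 * m / d * C) + 2 * m / d ^+ 2 * - al.
  by field; exact: lt0r_neq0.
lra.
Qed.

End Bounds.

Section NarrowStrip.
Variables (R : realType) (n : nat) (eps : R) (F : R -> R -> 'cV[R]_n -> 'M[R]_n -> R)
  (u : 'cV[R]_n -> R) (rbar : R).
Hypothesis Hsol : singular_solution eps F u rbar.
Variables (e : 'cV[R]_n).
Hypotheses (e1 : dotv e e = 1).
Notation jet := (R * R * 'cV[R]_n * 'M[R]_n)%type.
Notation G := (symF_uncurried F).
Notation B1 := (@punctured_ball R n 1).
Notation K1 := (@punctured_cball R n 1).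

Lemma extends_cont_bounded (g : 'cV[R]_n -> R) rho : 0 < rho -> extends_cont B1 K1 g ->
  exists B, forall x, rho <= enorm x < 1 -> `|g x| <= B.
Proof.
move=> rho0 [h [ch hg]].
pose An := [set x : 'cV[R]_n | rho <= enorm x] `&` [set x | enorm x <= 1].
have cAn : compact An.
  apply: (@compact_sublevel _ _ _ 1) => [|x []//].
  by apply: closedI; [apply: closed_ge_fun|apply: closed_le_fun] => x; exact: continuous_enorm.
have AK : An `<=` K1.
  by move=> x [/= h1 h2]; rewrite /punctured_cball /= h2 (lt_le_trans rho0).
have [B hB] := compact_bound cAn (continuous_subspaceW AK ch).
exists B => x /andP[x1 x2]; rewrite -hg; last first.
  by rewrite /punctured_ball /= x2 (lt_le_trans rho0).
by apply: hB; split => //=; exact: ltW.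
Qed.

(** The bound is uniform in [lam]: derivatives of the reflected function are derivatives of [u]
    along reflected basis vectors, and these depend on [e] only. *)
Lemma jets_bounded rho : 0 < rho -> exists2 B : R, 0 <= B & forall lam x,
  rho <= enorm x < 1 -> rho <= enorm (refl e lam x) < 1 ->
  [/\ `|u x| <= B /\ `|u (refl e lam x)| <= B,
      `|grad u x| <= B /\ `|grad (fun y => u (refl e lam y)) x| <= B &
      `|hess u x| <= B /\ `|hess (fun y => u (refl e lam y)) x| <= B].
Proof.
move=> rho0; have [_ c0 c1 c2] := sol_C2 Hsol.
have [B0 h0] := extends_cont_bounded rho0 (ex_intro _ u (conj c0 (fun x _ => erefl))).
pose D (x : 'cV[R]_n) : Prop := rho <= enorm x < 1.
have [B1' b1 h1] := @fin_bound R _ 'I_n D (fun i => 'D_(delta_mx i 0) u)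
  (fun i => extends_cont_bounded rho0 (c1 _)).
have [B2 b2 h2] := @fin_bound R _ 'I_n D (fun i => 'D_(reflv e (delta_mx i 0)) u)
  (fun i => extends_cont_bounded rho0 (c1 _)).
have [B3 b3 h3] := @fin_bound R _ ('I_n * 'I_n)%type D
  (fun ij => 'D_(delta_mx ij.2 0) ('D_(delta_mx ij.1 0) u))
  (fun ij => extends_cont_bounded rho0 (c2 _ _)).
have [B4 b4 h4] := @fin_bound R _ ('I_n * 'I_n)%type D
  (fun ij => 'D_(reflv e (delta_mx ij.2 0)) ('D_(reflv e (delta_mx ij.1 0)) u))
  (fun ij => extends_cont_bounded rho0 (c2 _ _)).
have bb0 := normr_ge0 B0.
exists (`|B0| + B1' + B2 + B3 + B4); first by rewrite !addr_ge0.
move=> lam x xD rxD.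
have l0 : B0 <= `|B0| + B1' + B2 + B3 + B4 by have := ler_norm B0; lra.
have l1 : B1' <= `|B0| + B1' + B2 + B3 + B4 by lra.
have l2 : B2 <= `|B0| + B1' + B2 + B3 + B4 by lra.
have l3 : B3 <= `|B0| + B1' + B2 + B3 + B4 by lra.
have l4 : B4 <= `|B0| + B1' + B2 + B3 + B4 by lra.
have BB : 0 <= `|B0| + B1' + B2 + B3 + B4 by rewrite !addr_ge0.
split; split.
- exact: le_trans (h0 _ xD) l0.
- exact: le_trans (h0 _ rxD) l0.
- apply/mx_norm_leP => [|i j]; first exact: BB.
  by rewrite ord1 mxE; exact: le_trans (h1 i _ xD) l1.
- apply/mx_norm_leP => [|i j]; first exact: BB.
  by rewrite ord1 grad_refl_coord; exact: le_trans (h2 i _ rxD) l2.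
- apply/mx_norm_leP => [|i j]; first exact: BB.
  by rewrite mxE; exact: le_trans (h3 (i, j) _ xD) l3.
- apply/mx_norm_leP => [|i j]; first exact: BB.
  by rewrite hess_refl_coord; exact: le_trans (h4 (i, j) _ rxD) l4.
Qed.

(** Symmetric jets of bounded size with radius in [[l0, 1]] form a compact subset of the domain: 0
    is kept away by [l0], and 1 is an interior radius because [eps > 0]. *)
Lemma jets_uniformly_elliptic l0 B : 0 < l0 -> l0 <= 1 -> 0 <= B ->
  exists a C : R, [/\ 0 < a, 0 <= C & forall r s (p : 'cV[R]_n) (M : 'M[R]_n), l0 <= r <= 1 ->
    `|s| <= B -> `|p| <= B -> `|M| <= B -> M^T = M ->
    [/\ `|'D_((0, 1, 0, 0) : jet) G (r, s, p, M)| <= C,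
      forall i, `|'D_((0, 0, delta_mx i 0, 0) : jet) G (r, s, p, M)| <= C &
      'D_((0, 0, 0, e *m e^T) : jet) G (r, s, p, M) <= - a]].
Proof.
move=> l00 l01 B0.
pose Kc : set jet := `[l0, 1]%classic `*` `[- B, B]%classic `*`
  [set p : 'cV[R]_n | `|p| <= B] `*` ([set M : 'M[R]_n | `|M| <= B] `&` [set M | M^T = M]).
have cKc : compact Kc.
  apply: compact_setX; first apply: compact_setX; first apply: compact_setX.
  - exact: segment_compact.
  - exact: segment_compact.
  - exact: compact_mx_box.
  - apply: compact_closedI; first exact: compact_mx_box.
    have -> : [set M : 'M[R]_n | M^T = M] = \bigcap_(ij in [set: 'I_n * 'I_n])
        [set M : 'M[R]_n | M ij.2 ij.1 - M ij.1 ij.2 = 0].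
      apply/seteqP; split => [M /= Ms [i j] _ /=|M h /=].
        by have /matrixP/(_ j i) := Ms; rewrite mxE => ->; rewrite subrr.
      apply/matrixP => i j; rewrite mxE; apply/eqP; rewrite -subr_eq0.
      by apply/eqP; exact: (h (i, j)).
    apply: closed_bigI => -[i j] _ /=.
    apply: (@closed_comp _ _ (fun M : 'M[R]_n => M j i - M i j) [set 0]); last exact: closed_eq.
    by move=> M _; apply: continuousB; exact: coord_continuous.
have KD J : Kc J -> jet_dom eps J /\ J.2^T = J.2.
  move=> [[[/= h1 h2] h3] [_ h4]]; split => //.
  move: h1; rewrite in_itv /= => /andP[h1 h1'].
  by rewrite /jet_dom /= (lt_le_trans l00) //= (le_lt_trans h1') // ltrDl (sol_eps Hsol).
have cD d : {within Kc, continuous ('D_d G)}.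
  apply: continuous_in_subspaceT => J; rewrite inE => /KD[DJ _].
  exact: (symF_derive_continuous (sol_FC1 Hsol)).
have [C1 h1] := compact_bound cKc (cD (0, 1, 0, 0)).
have [C2 C20 h2] := @fin_bound R _ 'I_n Kc (fun i => 'D_((0, 0, delta_mx i 0, 0) : jet) G)
  (fun i => compact_bound cKc (cD _)).
have e0 : e != 0.
  by apply/eqP => e0; move: e1; rewrite e0 dotv0l => /esym/eqP; rewrite oner_eq0.
have Kc0 : Kc !=set0.
  exists (1, 0, 0, 0); rewrite /Kc /=; split => /=; first split => /=; first split => /=.
  - by rewrite in_itv /= l01 lexx.
  - by rewrite in_itv /= B0 andbT oppr_le0.
  - by rewrite normr0.
  - by rewrite normr0 trmx0.
have [J] := compact_EVT_max Kc0 cKc (cD (0, 0, 0, e *m e^T)).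
rewrite inE => KJ Jmax; have [DJ Js] := KD J KJ.
have a0 := symF_derive_outer_lt0 (sol_FC1 Hsol) (sol_Fell Hsol) DJ Js e0.
exists (- 'D_((0, 0, 0, e *m e^T) : jet) G J), (`|C1| + C2); split.
- by rewrite oppr_gt0.
- by rewrite addr_ge0.
move=> r s p M rD sB pB MB Ms.
have KJ' : Kc (r, s, p, M).
  by rewrite /Kc /=; split => //=; split => //=; split => //=; rewrite in_itv //= -ler_norml.
split.
- by apply: le_trans (h1 _ KJ') _; apply: le_trans (ler_norm _) _; rewrite lerDl.
- by move=> i; apply: le_trans (h2 i _ KJ') _; rewrite lerDr.
- by rewrite opprK; apply: Jmax; rewrite inE.
Qed.

End NarrowStrip.

Section NarrowStripPrinciple.
Variables (R : realType) (n : nat) (eps : R) (F : R -> R -> 'cV[R]_n -> 'M[R]_n -> R)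
  (u : 'cV[R]_n -> R) (rbar : R).
Hypothesis Hsol : singular_solution eps F u rbar.
Variables (e : 'cV[R]_n).
Hypotheses (e1 : dotv e e = 1).
Notation jet := (R * R * 'cV[R]_n * 'M[R]_n)%type.
Notation G := (symF_uncurried F).
Notation B1 := (@punctured_ball R n 1).
Notation K1 := (@punctured_cball R n 1).

Lemma ler_norm_segment (V : normedModType R) (a b : V) (t B : R) : 0 <= t <= 1 ->
  `|a| <= B -> `|b| <= B -> `|a + t *: (b - a)| <= 3 * B.
Proof.
move=> /andP[t0 t1] aB bB; apply: le_trans (ler_normD _ _) _.
have : `|t *: (b - a)| <= `|b - a| by exact: normr_scale_le.
have := ler_normB b a; lra.
Qed.

Lemma refl_id lam x : dotv x e = lam -> refl e lam x = x.
Proof. by move=> xl; rewrite reflE xl subrr mulr0 scale0r addr0. Qed.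

Section Strip.
Variables (lam d : R).
Hypotheses (d0 : 0 < d) (lamd : 0 < lam - d).
Notation rx := (refl e lam).
Notation f := (fun y => u y - u (rx y)).

Let lam0 : 0 < lam. Proof. by have := lamd; have := d0; lra. Qed.

(* A weight with values in [1, 2] whose second derivative -2 / d^2 along e dominates
   the lower order terms when the strip is narrow. *)
Let h (x : 'cV[R]_n) := 2 - ((lam - dotv x e) / d) ^+ 2.

Let C := [set x : 'cV[R]_n | lam - d <= dotv x e] `&` [set x | dotv x e <= lam] `&`
  [set x | enorm (rx x) <= 1].

Lemma strip_bounds x : C x -> [/\ lam - d <= enorm x, enorm x <= enorm (rx x) & enorm (rx x) <= 1].
Proof.
move=> [[/= h1 h2] h3]; split => //; last exact: enorm_le_refl.
apply: le_trans h1 _; apply: le_trans (ler_norm _) _; exact: dotv_unit_le.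
Qed.

Lemma strip_K1 x : C x -> K1 x /\ K1 (rx x).
Proof.
move=> /strip_bounds[h1 h2 h3].
have x0 : 0 < enorm x by apply: lt_le_trans h1.
by rewrite /punctured_cball /= x0 (lt_le_trans x0 h2) (le_trans h2 h3).
Qed.

Lemma strip_f_continuous : {within C, continuous f}.
Proof.
apply: within_continuous_eps => x t /strip_K1[Kx Krx] t0.
have t2 : 0 < t / 2 by rewrite divr_gt0.
have [r1 r10 h1] := u_within_eps Hsol Kx t2.
have [r2 r20 h2] := u_within_eps Hsol Krx t2.
exists (Num.min r1 r2); first by rewrite lt_min r10.
move=> y /strip_K1[Ky Kry]; rewrite lt_min => /andP[y1 y2].
have := h1 y Ky y1; have := h2 _ Kry; rewrite reflB (enorm_reflv e1) => /(_ y2).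
rewrite !ltr_norml => /andP[? ?] /andP[? ?]; apply/andP; split; lra.
Qed.

Lemma strip_weight x : C x -> 1 <= h x <= 2.
Proof.
move=> [[/= h1 h2] _].
have t0 : 0 <= (lam - dotv x e) / d by rewrite divr_ge0 ?(ltW d0) // subr_ge0.
have t1 : (lam - dotv x e) / d <= 1 by rewrite ler_pdivrMr //; lra.
rewrite /h expr2; move: ((lam - dotv x e) / d) t0 t1 => t t0 t1.
by apply/andP; split; nra.
Qed.

Lemma strip_weight_continuous x : {for x, continuous h}.
Proof.
have cr (k : R) : {for x, continuous (fun _ : 'cV[R]_n => k)} by exact: cst_continuous.
have c1 := continuousM (continuousB (cr lam) (@continuous_dotv_cst _ _ e x)) (cr d^-1).
exact: (continuousB (cr 2) (continuousM c1 c1)).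
Qed.

Lemma strip_closed : closed C.
Proof.
apply: closedI; first apply: closedI.
- exact/closed_ge_fun/continuous_dotv_cst.
- exact/closed_le_fun/continuous_dotv_cst.
- apply: closed_le_fun => x; apply: (@continuous_comp _ _ _ rx (@enorm R n)).
    exact: continuous_refl.
  exact: continuous_enorm.
Qed.

Hypothesis outside : forall x, dotv x e <= lam - d -> x != 0 -> enorm (rx x) <= 1 -> 0 <= f x.

(** The minimum [- m] of [f / h] over the closed strip is negative, hence not on its boundary: [f]
    vanishes on the hyperplane, is nonnegative on the far side by assumption, and is positive where
    the reflected point reaches the unit sphere. *)
Lemma strip_touching xb : dotv xb e < lam -> xb != 0 -> enorm (rx xb) <= 1 -> f xb < 0 ->
  exists m x, [/\ 0 < m, C x, dotv x e < lam, enorm (rx x) < 1 &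
    f x = - m * h x /\ \forall y \near x, f x + m * h x <= f y + m * h y].
Proof.
move=> xl x0 x1 fx.
have Cxb : C xb.
  split => //; split => /=; last exact: ltW.
  by rewrite leNgt; apply/negP => hx; have := outside (ltW hx) x0 x1; rewrite leNgt fx.
have cC : compact C.
  by apply: (compact_sublevel strip_closed (C := 1)) => x /strip_bounds[_ h1]; exact: le_trans.
have cg : {within C, continuous (fun x => f x / h x)}.
  have ch : {within C, continuous (fun x => (h x)^-1)}.
    apply: continuous_in_subspaceT => x; rewrite inE => /strip_weight/andP[h1 _].
    apply: continuousV; last exact: strip_weight_continuous.
    by apply: lt0r_neq0; apply: lt_le_trans h1.
  move=> x; have cf := @strip_f_continuous x; have chx := ch x.
  exact: (@continuousM R (subspace C) (fun y : 'cV[R]_n => f y) (fun y => (h y)^-1) x cf chx).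
have [x] := compact_EVT_min (ex_intro _ xb Cxb) cC cg.
rewrite inE => Cx xmin.
have hpos y : C y -> 0 < h y by move=> /strip_weight/andP[h1 _]; apply: lt_le_trans h1.
pose m := - (f x / h x).
have m0 : 0 < m.
  rewrite oppr_gt0; apply: le_lt_trans (xmin xb _) _; first by rewrite inE.
  by rewrite pmulr_llt0 // invr_gt0 hpos.
have fE : f x = - m * h x by rewrite /m opprK divfK // lt0r_neq0 // hpos.
have fx0 : f x < 0 by rewrite fE mulNr oppr_lt0 mulr_gt0 // hpos.
have [[/= xa xb'] xc] := Cx.
have nx0 : x != 0.
  rewrite -enorm_gt0; have [h1 _ _] := strip_bounds Cx; exact: lt_le_trans h1.
have xlt : dotv x e < lam.
  rewrite lt_neqAle xb' andbT; apply/eqP => xE.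
  by move: fx0; rewrite refl_id // subrr ltxx.
have xgt : lam - d < dotv x e.
  rewrite ltNge; apply/negP => xE.
  by have := outside xE nx0 xc; rewrite leNgt fx0.
have xr : enorm (rx x) < 1.
  rewrite lt_neqAle xc andbT; apply/eqP => xE.
  move: fx0; rewrite (sol_bd Hsol xE) subr0 ltNge; apply/negP/negPn/ltW.
  apply: (sol_pos Hsol); rewrite /punctured_ball /= enorm_gt0 nx0 -xE.
  exact: enorm_lt_refl.
exists m, x; split => //; split => //.
have n1 : \forall y \near x, lam - d < dotv y e.
  exact: (@cvgr_gt _ _ (nbhs x) _ _ _ (@continuous_dotv_cst _ _ e x) _ xgt).
have n2 : \forall y \near x, dotv y e < lam.
  exact: (@cvgr_lt _ _ (nbhs x) _ _ _ (@continuous_dotv_cst _ _ e x) _ xlt).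
have n3 : \forall y \near x, enorm (rx y) < 1.
  have cr : {for x, continuous (fun y => enorm (rx y))}.
    apply: (@continuous_comp _ _ _ rx (@enorm R n)); [exact: continuous_refl|exact: continuous_enorm].
  exact: (@cvgr_lt _ _ (nbhs x) _ _ _ cr _ xr).
apply: filterS (filterI n1 (filterI n2 n3)) => y [y1 [y2 y3]].
have Cy : C y by split; [split => /=; exact: ltW|exact: ltW].
rewrite fE mulNr addNr.
have : - m <= f y / h y by rewrite opprK; apply: xmin; rewrite inE.
by rewrite ler_pdivlMr ?hpos // mulNr lerNl -subr_ge0 opprK addrC.
Qed.

End Strip.

Lemma strip_quadratic lam d m x : d != 0 ->
  quadratic (- 2 * m) 0 (lam *: e) ((2 * m / d ^+ 2) *: (e *m e^T)) x =
  - (m * (2 - ((lam - dotv x e) / d) ^+ 2)).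
Proof.
move=> d0; rewrite /quadratic dotv0l addr0 -scalemxAl mulmx_dotv.
rewrite !dotvE (dotvC e x) e1; field; exact: d0.
Qed.

(** The width depends on [l0] and not on the plane: [lam - d >= l0 / 2] keeps the strip away from
    the origin and [2 lam - x.e >= l0] does the same for the reflected points, so one choice of
    constants serves all planes. *)
Lemma narrow_strip l0 : 0 < l0 -> l0 < 1 -> exists d : R, [/\ 0 < d, d <= l0 / 2 &
  forall lam, l0 <= lam ->
    (forall x, dotv x e <= lam - d -> x != 0 -> enorm (refl e lam x) <= 1 ->
      0 <= u x - u (refl e lam x)) ->
    reflection_le u e lam].
Proof.
move=> l00 l01.
have l02 : 0 < l0 / 2 by rewrite divr_gt0.
have [B B0 hB] := jets_bounded Hsol e l02.
have B30 : 0 <= 3 * B by rewrite mulr_ge0.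
have [al [C [al0 C0 hC]]] := jets_uniformly_elliptic Hsol e1 l00 (ltW l01) B30.
pose N : R := n%:R; have N0 : 0 <= N by exact: ler0n.
have CN0 : 0 <= C + N * C by rewrite addr_ge0 // mulr_ge0.
pose d := Num.min (Num.min 1 (l0 / 2)) (al / (C + N * C + 1)).
have d0 : 0 < d by rewrite !lt_min ltr01 l02 divr_gt0 // ltr_wpDl.
have d1 : d <= 1 by rewrite !ge_min lexx.
have dl : d <= l0 / 2 by rewrite !ge_min lexx orbT.
have dal : d * (C + N * C) < al.
  apply: lt_le_trans (_ : d * (C + N * C + 1) <= _).
    by rewrite ltr_pM2l // ltrDl.
  by rewrite -ler_pdivlMr ?ltr_wpDl // /d ge_min lexx orbT.
exists d; split => // lam lamge outside xb xl x0 x1.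
rewrite leNgt; apply/negP => fx.
have lamd : 0 < lam - d by lra.
have lam0 : 0 < lam by lra.
have [m [x [m0 Cx xlt xr [fE fmin]]]] := strip_touching d0 lamd outside xl x0 x1 fx.
have [b1 b2 b3] := strip_bounds d0 lamd Cx.
have hb := strip_weight d0 Cx.
have [[/= xa xb'] _] := Cx.
have hd : - d <= dotv x e - lam <= d by apply/andP; split; lra.
have hl : l0 <= 2 * lam - dotv x e by lra.
have nx0 : x != 0 by rewrite -enorm_gt0; apply: lt_le_trans b1.
have dn0 : d != 0 by exact: lt0r_neq0.
pose k := 2 * m / d ^+ 2; pose Q : 'M[R]_n := k *: (e *m e^T).
have Qs : Q^T = Q by apply: symmxZ; rewrite trmx_mul trmxK.
have fmin' : \forall y \near x,
    u x - u (refl e lam x) - quadratic (- 2 * m) 0 (lam *: e) Q x <=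
    u y - u (refl e lam y) - quadratic (- 2 * m) 0 (lam *: e) Q y.
  by apply: filterS fmin => y; rewrite !strip_quadratic // !opprK.
have [t t01] := touching_segment Hsol e1 lam0 xlt nx0 xr Qs fmin'.
apply/negP; rewrite -ltNge.
have [Bx Brx] := cap_punctured_ball e1 lam0 xlt nx0 xr.
have hx : l0 / 2 <= enorm x < 1.
  by case/andP: Bx => _ ->; rewrite andbT; apply: le_trans b1; lra.
have hrx : l0 / 2 <= enorm (refl e lam x) < 1.
  by rewrite xr andbT; apply: le_trans b2; case/andP: hx.
have [[u1 u2] [g1 g2] [q1 q2]] := hB lam x hx hrx.
have sx := hess_sym (@open_B1 R n) (sol_C2_on Hsol) Bx.
have srx := hess_refl_sym e1 (@open_B1 R n) (sol_C2_on Hsol) Brx.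
have rD : l0 <= enorm (refl e lam x) <= 1.
  rewrite b3 andbT; apply: le_trans hl _; rewrite -(dotv_refl_e e1).
  by apply: le_trans (ler_norm _) _; exact: dotv_unit_le.
have DJ : jet_dom eps (enorm (refl e lam x), u (refl e lam x) + t * (u x - u (refl e lam x)),
    grad (fun y => u (refl e lam y)) x + t *: (grad u x - grad (fun y => u (refl e lam y)) x),
    hess (fun y => u (refl e lam y)) x + t *: (hess u x - hess (fun y => u (refl e lam y)) x)).
  by rewrite /jet_dom /=; exact: (enorm_refl_dom Hsol e1 lam0 xlt nx0 xr).
have [h1 h2 h3] := hC _ _ _ _ rD (ler_norm_segment t01 u2 u1) (ler_norm_segment t01 g2 g1)
  (ler_norm_segment t01 q2 q1) (symmxD srx (symmxZ t (symmxB sx srx))).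
move: h1 h2 h3; set J := (_, _, _, _) => h1 h2 h3.
rewrite (@symF_deriveE _ _ _ _ (sol_FC1 Hsol) J _ _ _ DJ) mxdotZ.
have -> : mxdot (\matrix_(i, j) 'D_((0, 0, 0, delta_mx i j) : jet) G J) (e *m e^T) =
    'D_((0, 0, 0, e *m e^T) : jet) G J.
  by rewrite (@symF_deriveE _ _ _ _ (sol_FC1 Hsol) J 0 0 _ DJ) mul0r dotv0l !add0r.
have kb : `|u x - u (refl e lam x)| <= 2 * m.
  rewrite fE mulNr normrN normrM gtr0_norm // mulrC ler_pM2r //.
  by case/andP: hb => hb1 hb2; rewrite ger0_norm //; apply: le_trans hb1.
have qb i : `|(0 + Q *m (x - lam *: e)) i 0| <= 2 * m / d.
  rewrite add0r -scalemxAl mulmx_dotv scalerA mxE normrM.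
  have k0 : 0 <= k by rewrite divr_ge0 ?exprn_ge0 ?mulr_ge0 ?(ltW d0) ?(ltW m0).
  have -> : 2 * m / d = k * d by rewrite /k; field.
  apply: le_trans (_ : `|k * dotv e (x - lam *: e)| <= _).
    by rewrite ler_piMr // unit_coord_le1.
  rewrite normrM (ger0_norm k0) ler_wpM2l // !dotvE e1 (dotvC e) mulr1 ler_norml.
  exact: hd.
have h2' i : `|(\col_i 'D_((0, 0, delta_mx i 0, 0) : jet) G J) i 0| <= C.
  by rewrite mxE; exact: h2.
have D1 := mul_le_norm kb h1; have D2 := dotv_le_coord qb h2'.
have H := narrow_arith m0 d0 d1 C0 N0 dal D1 D2 h3.
exact: H.
Qed.

End NarrowStripPrinciple.

(** * Continuation in the position of the plane and radial symmetry *)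

Section MovingPlanes.
Variables (R : realType) (n : nat) (eps : R) (F : R -> R -> 'cV[R]_n -> 'M[R]_n -> R)
  (u : 'cV[R]_n -> R) (rbar : R).
Hypothesis Hsol : singular_solution eps F u rbar.
Notation B1 := (@punctured_ball R n 1).
Notation K1 := (@punctured_cball R n 1).

Lemma u_le_limit x y : K1 x ->
  (forall rho : R, 0 < rho -> exists x', [/\ K1 x', enorm (x' - x) < rho & u y <= u x']) ->
  u y <= u x.
Proof.
move=> Kx h; rewrite leNgt; apply/negP => xy.
have t0 : 0 < u y - u x by rewrite subr_gt0.
have [rho rho0 hr] := u_within_eps Hsol Kx t0.
have [x' [Kx' x'x yx']] := h rho rho0.
by have := hr x' Kx' x'x; rewrite ltr_norml => /andP[h1 _]; lra.
Qed.

Section Continuation.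
Variable e : 'cV[R]_n.
Hypothesis e1 : dotv e e = 1.

(** Vacuous, as [|x'| >= 2 lam - x.e > lam >= 1]: the planes start here. *)
Lemma reflection_le_ge1 lam : 1 <= lam -> reflection_le u e lam.
Proof.
move=> lam1 x xl x0 x1.
have := dotv_unit_le (refl e lam x) e1; rewrite dotv_refl_e // => /(le_trans (ler_norm _)) h.
lra.
Qed.

Lemma refl_shift lam mu x : refl e lam x = refl e mu x + (2 * (lam - mu)) *: e.
Proof. by rewrite /refl -[RHS]addrA -scalerDl; congr (_ + _ *: _); ring. Qed.

Lemma enorm_shift lam mu x z :
  enorm (refl e lam x - refl e mu z) <= enorm (x - z) + 2 * `|lam - mu|.
Proof.
rewrite (refl_shift lam mu) addrAC reflB.
apply: le_trans (ler_enormD _ _) _; rewrite (enorm_reflv e1) enormZ (enorm_unit e1) mulr1.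
by rewrite normrM ger0_norm.
Qed.

(** The reflected point [y] is kept and [x] is moved: the plane at [lam + t] sends [y] to
    [x + (2 * t) *: e]. Keeping [x] instead could push [y] out of the unit ball. *)
Lemma reflection_le_limit lam : 0 < lam ->
  (forall mu, lam < mu -> reflection_le u e mu) -> reflection_le u e lam.
Proof.
move=> lam0 h x xl x0 x1; rewrite subr_ge0; set y := refl e lam x.
have xnorm := enorm_lt_refl e1 lam0 xl.
have xpos : 0 < enorm x by rewrite enorm_gt0.
apply: u_le_limit => [|rho rho0].
  by rewrite /punctured_cball /= xpos ltW // (lt_le_trans xnorm).
pose t := Num.min (Num.min rho (enorm x)) (lam - dotv x e) / 4.
have mn0 : 0 < Num.min (Num.min rho (enorm x)) (lam - dotv x e).
  by rewrite !lt_min rho0 xpos subr_gt0.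
have t0 : 0 < t by rewrite divr_gt0.
have : 2 * t < Num.min (Num.min rho (enorm x)) (lam - dotv x e) by rewrite /t; lra.
rewrite !lt_min => /andP[/andP[t1 t2] t3].
have E : refl e (lam + t) y = x + (2 * t) *: e.
  by rewrite (refl_shift _ lam) /y reflK // addrAC subrr add0r.
have ye : dotv y e = 2 * lam - dotv x e by rewrite dotv_refl_e.
have xE : dotv (refl e (lam + t) y) e < lam + t by rewrite dotv_refl_e // ye; lra.
have d : enorm (refl e (lam + t) y - x) = 2 * t.
  by rewrite E addrAC subrr add0r enormZ (enorm_unit e1) mulr1 ger0_norm //; lra.
have np : 0 < enorm (refl e (lam + t) y).
  have := ler_enormB x (x - refl e (lam + t) y); rewrite subKr enormBC d; lra.
have lt0 : 0 < lam + t by lra.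
have n1 : enorm (refl e (lam + t) y) <= 1.
  by have := enorm_lt_refl e1 lt0 xE; rewrite reflK // => /ltW /le_trans; apply.
exists (refl e (lam + t) y); split.
- by rewrite /punctured_cball /= np.
- by rewrite d.
- have ll : lam < lam + t by rewrite ltrDl.
  have := h _ ll _ xE; rewrite reflK // subr_ge0; apply => //.
  by rewrite -enorm_gt0.
Qed.

(** If the reflection of [z] is outside the closed ball, so are nearby ones and there is nothing to
    prove. Otherwise the gap [c] absorbs the variation of [u] near the reflected point. *)
Lemma reflection_le_local lam z : 0 < lam -> reflection_le u e lam -> dotv z e < lam ->
  exists2 rho : R, 0 < rho & forall x mu, enorm (x - z) < rho -> `|mu - lam| < rho ->
    x != 0 -> enorm (refl e mu x) <= 1 -> 0 <= u x - u (refl e mu x).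
Proof.
move=> lam0 Hlam zl; set p := refl e lam z.
have [p1|p1] := leP (enorm p) 1; last first.
  exists ((enorm p - 1) / 4); first by rewrite divr_gt0 // subr_gt0.
  move=> x mu xz mul _ x1.
  have := enorm_shift mu lam x z; have := ler_enormB p (p - refl e mu x).
  rewrite subKr (enormBC p) -/p; lra.
have [r1 [c [r10 c0 h1]]] := cap_gap Hsol e1 lam0 Hlam zl p1.
have p0 : 0 < enorm p by apply: le_lt_trans (enorm_lt_refl e1 lam0 zl); exact: enorm_ge0.
have Kp : K1 p by rewrite /punctured_cball /= p0.
have [r2 r20 h2] := u_within_eps Hsol Kp c0.
pose rho := Num.min (Num.min r1 r2) (enorm p) / 4.
have mn0 : 0 < Num.min (Num.min r1 r2) (enorm p) by rewrite !lt_min r10 r20.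
have rho0 : 0 < rho by rewrite divr_gt0.
have : 3 * rho < Num.min (Num.min r1 r2) (enorm p) by rewrite /rho; lra.
rewrite !lt_min => /andP[/andP[t1 t2] t3].
exists rho => // x mu xz mul x0 x1.
have d : enorm (refl e mu x - p) < 3 * rho by have := enorm_shift mu lam x z; rewrite -/p; lra.
have q0 : 0 < enorm (refl e mu x).
  by have := ler_enormB p (p - refl e mu x); rewrite subKr (enormBC p); lra.
have Kq : K1 (refl e mu x) by rewrite /punctured_cball /= q0.
have xr1 : enorm (x - z) < r1 by lra.
have := h1 x xr1 x0; have := h2 _ Kq (lt_trans d t2).
rewrite ltr_norml => /andP[a1 _] a2; rewrite -/p in a2; lra.
Qed.

(** The local radii become one by compactness. The compact set may contain the origin, where the
    local statement holds as well. *)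
Lemma reflection_le_compact lam d : 0 < lam -> reflection_le u e lam -> 0 < d ->
  exists2 rho : R, 0 < rho & forall mu x, `|mu - lam| < rho ->
    dotv x e <= lam - d -> enorm x <= 1 -> x != 0 -> enorm (refl e mu x) <= 1 ->
    0 <= u x - u (refl e mu x).
Proof.
move=> lam0 Hlam d0.
pose C := [set x : 'cV[R]_n | dotv x e <= lam - d] `&` [set x | enorm x <= 1].
have cC : compact C.
  apply: (@compact_sublevel _ _ _ 1) => [|x []//].
  apply: closedI; first exact/closed_le_fun/continuous_dotv_cst.
  by apply: closed_le_fun => x; exact: continuous_enorm.
move/compact_near_coveringP : cC => /(_ R (nbhs lam)
  (fun mu x => x != 0 -> enorm (refl e mu x) <= 1 -> 0 <= u x - u (refl e mu x)) _).
have loc : forall x, C x -> \forall x' \near x & mu \near nbhs lam,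
    x' != 0 -> enorm (refl e mu x') <= 1 -> 0 <= u x' - u (refl e mu x').
  move=> z [/= zl _]; have zl' : dotv z e < lam by lra.
  have [rho rho0 h] := reflection_le_local lam0 Hlam zl'.
  have zz : enorm (z - z) < rho by rewrite subrr enorm0.
  exists ([set x | enorm (x - z) < rho], [set mu | `|mu - lam| < rho]); first split => /=.
  - exact: near_enorm_lt.
  - have := nbhsx_ballx lam rho rho0; apply: filterS => mu.
    by rewrite -ball_normE /= distrC.
  - by move=> [x mu] [/= h1 h2]; exact: h.
move=> /(_ loc) /nbhs_ballP[rho /= rho0 h].
exists rho => // mu x mul xl x1; apply: h; last by split.
by rewrite -ball_normE /= distrC.
Qed.

Lemma reflection_le_all lam : 0 < lam -> reflection_le u e lam.
Proof.
move=> lam0; have [lam1|lam1] := leP 1 lam; first exact: reflection_le_ge1.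
apply: contrapT => bad.
pose S := [set l : R | lam <= l /\ forall mu, l <= mu -> reflection_le u e mu].
have S1 : S 1 by split; [exact: ltW|exact: reflection_le_ge1].
have Sinf : has_inf S by split; [exists 1|exists lam => l []].
pose l0 := inf S.
have l0lam : lam <= l0 by apply: lb_le_inf; [exists 1|move=> l []].
have l0pos : 0 < l0 by exact: lt_le_trans l0lam.
have above mu : l0 < mu -> reflection_le u e mu.
  move=> lm; have t0 : 0 < mu - l0 by rewrite subr_gt0.
  have [l [_ hl] ll] := inf_adherent t0 Sinf.
  by apply: hl; apply: ltW; move: ll; rewrite -/l0 addrC subrK.
have at0 := reflection_le_limit l0pos above.
have lamlt : lam < l0.
  by rewrite lt_neqAle l0lam andbT; apply/eqP => E; apply: bad; rewrite E.
(* The width belongs to the target [lam], so it is valid for every plane between [lam] and the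
   infimum [l0]. *)
have [d [d0 dl hd]] := narrow_strip Hsol e1 lam0 lam1.
have d20 : 0 < d / 2 by rewrite divr_gt0.
have [rho rho0 hrho] := reflection_le_compact l0pos at0 d20.
pose t := Num.min (Num.min rho (d / 2)) (l0 - lam) / 2.
have mn0 : 0 < Num.min (Num.min rho (d / 2)) (l0 - lam) by rewrite !lt_min rho0 d20 subr_gt0.
have t0 : 0 < t by rewrite divr_gt0.
have : t < Num.min (Num.min rho (d / 2)) (l0 - lam) by rewrite /t; lra.
rewrite !lt_min => /andP[/andP[t1 t2] t3].
have St : S (l0 - t).
  split; first by lra.
  move=> mu mut; have [/above//|mul0] := ltP l0 mu.
  have mulam : lam <= mu by lra.
  have mu0 : 0 < mu by lra.
  apply: hd => // x xl x0 x1; apply: hrho => //; [|lra|].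
    by rewrite ltr_norml; apply/andP; split; lra.
  have xmu : dotv x e < mu by lra.
  exact: le_trans (ltW (enorm_lt_refl e1 mu0 xmu)) x1.
have : l0 <= l0 - t by apply: ge_inf => //; case: Sinf.
lra.
Qed.

End Continuation.

(** [x] and [y] are mirror images in the hyperplane through the origin with normal [y - x]. Moving
    [x] by [(2 * t) *: e] makes them mirror images in the plane at distance [t > 0], and [t] tends
    to 0. *)
Lemma u_radial_le x y : enorm x = enorm y -> 0 < enorm x <= 1 -> u y <= u x.
Proof.
move=> xy /andP[x0 x1]; have [->//|yx] := eqVneq y x.
have yx0 : 0 < enorm (y - x) by rewrite enorm_gt0 subr_eq0.
have [e [e1 yE]] : exists e, dotv e e = 1 /\ y = x + enorm (y - x) *: e.
  exists ((enorm (y - x))^-1 *: (y - x)); split.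
    by rewrite dotvZl dotvZr -enorm_sqr expr2; field; exact: lt0r_neq0.
  by rewrite scalerA divff ?lt0r_neq0 // scale1r addrC subrK.
have xe : dotv x e = - (enorm (y - x) / 2).
  have yy : dotv y y = dotv x x by rewrite -!enorm_sqr xy.
  have : dotv y y = dotv x x + enorm (y - x) * (2 * dotv x e + enorm (y - x)).
    move: (enorm (y - x)) yE => w ->; rewrite !dotvE e1 (dotvC e x); ring.
  rewrite yy -[X in X = _]addr0 => /addrI/esym/eqP.
  by rewrite mulf_eq0 (gt_eqF yx0) /= => /eqP; lra.
move: (enorm (y - x)) yx0 yE xe => w w0 yE xe.
apply: u_le_limit => [|rho rho0]; first by rewrite /punctured_cball /= x0 x1.
pose t := Num.min (Num.min rho (enorm x)) w / 4.
have mn0 : 0 < Num.min (Num.min rho (enorm x)) w by rewrite !lt_min rho0 x0 w0.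
have t0 : 0 < t by rewrite divr_gt0.
have : 2 * t < Num.min (Num.min rho (enorm x)) w by rewrite /t; lra.
rewrite !lt_min => /andP[/andP[t1 t2] t3].
pose x' := x + (2 * t) *: e.
have x'e : dotv x' e < t by rewrite /x' !dotvE e1 xe; lra.
have rx' : refl e t x' = y.
  rewrite reflE /x' !dotvE e1 xe yE -addrA -scalerDl; congr (_ + _ *: _); by field.
have d : enorm (x' - x) = 2 * t.
  by rewrite /x' addrAC subrr add0r enormZ (enorm_unit e1) mulr1 ger0_norm //; lra.
have np : 0 < enorm x'.
  by have := ler_enormB x (x - x'); rewrite subKr enormBC d; lra.
have n1 : enorm x' <= 1.
  by have := enorm_lt_refl e1 t0 x'e; rewrite rx' -xy => /ltW /le_trans; apply.
exists x'; split; first by rewrite /punctured_cball /= np.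
  by rewrite d.
have := reflection_le_all e1 t0 x'e; rewrite rx' subr_ge0 -xy; apply => //.
by rewrite -enorm_gt0.
Qed.

Lemma u_radial x y : enorm x = enorm y -> 0 < enorm x <= 1 -> u x = u y.
Proof.
move=> xy x1; apply/le_anti; rewrite (u_radial_le xy x1) andbT.
by apply: u_radial_le; [rewrite xy|rewrite -xy].
Qed.

(** * The Hopf lemma on the hyperplane *)

Section Hopf.
Variables (e : 'cV[R]_n) (lam : R).
Hypotheses (e1 : dotv e e = 1) (lam0 : 0 < lam) (lam1 : lam < 1).
Notation rx := (refl e lam).
Notation f := (fun y => u y - u (rx y)).
Let z := lam *: e.

(** The barrier is centred on the hyperplane and compared with [f] on the half ball behind it. On
    the flat face [f = 0] while the barrier is [- ep |x - z|^2]; the spherical part is handled by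
    the sphere estimate. At [z - t *: e] the barrier equals [ep (t + (A - 1) t^2)], which is at
    least [ep t]. *)
Lemma hopf_lower_bound : exists s ep : R, [/\ 0 < s, 0 < ep &
  forall t, 0 <= t <= s -> ep * t <= u (z - t *: e) - u (z + t *: e)].
Proof.
have Hnn := reflection_le_all e1 lam0.
have ze : dotv z e = lam by rewrite dotvE e1 mulr1.
have zn : enorm z = lam by rewrite enormZ (enorm_unit e1) mulr1 gtr0_norm.
have Bz : B1 (rx z) by rewrite refl_id // /punctured_ball /= zn lam0 lam1.
have [A [s' [ep0 [A1 s'0 s'A ep00 [h1 h2]]]]] := barrier_not_touching Hsol e1 lam0 Bz.
have A0 : 0 <= A by lra.
pose s := Num.min (Num.min s' lam) 1 / 2.
have mn0 : 0 < Num.min (Num.min s' lam) 1 by rewrite !lt_min s'0 lam0 ltr01.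
have s0 : 0 < s by rewrite divr_gt0.
have : s < Num.min (Num.min s' lam) 1 by rewrite /s; lra.
rewrite !lt_min => /andP[/andP[ss' sl] /ltW s1].
have sA : s * A <= 1 by apply: le_trans s'A; rewrite ler_wpM2r // ltW.
have s24 : 0 < s ^+ 2 / 4 by rewrite divr_gt0 // exprn_gt0.
have bx x : enorm (x - z) <= s -> x != 0 /\ enorm (rx x) < 1.
  move=> xs; split; last by apply: h1; exact: le_lt_trans ss'.
  rewrite -enorm_gt0; have := ler_enormB z (z - x); rewrite subKr zn enormBC; lra.
have BB x : enorm (x - z) <= s -> dotv x e <= lam -> B1 x /\ B1 (rx x).
  move=> xs xl; have [x0 x1] := bx x xs; rewrite -enorm_gt0 in x0.
  have h := enorm_le_refl e1 lam0 xl.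
  by rewrite /punctured_ball /= x0 x1 (le_lt_trans h x1) (lt_le_trans x0 h).
have fc x : enorm (x - z) <= s -> dotv x e <= lam -> {for x, continuous f}.
  move=> xs xl; have [B Br] := BB x xs xl.
  exact: (continuousB (u_continuous Hsol B) (v_continuous Hsol Br)).
have bnd x : enorm (x - z) <= s -> enorm x <= s + enorm z.
  move=> xs; rewrite -[X in enorm X](subrK z).
  by apply: le_trans (ler_enormD _ _) _; rewrite lerD2r.
pose C := [set x | enorm (x - z) <= s] `&` [set x | s <= enorm (x - z)] `&`
  [set x | dotv x e <= lam - s ^+ 2 / 4].
have [c [c0 hc]] : exists c : R, 0 < c /\ forall x, C x -> c <= f x.
  have [C0|/set0P[x0 Cx0]] := eqVneq C set0.
    by exists 1; split => // x; rewrite C0.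
  have [|||x Cx xmin] := @EVT_min_closed R n C f (s + enorm z) _ _ (ex_intro _ x0 Cx0).
  - apply: closedI; last exact/closed_le_fun/continuous_dotv_cst.
    by apply: closedI; [exact/closed_le_fun/continuous_enormB|exact/closed_ge_fun/continuous_enormB].
  - by move=> x [[/= xs _] _]; exact: bnd.
  - by move=> x [[/= xs _] xl]; apply: fc => //; lra.
  have [[/= xs _] xl] := Cx; have [nx0 x1] := bx x xs.
  exists (f x); split => //; apply: (cap_gt0 Hsol e1 lam0 Hnn) => //; last exact: ltW.
  lra.
pose ep := Num.min (ep0 / 2) (c / 4).
have epgt0 : 0 < ep by rewrite lt_min !divr_gt0.
have epc : ep <= c / 4 by rewrite ge_min lexx orbT.
have ep2 : ep < ep0.
  by apply: (@le_lt_trans _ _ (ep0 / 2)); [rewrite ge_min lexx|lra].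
have fnn x : enorm (x - z) <= s -> dotv x e <= lam -> 0 <= f x.
  move=> xs; rewrite le_eqVlt => /orP[/eqP xl|xl]; first by rewrite refl_id // subrr.
  by have [nx0 x1] := bx x xs; apply: Hnn => //; exact: ltW.
pose g x := f x - barrier e ep A z 0 0 x.
pose H := [set x | enorm (x - z) <= s] `&` [set x | dotv x e <= lam].
have ep2s : ep * (2 * s) <= 2 * ep.
  by rewrite mulrC ler_wpM2r ?(ltW epgt0) //; lra.
have [||||x [/= xs xl] xmin] := @EVT_min_closed R n H g (s + enorm z).
- by apply: closedI; [exact/closed_le_fun/continuous_enormB|exact/closed_le_fun/continuous_dotv_cst].
- by move=> x [/= xs _]; exact: bnd.
- by exists z; split; rewrite /= ?subrr ?enorm0 ?ze // ltW.
- move=> x [/= xs xl].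
  exact: (continuousB (fc x xs xl) (@continuous_barrier R n e ep A z 0 0 x)).
have gx : 0 <= g x.
  rewrite leNgt; apply/negP => gx.
  have fx := fnn x xs xl.
  have xlt : dotv x e < lam.
    rewrite lt_neqAle xl andbT; apply/eqP => xE; move: gx; rewrite /g barrierE.
    rewrite refl_id // subrr dotvBl ze xE subrr dotv0l expr0n mulr0 !add0r.
    by rewrite mulrN opprK ltNge mulr_ge0 ?(ltW epgt0) // dotvv_ge0.
  have xslt : enorm (x - z) < s.
    rewrite lt_neqAle xs andbT; apply/eqP => xE; move: gx; rewrite ltNge => /negP; apply.
    have [hl|hl] := leP (dotv (z - x) e) (s ^+ 2 / 4).
      have := barrier_sphere_le e1 epgt0 A0 sA s1 xE hl.
      have : 0 <= ep * (s ^+ 2 / 2) by rewrite mulr_ge0 ?divr_ge0 ?sqr_ge0 // ltW.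
      by rewrite /g /= in fx *; lra.
    have := barrier_le e1 epgt0 A0 sA xs.
    have : c <= f x.
      apply: hc; split; first by rewrite /= xE.
      by move: hl; rewrite dotvBl ze /=; lra.
    by rewrite /g /=; lra.
  have [nx0 x1] := bx x xs.
  apply: (h2 ep 0 0 x _ _ _ xlt nx0); rewrite ?epgt0 ?enorm0 ?(ltW epgt0) //.
  - exact: le_lt_trans ss'.
  - rewrite fx /=; have := barrier_le e1 epgt0 A0 sA xs.
    by move: gx; rewrite /g /=; lra.
  - have n2 : \forall y \near x, dotv y e < lam.
      exact: (@cvgr_lt _ _ (nbhs x) _ _ _ (@continuous_dotv_cst _ _ e x) _ xlt).
    apply: filterS (filterI (near_enorm_lt xslt) n2) => y [y1 y2].
    by apply: xmin; split; exact: ltW.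
exists s, ep; split => // t /andP[t0 ts].
have te : enorm (z - t *: e - z) = t.
  by rewrite addrAC subrr add0r enormN enormZ (enorm_unit e1) mulr1 ger0_norm.
have zte : dotv (z - t *: e) e = lam - t by rewrite dotvBl ze [dotv (t *: e) e]dotvZl e1 mulr1.
have Ht : H (z - t *: e).
  by split => /=; [rewrite te|rewrite zte; lra].
have := le_trans gx (xmin _ Ht).
have -> : z + t *: e = rx (z - t *: e).
  rewrite reflE zte -addrA; congr (_ + _).
  by rewrite -scaleNr -scalerDl; congr (_ *: _); ring.
have -> : g (z - t *: e) = f (z - t *: e) - ep * (t + (A - 1) * t ^+ 2).
  rewrite /g barrierE dotv0l !add0r -enorm_sqr te; congr (_ - ep * _).
  by rewrite subKr [dotv (t *: e) e]dotvZl e1; ring.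
have : 0 <= ep * ((A - 1) * t ^+ 2).
  by rewrite mulr_ge0 ?(ltW epgt0) // mulr_ge0 ?sqr_ge0 // subr_ge0.
rewrite /=; lra.
Qed.

(** Differentiability costs [ep t / 4] at each of the two points [z + t *: e] and [z - t *: e],
    which leaves half of the Hopf gap: [- 2 t D >= ep t / 2] for the derivative [D]. *)
Lemma radial_derivative_lt0 : 'D_e u z < 0.
Proof.
have [s [ep [s0 ep0 h]]] := hopf_lower_bound.
have zn : enorm z = lam by rewrite enormZ (enorm_unit e1) mulr1 gtr0_norm.
have Bz : B1 z by rewrite /punctured_ball /= zn lam0 lam1.
have du := C2_differentiable (sol_C2_on Hsol) Bz.
have ep4 : 0 < ep / 4 by rewrite divr_gt0.
have /nbhs_ballP[r /= r0 hr] := differentiable_expansion du ep4.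
pose t := Num.min s r / 2.
have mn0 : 0 < Num.min s r by rewrite lt_min s0 r0.
have t0 : 0 < t by rewrite divr_gt0.
have : t < Num.min s r by rewrite /t; lra.
rewrite !lt_min => /andP[ts tr].
have te : enorm (t *: e) = t by rewrite enormZ (enorm_unit e1) mulr1 gtr0_norm.
have b1 : ball 0 r (t *: e).
  by rewrite -ball_normE /= sub0r normrN (le_lt_trans (norm_le_enorm _)) // te.
have b2 : ball 0 r (- (t *: e)).
  by rewrite -ball_normE /= sub0r opprK (le_lt_trans (norm_le_enorm _)) // te.
have D1 : 'D_(t *: e) u z = t * 'D_e u z by rewrite !derive_gradE // dotvZr.
have D2 : 'D_(- (t *: e)) u z = - (t * 'D_e u z) by rewrite !derive_gradE // dotvNr dotvZr.
have tb : 0 <= t <= s by rewrite !ltW.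
have nb : ep / 4 * `|t *: e| <= ep / 4 * t.
  by rewrite ler_wpM2l ?(ltW ep4) // -[X in _ <= X]te norm_le_enorm.
have := h t tb; have := hr _ b1; have := hr _ b2.
rewrite D1 D2 normrN; move: ('D_e u z) => D.
rewrite !ler_norml => /andP[_ a1] /andP[a2 _] a3.
have : t * (2 * D + ep / 2) <= 0 by lra.
rewrite pmulr_rle0 //; lra.
Qed.

End Hopf.
End MovingPlanes.

Theorem corollary1p2 (R : realType) (n : nat) (hn : (1 <= n)%N)
  (eps : R) (heps : 0 < eps)
  (F : R -> R -> 'cV[R]_n -> 'M[R]_n -> R)
  (hFC1 : C1_on
     [set z : R * R * 'cV[R]_n * 'M[R]_n | 0 < z.1.1.1 < 1 + eps]
     (symF_uncurried F))
  (hFell : forall (r s : R) (p : 'cV[R]_n) (M : 'M[R]_n),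
     0 < r < 1 + eps -> M^T = M -> posdefmx (- dFdM F r s p M))
  (hFr : forall (r s : R) (p : 'cV[R]_n) (M : 'M[R]_n),
     0 < r < 1 + eps -> 0 < s -> M^T = M ->
     0 <= derive1 (fun t : R => F t s p M) r)
  (hFO : forall (r s : R) (p : 'cV[R]_n) (M O : 'M[R]_n),
     0 < r < 1 + eps -> 0 < s -> M^T = M -> real_orthomx O ->
     F r s (O^T *m p) (O^T *m M *m O) = F r s p M)
  (u : 'cV[R]_n -> R)
  (huC2 : C2_upto (punctured_ball 1) (punctured_cball 1) u)
  (rbar : R) (hrbar : 0 < rbar <= 1)
  (hsing : forall (V : 'cV[R]_n) (r : R), 0 < r < rbar ->
     exists x0 : 'cV[R]_n,
       [/\ esphere r x0,
           (forall x, esphere r x -> u x0 + dotv V x0 <= u x + dotv V x) &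
           ereal_inf [set (u x + dotv V x)%:E | x in punctured_ball r]
             = (u x0 + dotv V x0)%:E])
  (hpde : forall x : 'cV[R]_n, punctured_ball 1 x ->
     F (enorm x) (u x) (grad u x) (hess u x) = 0)
  (hupos : forall x : 'cV[R]_n, punctured_ball 1 x -> 0 < u x)
  (hubd : forall x : 'cV[R]_n, esphere 1 x -> u x = 0) :
  exists phi : R -> R,
    (forall x : 'cV[R]_n, punctured_cball 1 x -> u x = phi (enorm x)) /\
    (forall r : R, 0 < r < 1 -> derivable phi r 1 /\ derive1 phi r < 0).
Proof.
have Hsol : singular_solution eps F u rbar by split.
case: n hn F hFC1 hFell hFr hFO u huC2 hsing hpde hupos hubd Hsol
  => // n' _ F' _ _ _ _ u' _ _ _ _ _ Hsol.
(* The assumption [1 <= n] supplies a coordinate axis; the profile is [u] along it. *)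
pose e : 'cV[R]_n'.+1 := delta_mx ord0 0.
have e1 : dotv e e = 1 by rewrite dotv_delta mxE !eqxx.
exists (fun r => u' (0 + r *: e)); split => [x|r /andP[r0 r1]].
  move=> /[dup] xK /andP[x0 x1]; apply: (u_radial Hsol) => //.
  by rewrite add0r enormZ (enorm_unit e1) mulr1 ger0_norm // ltW.
have Br : punctured_ball 1 (0 + r *: e).
  by rewrite /punctured_ball /= add0r enormZ (enorm_unit e1) mulr1 gtr0_norm // r0 r1.
have dr := is_derive_line (@diff_derivable _ _ _ u' _ e (C2_differentiable (sol_C2_on Hsol) Br)).
split; first by have [] := dr.
rewrite derive1E; have [_ ->] := dr.
by rewrite add0r; exact: (radial_derivative_lt0 Hsol).
Qed.
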